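(* Let $F\colon\mathcal C\to\mathcal D$ be a perfect pivotal tensor functor between pivotal finite tensor categories and $\mathcal M$ a pivotal $\mathcal D$-module category with pivotal structure $\tilde{\mathfrak p}\colon\mathrm{id}_{\mathcal M}\Rightarrow\mathbb S^{\mathcal D}_{\mathcal M}$. The $\mathcal C$-module category ${}_F\mathcal M$ is pivotal (i.e. admits a pivotal structure) if and only if $F$ is Frobenius with respect to $\mathcal M$. In that case, ${}_F\mathcal M$ is endowed with a pivotal structure given by the composite $$\mathrm{id}_{\mathcal M}=F^*(\mathrm{id}_{\mathcal M})\xrightarrow{F^*(\tilde{\mathfrak p})}F^*\bigl(\mathbb S^{\mathcal D}_{\mathcal M}\bigr)\cong\mathbb S^{\mathcal C}_{{}_F\mathcal M}.$$ In particular, if $F$ is $\otimes$-Frobenius, then the $\mathcal C$-module category ${}_F\mathcal M$ is pivotal.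
   Context: Work over an algebraically closed field $\Bbbk$. A finite tensor category is a finite $\Bbbk$-linear abelian rigid monoidal category with bilinear tensor product and $\mathrm{End}(\mathbb 1)\cong\Bbbk$; a tensor functor is an exact $\Bbbk$-linear strong monoidal functor. Right duals $c^\vee$ have $c^\vee\otimes c\to\mathbb 1$, $\mathbb 1\to c\otimes c^\vee$. A pivotal structure on $\mathcal C$ is a monoidal natural isomorphism $\mathfrak p\colon\mathrm{id}\cong(-)^{\vee\vee}$. $F$ is pivotal if $\zeta_c^\vee\circ\mathfrak p^{\mathcal D}_{F(c)}=\zeta_{c^\vee}\circ F(\mathfrak p^{\mathcal C}_c)$ with $\zeta_c\colon F(c^\vee)\cong F(c)^\vee$ canonical. $F^{\mathrm{la}},F^{\mathrm{ra}}$ are adjoints, $F^{\mathrm{rra}}=(F^{\mathrm{ra}})^{\mathrm{ra}}$; $F$ is perfect if $F^{\mathrm{ra}}$ is exact. Let ${}_F\mathcal D_F$ be $\mathcal D$ as a $\mathcal C$-bimodule category via $F(c)\otimes d\otimes F(c')$; $F\colon\mathcal C\to{}_F\mathcal D_F$ and its iterated adjoints are $\mathcal C$-bimodule functors. $F$ is $\otimes$-Frobenius if $F^{\mathrm{la}}\cong F^{\mathrm{ra}}$ as $\mathcal C$-bimodule functors. A module category (finite $\Bbbk$-linear category with action exact in each variable) is exact if $p\triangleright m$ is projective for all projective $p$ and all $m$. ${}_F\mathcal M$ is $\mathcal M$ with $\mathcal C$-action $c\triangleright^Fm=F(c)\triangleright m$; for a $\mathcal D$-module functor $H$, $F^*(H)$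 is $H$ viewed as a functor of $F$-twisted $\mathcal C$-module categories. With internal Homs $\mathrm{Hom}_{\mathcal M}(d\triangleright m,n)\cong\mathrm{Hom}_{\mathcal D}(d,\underline{\mathrm{Hom}}(m,n))$, the relative Serre functor of an exact $\mathcal D$-module category is the essentially unique $\mathbb S^{\mathcal D}_{\mathcal M}\colon\mathcal M\to\mathcal M$ with $\underline{\mathrm{Hom}}(m,n)^\vee\cong\underline{\mathrm{Hom}}(n,\mathbb S^{\mathcal D}_{\mathcal M}(m))$ naturally; canonically $\mathbb S(d\triangleright m)\cong d^{\vee\vee}\triangleright\mathbb S(m)$. When $\mathcal D$ is pivotal, identifying $d^{\vee\vee}$ with $d$ by $\mathfrak p_d$ makes $\mathbb S^{\mathcal D}_{\mathcal M}$ a $\mathcal D$-module functor. A pivotal structure on an exact $\mathcal M$ is a $\mathcal D$-module natural isomorphism $\mathrm{id}_{\mathcal M}\cong\mathbb S^{\mathcal D}_{\mathcal M}$; a pivotal module category is an exact module category with a pivotal structure. The relative modular object $\chi_F:=F^{\mathrm{rra}}(\mathbb 1)\in\mathcal D$ carries the half-braiding $\sigma_c\colon\chi_F\otimes F(c)\cong F^{\mathrm{rra}}(c)\cong F(c)\otimes\chi_F$ from the bimodule structure of $F^{\mathrm{rra}}$, making $\chi_F\triangleright-\colon{}_F\mathcal M\to{}_F\mathcal M$ a $\mathcal C$-module functor via $\sigma_c\triangleright\mathrm{id}$. $F$ is Frobenius with respect to $\mathcal M$ if $\chi_F\triangleright-\cong\mathrm{id}_{{}_F\mathcal M}$ as $\mathcal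 C$-module functors. In the displayed composite, the last isomorphism comes from the isomorphism of twisted $\mathcal C$-module functors $\chi_F\triangleright F^*(\mathbb S^{\mathcal D}_{\mathcal M})\cong\mathbb S^{\mathcal C}_{{}_F\mathcal M}$ (valid for any perfect $F$ and exact $\mathcal M$) and a chosen trivialization of $\chi_F\triangleright-$. *)

(* Defs.v *)
(* Finite tensor categories and their module categories, over a field k.
   Hom spaces are finite-dimensional throughout, as they are in every finite
   k-linear category. *)
#[warnings="-notation-overridden"]
From mathcomp Require Import all_boot all_order all_algebra.
#[warnings="-notation-overridden"]
From mathcomp Require Import boolp classical_sets.

Set Implicit Arguments.
Unset Strict Implicit.
Unset Printing Implicit Defensive.

Import GRing.Theory.
Local Open Scope ring_scope.

Local Obligation Tactic := idtac.

Declare Scope cat_scope.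
Delimit Scope cat_scope with cat.

Record lincat (k : fieldType) : Type := LinCat {
  obj :> Type;
  mor : obj -> obj -> vectType k;
  idm : forall x, mor x x;
  cmp : forall x y z, mor y z -> mor x y -> mor x z;
  cmp1m : forall x y (f : mor x y), cmp (idm y) f = f;
  cmpm1 : forall x y (f : mor x y), cmp f (idm x) = f;
  cmpA : forall w x y z (h : mor y z) (g : mor x y) (f : mor w x),
    cmp h (cmp g f) = cmp (cmp h g) f;
  cmp_linl : forall x y z a (g g' : mor y z) (f : mor x y),
    cmp (a *: g + g') f = a *: cmp g f + cmp g' f;
  cmp_linr : forall x y z a (g : mor y z) (f f' : mor x y),
    cmp g (a *: f + f') = a *: cmp g f + cmp g f'
}.

Arguments mor {k} {l} x y.
Arguments idm {k l} x.
Arguments cmp {k l x y z} g f.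

Notation "g ∘ f" := (cmp g f) (at level 40, left associativity) : cat_scope.
Local Open Scope cat_scope.

Section LinCat.
Variables (k : fieldType) (A : lincat k).
Implicit Types x y z : A.

Definition is_inverse x y (f : mor x y) (g : mor y x) : Prop :=
  g ∘ f = idm x /\ f ∘ g = idm y.

Definition is_iso x y (f : mor x y) : Prop := exists g, is_inverse f g.

(* The inverse of f when f is invertible, and 0 otherwise (in the style of
   x^-1 in a field).  It is only ever applied to morphisms that are
   isomorphisms, by hypothesis or by rigidity. *)
Definition isoinv x y (f : mor x y) : mor y x := xget 0 (is_inverse f).

Definition is_mono x y (f : mor x y) : Prop :=
  forall w (g h : mor w x), f ∘ g = f ∘ h -> g = h.

Definition is_epi x y (f : mor x y) : Prop :=
  forall z (g h : mor y z), g ∘ f = h ∘ f -> g = h.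

Definition is_zero_obj x : Prop :=
  forall y, (forall f : mor x y, f = 0) /\ (forall f : mor y x, f = 0).

Definition is_biproduct x y z
  (i1 : mor x z) (i2 : mor y z) (p1 : mor z x) (p2 : mor z y) : Prop :=
  [/\ p1 ∘ i1 = idm x, p2 ∘ i2 = idm y, p1 ∘ i2 = 0, p2 ∘ i1 = 0
    & i1 ∘ p1 + i2 ∘ p2 = idm z].

Definition is_kernel a x y (i : mor a x) (f : mor x y) : Prop :=
  f ∘ i = 0 /\
  forall w (g : mor w x), f ∘ g = 0 -> exists! h : mor w a, i ∘ h = g.

Definition is_cokernel x y b (p : mor y b) (f : mor x y) : Prop :=
  p ∘ f = 0 /\
  forall z (g : mor y z), g ∘ f = 0 -> exists! h : mor b z, h ∘ p = g.

Definition short_exact a x b (i : mor a x) (p : mor x b) : Prop :=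
  is_kernel i p /\ is_cokernel p i.

Definition projective (p : A) : Prop :=
  forall x y (e : mor x y) (f : mor p y), is_epi e ->
    exists g : mor p x, e ∘ g = f.

Definition simple_obj (s : A) : Prop :=
  ~ is_zero_obj s /\
  forall a (i : mor a s), is_mono i -> is_zero_obj a \/ is_iso i.

Inductive finite_length : A -> Prop :=
| FL_zero x : is_zero_obj x -> finite_length x
| FL_ext a x b (i : mor a x) (p : mor x b) :
    short_exact i p -> simple_obj a -> finite_length b -> finite_length x.

End LinCat.

Record abelian_cat (k : fieldType) (A : lincat k) : Prop := AbelianCat {
  ab_zero : exists z : A, is_zero_obj z;
  ab_biprod : forall x y : A, exists z (i1 : mor x z) (i2 : mor y z)
    (p1 : mor z x) (p2 : mor z y), is_biproduct i1 i2 p1 p2;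
  ab_ker : forall (x y : A) (f : mor x y),
    exists a (i : mor a x), is_kernel i f;
  ab_coker : forall (x y : A) (f : mor x y),
    exists b (p : mor y b), is_cokernel p f;
  ab_mono : forall (x y : A) (f : mor x y), is_mono f ->
    exists z (g : mor y z), is_kernel f g;
  ab_epi : forall (x y : A) (f : mor x y), is_epi f ->
    exists w (g : mor w x), is_cokernel f g
}.

(* Finiteness in the intrinsic form of Etingof-Gelaki-Nikshych-Ostrik
   (finite-dimensionality of Hom is part of lincat). *)
Record finite_cat (k : fieldType) (A : lincat k) : Prop := FiniteCat {
  fin_abelian : abelian_cat A;
  fin_length : forall x : A, finite_length x;
  fin_proj : forall x : A, exists (p : A) (e : mor p x),
    projective p /\ is_epi e;
  fin_simple : exists (n : nat) (r : 'I_n -> A),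
    forall s : A, simple_obj s -> exists (i : 'I_n) (f : mor s (r i)), is_iso f
}.

Section IsoLemmas.
Variables (k : fieldType) (A : lincat k).
Implicit Types x y z : A.

Lemma isoinvP x y (f : mor x y) : is_iso f -> is_inverse f (isoinv f).
Proof. by move=> fiso; apply: xgetPex. Qed.

Lemma isoinvK x y (f : mor x y) : is_iso f -> isoinv f ∘ f = idm x.
Proof. by case/isoinvP. Qed.

Lemma isoinvKV x y (f : mor x y) : is_iso f -> f ∘ isoinv f = idm y.
Proof. by case/isoinvP. Qed.

Lemma is_iso_cmp x y z (g : mor y z) (f : mor x y) :
  is_iso g -> is_iso f -> is_iso (g ∘ f).
Proof.
move=> [g' [gK gKV]] [f' [fK fKV]]; exists (f' ∘ g'); split.
  by rewrite -cmpA (cmpA g' g f) gK cmp1m.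
by rewrite -cmpA (cmpA f f' g') fKV cmp1m.
Qed.

Lemma is_iso_inv x y (f : mor x y) : is_iso f -> is_iso (isoinv f).
Proof. by move=> /isoinvP[fK fKV]; exists f; split. Qed.

Lemma is_iso_idm x : is_iso (idm x).
Proof. by exists (idm x); split; rewrite cmp1m. Qed.

Lemma isoinv_square x x' y y' (f : mor x y) (f' : mor x' y')
    (u : mor x x') (v : mor y y') :
  is_iso f -> is_iso f' -> f' ∘ u = v ∘ f -> isoinv f' ∘ v = u ∘ isoinv f.
Proof.
move=> fiso f'iso fE.
by rewrite -[LHS]cmpm1 -(isoinvKV fiso) cmpA -(cmpA _ v) -fE cmpA isoinvK ?cmp1m.
Qed.

Lemma iso_epic x y (f : mor x y) : is_iso f -> is_epi f.
Proof.
move=> [f' [_ fKV]] w g h /(congr1 (fun u => u ∘ f')).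
by rewrite -!cmpA fKV !cmpm1.
Qed.

End IsoLemmas.

Record functor (k : fieldType) (A B : lincat k) : Type := Functor {
  fobj :> A -> B;
  fmap : forall x y, mor x y -> mor (fobj x) (fobj y);
  fmap_lin : forall x y a (f g : mor x y),
    fmap (a *: f + g) = a *: fmap f + fmap g;
  fmap1 : forall x, fmap (idm x) = idm (fobj x);
  fmapM : forall x y z (g : mor y z) (f : mor x y),
    fmap (g ∘ f) = fmap g ∘ fmap f
}.

Arguments fmap {k A B} f {x y} _ : rename.

Definition exact_functor (k : fieldType) (A B : lincat k) (G : functor A B) :
  Prop :=
  forall a x b (i : mor a x) (p : mor x b),
    short_exact i p -> short_exact (fmap G i) (fmap G p).

Definition idF (k : fieldType) (A : lincat k) : functor A A :=
  Functor (fobj := fun x : A => x) (fmap := fun x y f => f)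
    (fun _ _ _ _ _ => erefl) (fun _ => erefl) (fun _ _ _ _ _ => erefl).

Program Definition compF (k : fieldType) (A B E : lincat k)
  (G : functor B E) (H : functor A B) : functor A E :=
  Functor (fobj := fun x => G (H x)) (fmap := fun x y f => fmap G (fmap H f))
    _ _ _.
Next Obligation. by move=> k A B E G H x y a f g /=; rewrite !fmap_lin. Qed.
Next Obligation. by move=> k A B E G H x /=; rewrite !fmap1. Qed.
Next Obligation. by move=> k A B E G H x y z g f /=; rewrite !fmapM. Qed.

Definition natural_iso (k : fieldType) (A B : lincat k) (G H : functor A B)
  (t : forall x, mor (G x) (H x)) : Prop :=
  (forall x y (f : mor x y), t y ∘ fmap G f = fmap H f ∘ t x) /\
  (forall x, is_iso (t x)).

Arguments natural_iso {k A B} G H t.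

Record adjunction (k : fieldType) (A B : lincat k)
  (L : functor A B) (R : functor B A) : Type := Adjunction {
  aunit : forall x : A, mor x (R (L x));
  acounit : forall y : B, mor (L (R y)) y;
  aunit_nat : forall x x' (f : mor x x'),
    aunit x' ∘ f = fmap R (fmap L f) ∘ aunit x;
  acounit_nat : forall y y' (g : mor y y'),
    g ∘ acounit y = acounit y' ∘ fmap L (fmap R g);
  adj_triL : forall x, acounit (L x) ∘ fmap L (aunit x) = idm (L x);
  adj_triR : forall y, fmap R (acounit y) ∘ aunit (R y) = idm (R y)
}.

Record bifunctor (k : fieldType) (A B E : lincat k) : Type := Bifunctor {
  bobj :> A -> B -> E;
  bmap : forall x x' y y', mor x x' -> mor y y' ->
    mor (bobj x y) (bobj x' y');
  bmap_linl : forall x x' y y' a (f f' : mor x x') (g : mor y y'),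
    bmap (a *: f + f') g = a *: bmap f g + bmap f' g;
  bmap_linr : forall x x' y y' a (f : mor x x') (g g' : mor y y'),
    bmap f (a *: g + g') = a *: bmap f g + bmap f g';
  bmap1 : forall x y, bmap (idm x) (idm y) = idm (bobj x y);
  bmapM : forall x x' x'' y y' y''
    (f' : mor x' x'') (f : mor x x') (g' : mor y' y'') (g : mor y y'),
    bmap (f' ∘ f) (g' ∘ g) = bmap f' g' ∘ bmap f g
}.

Arguments bmap {k A B E} b {x x' y y'} _ _ : rename.

Section Bifunctor.
Variables (k : fieldType) (A B E : lincat k) (T : bifunctor A B E).

Program Definition bfixl (x : A) : functor B E :=
  Functor (fobj := fun y => T x y) (fmap := fun y y' g => bmap T (idm x) g)
    _ _ _.
Next Obligation. by move=> * /=; rewrite bmap_linr. Qed.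
Next Obligation. by move=> * /=; rewrite bmap1. Qed.
Next Obligation. by move=> * /=; rewrite -bmapM cmp1m. Qed.

Program Definition bfixr (y : B) : functor A E :=
  Functor (fobj := fun x => T x y) (fmap := fun x x' f => bmap T f (idm y))
    _ _ _.
Next Obligation. by move=> * /=; rewrite bmap_linl. Qed.
Next Obligation. by move=> * /=; rewrite bmap1. Qed.
Next Obligation. by move=> * /=; rewrite -bmapM cmp1m. Qed.

Lemma bmap_iso x x' y y' (f : mor x x') (g : mor y y') :
  is_iso f -> is_iso g -> is_iso (bmap T f g).
Proof.
move=> [f' [fK fKV]] [g' [gK gKV]]; exists (bmap T f' g').
by split; rewrite -bmapM ?fK ?gK ?fKV ?gKV bmap1.
Qed.

End Bifunctor.

Program Definition bprecomp (k : fieldType) (A' A B E : lincat k)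
  (T : bifunctor A B E) (G : functor A' A) : bifunctor A' B E :=
  Bifunctor (bobj := fun x y => T (G x) y)
    (bmap := fun x x' y y' f g => bmap T (fmap G f) g) _ _ _ _.
Next Obligation. by move=> * /=; rewrite fmap_lin bmap_linl. Qed.
Next Obligation. by move=> * /=; rewrite bmap_linr. Qed.
Next Obligation. by move=> * /=; rewrite fmap1 bmap1. Qed.
Next Obligation. by move=> * /=; rewrite fmapM bmapM. Qed.

Record monoidal (k : fieldType) : Type := Monoidal {
  mon_cat :> lincat k;
  tens : bifunctor mon_cat mon_cat mon_cat;
  munit : mon_cat;
  massoc : forall x y z, mor (tens (tens x y) z) (tens x (tens y z));
  massoc_iso : forall x y z, is_iso (massoc x y z);
  massoc_nat : forall x x' y y' z z'
    (f : mor x x') (g : mor y y') (h : mor z z'),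
    massoc x' y' z' ∘ bmap tens (bmap tens f g) h =
    bmap tens f (bmap tens g h) ∘ massoc x y z;
  mlun : forall x, mor (tens munit x) x;
  mlun_iso : forall x, is_iso (mlun x);
  mlun_nat : forall x x' (f : mor x x'),
    mlun x' ∘ bmap tens (idm munit) f = f ∘ mlun x;
  mrun : forall x, mor (tens x munit) x;
  mrun_iso : forall x, is_iso (mrun x);
  mrun_nat : forall x x' (f : mor x x'),
    mrun x' ∘ bmap tens f (idm munit) = f ∘ mrun x;
  mpentagon : forall w x y z,
    massoc w x (tens y z) ∘ massoc (tens w x) y z =
    bmap tens (idm w) (massoc x y z) ∘ massoc w (tens x y) z
      ∘ bmap tens (massoc w x y) (idm z);
  mtriangle : forall x y,
    bmap tens (idm x) (mlun y) ∘ massoc x munit y =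
    bmap tens (mrun x) (idm y)
}.

Arguments tens {k C} : rename.
Arguments munit {k C} : rename.
Arguments massoc {k C} x y z : rename.
Arguments mlun {k C} x : rename.
Arguments mrun {k C} x : rename.

Notation "x ⊗ y" := (bobj tens x y)
  (at level 37, left associativity) : cat_scope.
Notation "f ⊗₁ g" := (bmap tens f g)
  (at level 37, left associativity) : cat_scope.
Notation "'𝟙'" := munit (at level 0) : cat_scope.

(* y is a right dual of x, with e : y ⊗ x -> 1 and c : 1 -> x ⊗ y
   (equivalently, x is a left dual of y). *)
Definition is_rdual (k : fieldType) (C : monoidal k) (x y : C)
  (e : mor (y ⊗ x) 𝟙) (c : mor 𝟙 (x ⊗ y)) : Prop :=
  mrun x ∘ (idm x ⊗₁ e) ∘ massoc x y x ∘ (c ⊗₁ idm x) = mlun x /\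
  mlun y ∘ (e ⊗₁ idm y) ∘ isoinv (massoc y x y) ∘ (idm y ⊗₁ c) = mrun y.

Record ftcat (k : fieldType) : Type := FTCat {
  ft_mon :> monoidal k;
  ft_finite : finite_cat ft_mon;
  ft_end1 : forall f : mor (𝟙 : ft_mon) 𝟙, exists! a : k, f = a *: idm 𝟙;
  rdual : ft_mon -> ft_mon;
  rdev : forall x, mor (rdual x ⊗ x) 𝟙;
  rdcoev : forall x, mor 𝟙 (x ⊗ rdual x);
  rdualP : forall x, is_rdual (rdev x) (rdcoev x);
  ldual_ex : forall x : ft_mon,
    exists y (e : mor (x ⊗ y) 𝟙) (c : mor 𝟙 (y ⊗ x)), is_rdual e c
}.

Arguments rdual {k f} x : rename.
Arguments rdev {k f} x : rename.
Arguments rdcoev {k f} x : rename.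

Notation "x ^∨" := (rdual x) (at level 2, left associativity) : cat_scope.

Section Duals.
Variables (k : fieldType) (C : ftcat k).
Implicit Types x y z : C.

(* The morphism z -> x^∨ corresponding to f under
   Hom(z ⊗ x, 1) ≅ Hom(z, x^∨). *)
Definition transpose z x (f : mor (z ⊗ x) 𝟙) : mor z (x^∨) :=
  mlun (x^∨) ∘ (f ⊗₁ idm (x^∨)) ∘ isoinv (massoc z x (x^∨))
    ∘ (idm z ⊗₁ rdcoev x) ∘ isoinv (mrun z).

Definition dualm x y (f : mor x y) : mor (y^∨) (x^∨) :=
  transpose (rdev y ∘ (idm (y^∨) ⊗₁ f)).

(* y^∨ ⊗ x^∨ ≅ (x ⊗ y)^∨ *)
Definition dual_tens x y : mor (y^∨ ⊗ x^∨) ((x ⊗ y)^∨) :=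
  transpose (rdev y
    ∘ (idm (y^∨) ⊗₁ (mlun y ∘ (rdev x ⊗₁ idm y) ∘ isoinv (massoc (x^∨) x y)))
    ∘ massoc (y^∨) (x^∨) (x ⊗ y)).

(* 1 ≅ 1^∨ *)
Definition dual_unit : mor (𝟙 : C) (𝟙^∨) := transpose (mlun 𝟙).

(* The monoidal structure of the double dual functor:
   x^∨∨ ⊗ y^∨∨ ≅ (x ⊗ y)^∨∨ and 1 ≅ 1^∨∨. *)
Definition ddual_tens x y : mor (x^∨^∨ ⊗ y^∨^∨) ((x ⊗ y)^∨^∨) :=
  isoinv (dualm (dual_tens x y)) ∘ dual_tens (y^∨) (x^∨).

Definition ddual_unit : mor (𝟙 : C) (𝟙^∨^∨) :=
  isoinv (dualm dual_unit) ∘ dual_unit.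

End Duals.

Record pivotal_ftcat (k : fieldType) : Type := PivotalFTCat {
  pv_ft :> ftcat k;
  piv : forall x : pv_ft, mor x (x^∨^∨);
  piv_iso : forall x, is_iso (piv x);
  piv_nat : forall x y (f : mor x y), piv y ∘ f = dualm (dualm f) ∘ piv x;
  piv_tens : forall x y, piv (x ⊗ y) = ddual_tens x y ∘ (piv x ⊗₁ piv y);
  piv_unit : piv 𝟙 = ddual_unit pv_ft
}.

Arguments piv {k p} x : rename.

Record tensor_functor (k : fieldType) (C D : ftcat k) : Type := TensorFunctor {
  tf_fun :> functor C D;
  tf_mu : forall x y, mor (tf_fun x ⊗ tf_fun y) (tf_fun (x ⊗ y));
  tf_mu_iso : forall x y, is_iso (tf_mu x y);
  tf_mu_nat : forall x x' y y' (f : mor x x') (g : mor y y'),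
    tf_mu x' y' ∘ (fmap tf_fun f ⊗₁ fmap tf_fun g) =
    fmap tf_fun (f ⊗₁ g) ∘ tf_mu x y;
  tf_eps : mor 𝟙 (tf_fun 𝟙);
  tf_eps_iso : is_iso tf_eps;
  tf_assoc : forall x y z,
    fmap tf_fun (massoc x y z) ∘ tf_mu (x ⊗ y) z
      ∘ (tf_mu x y ⊗₁ idm (tf_fun z)) =
    tf_mu x (y ⊗ z) ∘ (idm (tf_fun x) ⊗₁ tf_mu y z)
      ∘ massoc (tf_fun x) (tf_fun y) (tf_fun z);
  tf_lun : forall x,
    fmap tf_fun (mlun x) ∘ tf_mu 𝟙 x ∘ (tf_eps ⊗₁ idm (tf_fun x)) =
    mlun (tf_fun x);
  tf_run : forall x,
    fmap tf_fun (mrun x) ∘ tf_mu x 𝟙 ∘ (idm (tf_fun x) ⊗₁ tf_eps) =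
    mrun (tf_fun x);
  tf_exact : exact_functor tf_fun
}.

Arguments tf_mu {k C D} F x y : rename.
Arguments tf_eps {k C D} F : rename.

Lemma tf_assoc_inv (k : fieldType) (C D : ftcat k) (F : tensor_functor C D)
    (x y z : C) :
  massoc (F x) (F y) (F z) ∘ ((isoinv (tf_mu F x y) ⊗₁ idm (F z))
    ∘ isoinv (tf_mu F (x ⊗ y) z)) =
  (idm (F x) ⊗₁ isoinv (tf_mu F y z)) ∘ (isoinv (tf_mu F x (y ⊗ z))
    ∘ fmap F (massoc x y z)).
Proof.
have /iso_epic epi : is_iso (tf_mu F (x ⊗ y) z ∘ (tf_mu F x y ⊗₁ idm (F z))).
  apply: is_iso_cmp; first exact: tf_mu_iso.
  by apply: bmap_iso; [exact: tf_mu_iso | exact: is_iso_idm].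
apply: epi; rewrite -!cmpA [in RHS](cmpA (fmap F _)) tf_assoc.
rewrite (cmpA (isoinv (tf_mu F (x ⊗ y) z))) isoinvK ?cmp1m; last first.
  exact: tf_mu_iso.
rewrite -bmapM cmp1m isoinvK ?bmap1 ?cmpm1; last exact: tf_mu_iso.
rewrite -!cmpA (cmpA (isoinv (tf_mu F x (y ⊗ z)))) isoinvK ?cmp1m; last first.
  exact: tf_mu_iso.
rewrite cmpA -bmapM cmp1m isoinvK ?bmap1 ?cmp1m //; exact: tf_mu_iso.
Qed.

(* ζ_c : F(c^∨) ≅ F(c)^∨ *)
Definition tf_dual (k : fieldType) (C D : ftcat k) (F : tensor_functor C D)
  (c : C) : mor (F (c^∨)) ((F c)^∨) :=
  transpose (isoinv (tf_eps F) ∘ fmap F (rdev c) ∘ tf_mu F (c^∨) c).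

Definition pivotal_functor (k : fieldType) (C D : pivotal_ftcat k)
  (F : tensor_functor C D) : Prop :=
  forall c : C,
    dualm (tf_dual F c) ∘ piv (F c) = tf_dual F (c^∨) ∘ fmap F (piv c).

Record left_adjoint (k : fieldType) (C D : ftcat k) (F : tensor_functor C D) :
  Type := LeftAdjoint {
  la :> functor D C;
  la_adj : adjunction la F
}.

Record right_adjoints (k : fieldType) (C D : ftcat k)
  (F : tensor_functor C D) : Type := RightAdjoints {
  ra : functor D C;
  ra_adj : adjunction F ra;
  rra : functor C D;
  rra_adj : adjunction ra rra
}.

Section Adjoints.
Variables (k : fieldType) (C D : ftcat k) (F : tensor_functor C D).
Variable (R : right_adjoints F).

Definition perfect : Prop := exact_functor (ra R).

(* The C-bimodule structures of the iterated adjoints of F : C -> _F D_F are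
   the mates of the structure tf_mu of F itself. *)

(* c ⊗ F^ra(d) ≅ F^ra(F(c) ⊗ d) *)
Definition ra_left (c : C) (d : D) : mor (c ⊗ ra R d) (ra R (F c ⊗ d)) :=
  fmap (ra R) ((idm (F c) ⊗₁ acounit (ra_adj R) d)
                 ∘ isoinv (tf_mu F c (ra R d)))
    ∘ aunit (ra_adj R) (c ⊗ ra R d).

(* F^ra(d) ⊗ c ≅ F^ra(d ⊗ F(c)) *)
Definition ra_right (d : D) (c : C) : mor (ra R d ⊗ c) (ra R (d ⊗ F c)) :=
  fmap (ra R) ((acounit (ra_adj R) d ⊗₁ idm (F c))
                 ∘ isoinv (tf_mu F (ra R d) c))
    ∘ aunit (ra_adj R) (ra R d ⊗ c).

(* F(c) ⊗ F^rra(x) ≅ F^rra(c ⊗ x) *)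
Definition rra_left (c x : C) : mor (F c ⊗ rra R x) (rra R (c ⊗ x)) :=
  fmap (rra R) ((idm c ⊗₁ acounit (rra_adj R) x)
                  ∘ isoinv (ra_left c (rra R x)))
    ∘ aunit (rra_adj R) (F c ⊗ rra R x).

(* F^rra(x) ⊗ F(c) ≅ F^rra(x ⊗ c) *)
Definition rra_right (x c : C) : mor (rra R x ⊗ F c) (rra R (x ⊗ c)) :=
  fmap (rra R) ((acounit (rra_adj R) x ⊗₁ idm c)
                  ∘ isoinv (ra_right (rra R x) c))
    ∘ aunit (rra_adj R) (rra R x ⊗ F c).

Definition chi : D := rra R 𝟙.

(* σ_c : χ_F ⊗ F(c) ≅ F^rra(1 ⊗ c) ≅ F^rra(c) ≅ F^rra(c ⊗ 1) ≅ F(c) ⊗ χ_F *)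
Definition chi_braid (c : C) : mor (chi ⊗ F c) (F c ⊗ chi) :=
  isoinv (rra_left c 𝟙) ∘ fmap (rra R) (isoinv (mrun c) ∘ mlun c)
    ∘ rra_right 𝟙 c.

Variable (L : left_adjoint F).

(* F^la(F(c) ⊗ d) ≅ c ⊗ F^la(d) *)
Definition la_left (c : C) (d : D) : mor (L (F c ⊗ d)) (c ⊗ L d) :=
  acounit (la_adj L) (c ⊗ L d)
    ∘ fmap L (tf_mu F c (L d) ∘ (idm (F c) ⊗₁ aunit (la_adj L) d)).

(* F^la(d ⊗ F(c)) ≅ F^la(d) ⊗ c *)
Definition la_right (d : D) (c : C) : mor (L (d ⊗ F c)) (L d ⊗ c) :=
  acounit (la_adj L) (L d ⊗ c)
    ∘ fmap L (tf_mu F (L d) c ∘ (aunit (la_adj L) d ⊗₁ idm (F c))).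

(* F^la ≅ F^ra as C-bimodule functors *)
Definition tensor_frobenius : Prop :=
  exists t : forall d, mor (L d) (ra R d),
    [/\ natural_iso L (ra R) t,
        forall c d,
          t (F c ⊗ d) = ra_left c d ∘ (idm c ⊗₁ t d) ∘ la_left c d
      & forall d c,
          t (d ⊗ F c) = ra_right d c ∘ (t d ⊗₁ idm c) ∘ la_right d c].

End Adjoints.

Record modcat (k : fieldType) (D : ftcat k) : Type := ModCat {
  mod_cat :> lincat k;
  mod_finite : finite_cat mod_cat;
  act : bifunctor D mod_cat mod_cat;
  act_exactl : forall d, exact_functor (bfixl act d);
  act_exactr : forall m, exact_functor (bfixr act m);
  aassoc : forall d d' m, mor (act (d ⊗ d') m) (act d (act d' m));
  aassoc_iso : forall d d' m, is_iso (aassoc d d' m);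
  aassoc_nat : forall d d' e e' m m'
    (f : mor d d') (g : mor e e') (h : mor m m'),
    aassoc d' e' m' ∘ bmap act (f ⊗₁ g) h =
    bmap act f (bmap act g h) ∘ aassoc d e m;
  alun : forall m, mor (act 𝟙 m) m;
  alun_iso : forall m, is_iso (alun m);
  alun_nat : forall m m' (f : mor m m'),
    alun m' ∘ bmap act (idm 𝟙) f = f ∘ alun m;
  apentagon : forall d d' d'' m,
    aassoc d d' (act d'' m) ∘ aassoc (d ⊗ d') d'' m =
    bmap act (idm d) (aassoc d' d'' m) ∘ aassoc d (d' ⊗ d'') m
      ∘ bmap act (massoc d d' d'') (idm m);
  atriangle : forall d m,
    bmap act (idm d) (alun m) ∘ aassoc d 𝟙 m = bmap act (mrun d) (idm m)
}.

Arguments act {k D M} : rename.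
Arguments aassoc {k D M} d d' m : rename.
Arguments alun {k D M} m : rename.

Notation "d ▷ m" := (bobj act d m)
  (at level 38, right associativity) : cat_scope.
Notation "f ▷₁ g" := (bmap act f g)
  (at level 38, right associativity) : cat_scope.

Definition exact_module (k : fieldType) (D : ftcat k) (M : modcat D) : Prop :=
  forall (p : D) (m : M), projective p -> projective (p ▷ m).

Section Twist.
Variables (k : fieldType) (C D : ftcat k) (F : tensor_functor C D).
Variable M : modcat D.

Definition twist_assoc (c c' : C) (m : M) :
  mor (F (c ⊗ c') ▷ m) (F c ▷ F c' ▷ m) :=
  aassoc (F c) (F c') m ∘ (isoinv (tf_mu F c c') ▷₁ idm m).

Definition twist_lun (m : M) : mor (F 𝟙 ▷ m) m :=
  alun m ∘ (isoinv (tf_eps F) ▷₁ idm m).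

(* The module category _F M. *)
Program Definition twist : modcat C :=
  @ModCat k C M (mod_finite M) (bprecomp act F) _ _
    twist_assoc _ _ twist_lun _ _ _ _.
Next Obligation.
by move=> c a x b i p /(act_exactl (F c)); rewrite /= fmap1.
Qed.
Next Obligation.
move=> m a x b i p ip; exact: (act_exactr m (tf_exact F ip)).
Qed.
Next Obligation.
move=> c c' m; apply: is_iso_cmp; first exact: aassoc_iso.
by apply: bmap_iso; [apply/is_iso_inv/tf_mu_iso | exact: is_iso_idm].
Qed.
Next Obligation.
move=> c d c' d' m m' f g h; rewrite /twist_assoc /= -cmpA -bmapM.
rewrite (isoinv_square (tf_mu_iso F c c') (tf_mu_iso F d d')
  (tf_mu_nat F f g)).
by rewrite cmpA -aassoc_nat -!cmpA -!bmapM cmpm1 cmp1m.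
Qed.
Next Obligation.
move=> m; apply: is_iso_cmp; first exact: alun_iso.
by apply: bmap_iso; [apply/is_iso_inv/tf_eps_iso | exact: is_iso_idm].
Qed.
Next Obligation.
move=> m m' f; rewrite /twist_lun /= fmap1 cmpA -alun_nat -!cmpA -!bmapM.
by rewrite !cmp1m !cmpm1.
Qed.
Next Obligation.
move=> c c' c'' m /=; rewrite /twist_assoc fmap1.
have split_l x y z (g : mor y z) (f : mor x y) :
    (g ∘ f) ▷₁ idm m = (g ▷₁ idm m) ∘ (f ▷₁ idm m).
  by rewrite -bmapM cmp1m.
have split_r d x y z (g : mor y z) (f : mor x y) :
    idm d ▷₁ (g ∘ f : mor (x : M) z) = (idm d ▷₁ g) ∘ (idm d ▷₁ f).
  by rewrite -bmapM cmp1m.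
have natl := aassoc_nat (isoinv (tf_mu F c c')) (idm (F c'')) (idm m).
have natr := aassoc_nat (idm (F c)) (isoinv (tf_mu F c' c'')) (idm m).
rewrite bmap1 in natl.
rewrite split_r -!cmpA (cmpA _ (aassoc (F (c ⊗ c')) _ _)) -natl.
rewrite (cmpA _ (aassoc (F c) (F (c' ⊗ c'')) m)) -natr.
rewrite !cmpA apentagon -!cmpA; congr (_ ∘ (_ ∘ _)).
by rewrite -!split_l tf_assoc_inv.
Qed.
Next Obligation.
move=> c m /=; rewrite /twist_assoc /twist_lun fmap1.
have nat := aassoc_nat (idm (F c)) (isoinv (tf_eps F)) (idm m).
rewrite -[X in X ▷₁ _](cmp1m (idm (F c))) bmapM -cmpA (cmpA _ (aassoc _ _ _)).
rewrite -nat !cmpA atriangle -!bmapM !cmp1m -tf_run -!cmpA.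
rewrite (cmpA _ _ (isoinv (tf_mu F c 𝟙))) -bmapM cmp1m.
rewrite (isoinvKV (tf_eps_iso F)) bmap1 cmp1m (isoinvKV (tf_mu_iso F c 𝟙)).
by rewrite cmpm1.
Qed.

End Twist.

(* The structure maps G(c ▷ m) -> T(c) ▷ G(m) of a functor G compatible with
   the actions up to a twist T : C -> C of the acting objects, where T is the
   identity for ordinary C-module functors, and the double dual for Serre
   functors.  The coherence axioms play no role in the notion of morphism. *)
Definition mod_constr (k : fieldType) (C : ftcat k) (M : modcat C)
  (T : C -> C) (G : functor M M) : Type :=
  forall (c : C) (m : M), mor (G (c ▷ m)) (T c ▷ G m).

Definition module_iso (k : fieldType) (C : ftcat k) (M : modcat C)
  (T : C -> C) (G H : functor M M)
  (sG : mod_constr T G) (sH : mod_constr T H)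
  (t : forall m, mor (G m) (H m)) : Prop :=
  natural_iso G H t /\
  forall c m, sH c m ∘ t (c ▷ m) = (idm (T c) ▷₁ t m) ∘ sG c m.

Definition id_constr (k : fieldType) (C : ftcat k) (M : modcat C) :
  mod_constr (M := M) id (idF M) := fun c m => idm (c ▷ m).

Arguments id_constr {k C} M c m : rename.

(* The natural bijection Hom(d ▷ m, n) ≅ Hom(d, ihom m n), presented by its
   universal element. *)
Record internal_homs (k : fieldType) (D : ftcat k) (M : modcat D) : Type :=
  InternalHoms {
  ihom : M -> M -> D;
  ihev : forall m n, mor (ihom m n ▷ m) n;
  ihcur : forall d m n, mor (d ▷ m) n -> mor d (ihom m n);
  ihcurK : forall d m n (f : mor (d ▷ m) n),
    ihev m n ∘ (ihcur f ▷₁ idm m) = f;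
  ihcur_uniq : forall d m n (g : mor d (ihom m n)),
    ihcur (ihev m n ∘ (g ▷₁ idm m)) = g
}.

Arguments ihom {k D M} H m n : rename.
Arguments ihev {k D M} H m n : rename.
Arguments ihcur {k D M} H {d m n} f : rename.

Section InternalHoms.
Variables (k : fieldType) (D : ftcat k) (M : modcat D) (H : internal_homs M).

Definition ihomr (m n n' : M) (f : mor n n') : mor (ihom H m n) (ihom H m n') :=
  ihcur H (f ∘ ihev H m n).

Definition ihoml (m m' n : M) (f : mor m m') : mor (ihom H m' n) (ihom H m n) :=
  ihcur H (ihev H m' n ∘ (idm (ihom H m' n) ▷₁ f)).

(* d ⊗ ihom m n ≅ ihom m (d ▷ n) *)
Definition ihom_actr (d : D) (m n : M) :
  mor (d ⊗ ihom H m n) (ihom H m (d ▷ n)) :=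
  ihcur H ((idm d ▷₁ ihev H m n) ∘ aassoc d (ihom H m n) m).

(* ihom (d ▷ m) n ≅ ihom m n ⊗ d^∨ *)
Definition ihom_actl (d : D) (m n : M) :
  mor (ihom H (d ▷ m) n) (ihom H m n ⊗ d^∨) :=
  (ihcur H (ihev H (d ▷ m) n ∘ aassoc (ihom H (d ▷ m) n) d m) ⊗₁ idm (d^∨))
    ∘ isoinv (massoc (ihom H (d ▷ m) n) d (d^∨))
    ∘ (idm (ihom H (d ▷ m) n) ⊗₁ rdcoev d)
    ∘ isoinv (mrun (ihom H (d ▷ m) n)).

(* The isomorphism is natural in m and n, and (naturality for the
   D-valued Hom) in the D-action on n, i.e. it is compatible with
     (ihom m (d ▷ n))^∨ ≅ (d ⊗ ihom m n)^∨ ≅ (ihom m n)^∨ ⊗ d^∨,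
     ihom (d ▷ n) (S m) ≅ ihom n (S m) ⊗ d^∨.
   Without the last condition the pair (S, serre_phi) would not be unique up
   to a unique isomorphism and serre_constr below would not be well-behaved. *)
Record relative_serre : Type := RelativeSerre {
  serre :> functor M M;
  serre_phi : forall m n, mor ((ihom H m n)^∨) (ihom H n (serre m));
  serre_phi_iso : forall m n, is_iso (serre_phi m n);
  serre_phi_natl : forall m m' n (f : mor m m'),
    serre_phi m' n ∘ dualm (ihoml n f) =
    ihomr n (fmap serre f) ∘ serre_phi m n;
  serre_phi_natr : forall m n n' (g : mor n n'),
    serre_phi m n ∘ dualm (ihomr m g) =
    ihoml (serre m) g ∘ serre_phi m n';
  serre_phi_act : forall d m n,
    ihom_actl d n (serre m) ∘ serre_phi m (d ▷ n) =
    (serre_phi m n ⊗₁ idm (d^∨)) ∘ isoinv (dual_tens d (ihom H m n))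
      ∘ dualm (ihom_actr d m n)
}.

Variable S : relative_serre.

(* ihom n (S(d ▷ m)) ≅ (ihom (d ▷ m) n)^∨ ≅ (ihom m n ⊗ d^∨)^∨
     ≅ d^∨∨ ⊗ (ihom m n)^∨ ≅ d^∨∨ ⊗ ihom n (S m) ≅ ihom n (d^∨∨ ▷ S m) *)
Definition serre_ihom (d : D) (m n : M) :
  mor (ihom H n (S (d ▷ m))) (ihom H n (d^∨^∨ ▷ S m)) :=
  ihom_actr (d^∨^∨) n (S m) ∘ (idm (d^∨^∨) ⊗₁ serre_phi S m n)
    ∘ isoinv (dual_tens (ihom H m n) (d^∨)) ∘ isoinv (dualm (ihom_actl d m n))
    ∘ isoinv (serre_phi S (d ▷ m) n).

(* The isomorphism S(d ▷ m) ≅ d^∨∨ ▷ S(m) inducing serre_ihom: the image of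
   the identity of S(d ▷ m), by the Yoneda lemma. *)
Definition serre_constr : mod_constr (fun d : D => d^∨^∨) S :=
  fun d m =>
    ihev H (S (d ▷ m)) (d^∨^∨ ▷ S m)
      ∘ ((serre_ihom d m (S (d ▷ m)) ∘ ihcur H (alun (S (d ▷ m))))
           ▷₁ idm (S (d ▷ m)))
      ∘ isoinv (alun (S (d ▷ m))).

End InternalHoms.

Section PivotalModule.
Variables (k : fieldType) (D : pivotal_ftcat k) (M : modcat D).

(* The D-module functor structure of S, identifying d^∨∨ with d. *)
Definition serre_piv (H : internal_homs M) (S : relative_serre H) :
  mod_constr id S :=
  fun d m => (isoinv (piv d) ▷₁ idm (S m)) ∘ serre_constr S d m.

Definition is_pivotal_structure (H : internal_homs M) (S : relative_serre H)
  (p : forall m, mor m (S m)) : Prop :=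
  module_iso (id_constr M) (serre_piv S) p.

Arguments is_pivotal_structure {H} S p.

Definition pivotal_module : Prop :=
  exact_module M /\
  exists (H : internal_homs M) (S : relative_serre H)
    (p : forall m, mor m (S m)), is_pivotal_structure S p.

End PivotalModule.

Arguments is_pivotal_structure {k D M H} S p.

Section Frobenius.
Variables (k : fieldType) (C D : ftcat k) (F : tensor_functor C D).
Variables (R : right_adjoints F) (M : modcat D).

Definition chi_act : functor M M := bfixl act (chi R).

(* χ_F ▷ - as a C-module endofunctor of _F M, through σ *)
Definition chi_constr : mod_constr (M := twist F M) id chi_act :=
  fun c m => aassoc (F c) (chi R) m ∘ (chi_braid R c ▷₁ idm m)
    ∘ isoinv (aassoc (chi R) (F c) m).

Definition is_trivialization (t : forall m : M, mor (chi R ▷ m) m) : Prop :=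
  module_iso chi_constr (id_constr (twist F M)) t.

Definition frobenius_wrt : Prop :=
  exists t : forall m : M, mor (chi R ▷ m) m, is_trivialization t.

Variables (H : internal_homs M) (S : relative_serre H).

(* F^*(S) as a functor of twisted C-module categories:
   S(F(c) ▷ m) ≅ F(c)^∨∨ ▷ S(m) ≅ F(c^∨∨) ▷ S(m) *)
Definition pullback_serre_constr :
  mod_constr (M := twist F M) (fun c : C => c^∨^∨) S :=
  fun c m =>
    ((isoinv (tf_dual F (c^∨)) ∘ dualm (tf_dual F c)) ▷₁ idm (S m))
      ∘ serre_constr S (F c) m.

(* χ_F ▷ S(F(c) ▷ m) ≅ χ_F ▷ F(c^∨∨) ▷ S(m) ≅ F(c^∨∨) ▷ χ_F ▷ S(m) *)
Definition chi_serre_constr :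
  mod_constr (M := twist F M) (fun c : C => c^∨^∨) (compF chi_act S) :=
  fun c m => chi_constr (c^∨^∨) (S m)
    ∘ (idm (chi R) ▷₁ pullback_serre_constr c m).

(* t is an isomorphism χ_F ▷ F^*(S) ≅ S' of twisted C-module functors, where
   S' is a relative Serre functor of _F M. *)
Definition is_serre_comparison (H' : internal_homs (twist F M))
  (S' : relative_serre H') (t : forall m : M, mor (chi R ▷ S m) (S' m)) :
  Prop :=
  module_iso chi_serre_constr (serre_constr S') t.

End Frobenius.

Arguments is_trivialization {k C D F} R M t.
Arguments is_serre_comparison {k C D F} R {M H} S {H'} S' t.

(* Main.v *)
(* For an object m of a module category, the functor ihom m is right adjoint to
   - ▷ m, and S m is the value at 1 of the right adjoint of ihom m: it comes with
   a universal functional ihom m (S m) -> 1.  Likewise χ = F^rra(1) comes with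
   a universal functional F^ra(χ) -> 1.  Both are traces along a strong module
   functor out of the regular module category, and give partial traces
   Hom(T x, a ▷ s) -> Hom(x, a).  Composing the trace of M, with values in χ,
   with that of F shows that χ ▷ S m carries a universal trace for _F M, hence is
   canonically isomorphic to S' m for any relative Serre functor S' of _F M.
   Since morphisms into a ▷ S' m are separated by partial traces, compatibility
   of this isomorphism with the twisted module structures is an equality of
   traces; it reduces to the fact that the half-braiding σ exchanges the partial
   traces along F with χ on the left and on the right.  For pivotal F the
   comparison χ ▷ S ≅ S' then converts trivializations of χ ▷ - into pivotal
   structures and back.  If F^la ≅ F^ra as bimodule functors, taking right
   adjoints gives F ≅ F^rra, so that χ ≅ 1 compatibly with σ. *)
Require Import Defs.
#[warnings="-notation-overridden"]
From mathcomp Require Import all_boot all_order all_algebra.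
#[warnings="-notation-overridden"]
From mathcomp Require Import boolp.

Set Implicit Arguments.
Unset Strict Implicit.
Unset Printing Implicit Defensive.

Import GRing.Theory.
Local Open Scope ring_scope.
Local Open Scope cat_scope.
Local Obligation Tactic := idtac.

(** * Morphisms, functors and adjunctions *)

(** The comparison of Serre functors concerns [serre_constr], a composite full of inverses of
    structure maps and of their duals. Traces remove these inverses: the definition of
    [serre_constr] is unfolded only in [serre_constr_mptr], and later arguments use its trace
    formula. As [isoinv] is 0 on non-isomorphisms, each structure map that the definitions invert
    must first be shown invertible; for the maps on adjoints this comes from rigidity. Right-handed
    statements are obtained by reversing tensor products. Perfectness makes F preserve projectives,
    whence exactness of _F M. A pivotal module category must also come with internal Homs and a
    relative Serre functor; for _F M they are F^ra of the internal Homs of M and χ ▷ S, while the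
    comparison itself is proved for an arbitrary choice of S'. *)

Section Composition.
Variables (k : fieldType) (A : lincat k).
Implicit Types w x y z : A.

Lemma cmp_eq2 w x y y' z (g : mor y z) (f : mor x y) (g' : mor y' z)
    (f' : mor x y') (e : mor w x) :
  g ∘ f = g' ∘ f' -> g ∘ (f ∘ e) = g' ∘ (f' ∘ e).
Proof. by rewrite !cmpA => ->. Qed.

Lemma isoinvKl w x y (f : mor x y) (e : mor w x) :
  is_iso f -> isoinv f ∘ (f ∘ e) = e.
Proof. by move=> fi; rewrite cmpA isoinvK ?cmp1m. Qed.

Lemma isoinvKVl w x y (f : mor x y) (e : mor w y) :
  is_iso f -> f ∘ (isoinv f ∘ e) = e.
Proof. by move=> fi; rewrite cmpA isoinvKV ?cmp1m. Qed.

Lemma iso_monic x y (f : mor x y) : is_iso f -> is_mono f.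
Proof. by move=> fi w g h e; rewrite -(isoinvKl g fi) e isoinvKl. Qed.

Lemma is_inverse_isoinv x y (f : mor x y) (g : mor y x) :
  is_inverse f g -> isoinv f = g.
Proof.
move=> fg; have fi : is_iso f by exists g.
by rewrite -[LHS]cmpm1 -(proj2 fg) isoinvKl.
Qed.

Lemma isoinv_cmp x y z (g : mor y z) (f : mor x y) :
  is_iso g -> is_iso f -> isoinv (g ∘ f) = isoinv f ∘ isoinv g.
Proof.
move=> gi fi; apply: is_inverse_isoinv; split.
  by rewrite -!cmpA isoinvKl ?isoinvK.
by rewrite -!cmpA isoinvKVl ?isoinvKV.
Qed.

Lemma isoinvV x y (f : mor x y) : is_iso f -> isoinv (isoinv f) = f.
Proof. by case/isoinvP=> fK fKV; apply: is_inverse_isoinv. Qed.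

Lemma isoinv1 x : isoinv (idm x) = idm x.
Proof. by apply: is_inverse_isoinv; split; rewrite cmp1m. Qed.

Lemma iso_of_inverse x y (f : mor x y) (g : mor y x) :
  g ∘ f = idm x -> f ∘ g = idm y -> is_iso f.
Proof. by exists g. Qed.

Lemma move_isor x y z (g : mor y z) (f : mor x y) (h : mor x z) :
  is_iso f -> g ∘ f = h -> g = h ∘ isoinv f.
Proof. by move=> fi <-; rewrite -cmpA isoinvKV ?cmpm1. Qed.

(** Yoneda. Transposition gives an evident bijection on generalized elements where an explicit
    inverse would be cumbersome; [dual_tens], [ihom_actl] and [tf_dual] are inverted this way. *)
Lemma iso_of_bij x y (f : mor x y) :
  (forall w (g : mor w y), exists! h : mor w x, f ∘ h = g) -> is_iso f.
Proof.
move=> bij; have [g [fg _]] := bij y (idm y); exists g; split=> //.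
have [h [_ hu]] := bij x f.
by rewrite -(hu (idm x)) ?cmpm1 // (hu (g ∘ f)) // cmpA fg cmp1m.
Qed.

Lemma cmp0m x y z (f : mor x y) : (0 : mor y z) ∘ f = 0.
Proof.
have := cmp_linl 1 (0 : mor y z) 0 f.
rewrite !scale1r addr0 => e; apply: (addrI ((0 : mor y z) ∘ f)).
by rewrite addr0 -e.
Qed.

Lemma cmpm0 x y z (g : mor y z) : g ∘ (0 : mor x y) = 0.
Proof.
have := cmp_linr 1 g (0 : mor x y) 0.
rewrite !scale1r addr0 => e; apply: (addrI (g ∘ (0 : mor x y))).
by rewrite addr0 -e.
Qed.

End Composition.

Section Functors.
Variables (k : fieldType) (A B : lincat k).

Lemma fmap_iso (G : functor A B) x y (f : mor x y) :
  is_iso f -> is_iso (fmap G f).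
Proof. by case=> g [gf fg]; exists (fmap G g); split; rewrite -fmapM ?gf ?fg fmap1. Qed.

Lemma fmap_isoinv (G : functor A B) x y (f : mor x y) :
  is_iso f -> fmap G (isoinv f) = isoinv (fmap G f).
Proof.
move=> /isoinvP[fK fKV]; apply/esym/is_inverse_isoinv.
by split; rewrite -fmapM ?fK ?fKV fmap1.
Qed.

Lemma fmap0 (G : functor A B) x y : fmap G (0 : mor x y) = 0.
Proof.
have := fmap_lin G 1 (0 : mor x y) 0.
rewrite !scale1r addr0 => e; apply: (addrI (fmap G (0 : mor x y))).
by rewrite addr0 -e.
Qed.

End Functors.

Section Adjunction.
Variables (k : fieldType) (A B : lincat k) (L : functor A B) (R : functor B A).
Variable adj : adjunction L R.

Lemma adj_curryK x y (f : mor (L x) y) :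
  acounit adj y ∘ fmap L (fmap R f ∘ aunit adj x) = f.
Proof. by rewrite fmapM cmpA -acounit_nat -cmpA adj_triL cmpm1. Qed.

Lemma adj_uncurryK x y (g : mor x (R y)) :
  fmap R (acounit adj y ∘ fmap L g) ∘ aunit adj x = g.
Proof. by rewrite fmapM -cmpA -aunit_nat cmpA adj_triR cmp1m. Qed.

Lemma adj_inj x y (g h : mor x (R y)) :
  acounit adj y ∘ fmap L g = acounit adj y ∘ fmap L h -> g = h.
Proof. by move=> e; rewrite -(adj_uncurryK g) e adj_uncurryK. Qed.

Lemma adj_injl x y (f g : mor (L x) y) :
  fmap R f ∘ aunit adj x = fmap R g ∘ aunit adj x -> f = g.
Proof. by move=> e; rewrite -(adj_curryK f) e adj_curryK. Qed.

Lemma radj_kernel a x y (i : mor a x) (f : mor x y) :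
  is_kernel i f -> is_kernel (fmap R i) (fmap R f).
Proof.
move=> [fi0 u]; split; first by rewrite -fmapM fi0 fmap0.
move=> w g fg0.
have e0 : f ∘ (acounit adj x ∘ fmap L g) = 0.
  by rewrite cmpA acounit_nat -cmpA -fmapM fg0 fmap0 cmpm0.
have [h [hE hu]] := u _ _ e0.
exists (fmap R h ∘ aunit adj w); split.
  by rewrite cmpA -fmapM hE adj_uncurryK.
move=> h' h'E; apply: adj_inj; rewrite adj_curryK; apply: hu.
by rewrite cmpA acounit_nat -cmpA -fmapM h'E.
Qed.

Lemma ladj_cokernel x y b (p : mor y b) (f : mor x y) :
  is_cokernel p f -> is_cokernel (fmap L p) (fmap L f).
Proof.
move=> [pf0 u]; split; first by rewrite -fmapM pf0 fmap0.
move=> z g gf0.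
have e0 : (fmap R g ∘ aunit adj y) ∘ f = 0.
  by rewrite -cmpA aunit_nat cmpA -fmapM gf0 fmap0 cmp0m.
have [h [hE hu]] := u _ _ e0.
exists (acounit adj z ∘ fmap L h); split.
  by rewrite -cmpA -fmapM hE adj_curryK.
move=> h' h'E; apply: adj_injl; rewrite adj_uncurryK; apply: hu.
by rewrite -cmpA aunit_nat cmpA -fmapM h'E.
Qed.

End Adjunction.

(** An epimorphism p is the cokernel of some g, and g factors through the kernel i of p; hence a map
    killing i kills g, and p is the cokernel of i as well. *)
Lemma epi_short_exact (k : fieldType) (A : lincat k) (x b : A) (p : mor x b) :
  abelian_cat A -> is_epi p ->
  exists a (i : mor a x), short_exact i p.
Proof.
move=> abA pe; have [a [i ip]] := ab_ker abA p; exists a, i; split=> //.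
have [w [g [pg0 u]]] := ab_epi abA pe; have [pi0 v] := ip.
split=> // z h hi0; apply: u.
by have [j [<- _]] := v _ _ pg0; rewrite cmpA hi0 cmp0m.
Qed.

Section Exactness.
Variables (k : fieldType) (A B : lincat k).

Lemma two_adjoints_exact (G : functor A B) (L R : functor B A) :
  adjunction L G -> adjunction G R -> exact_functor G.
Proof.
move=> LG GR a x b i p [ip pi]; split.
  exact: (radj_kernel LG ip).
exact: (ladj_cokernel GR pi).
Qed.

(** Lifting problems for [L p] transpose to lifting problems for p along the epimorphism [fmap R e].
    With L = F and R = F^ra this is how perfectness is used. *)
Lemma ladj_projective (L : functor A B) (R : functor B A) :
  abelian_cat B -> adjunction L R -> exact_functor R ->
  forall p : A, projective p -> projective (L p).
Proof.
move=> abB adj Rex p pP x y e f ee.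
have Re : is_epi (fmap R e).
  have [a [i /Rex[_ [pi0 u]]]] := epi_short_exact abB ee.
  move=> z g h E; have hi0 : (h ∘ fmap R e) ∘ fmap R i = 0.
    by rewrite -cmpA pi0 cmpm0.
  by have [c [_ cu]] := u _ _ hi0; rewrite -(cu g) ?(cu h).
have [g gE] := pP _ _ _ (fmap R f ∘ aunit adj p) Re.
exists (acounit adj x ∘ fmap L g).
by rewrite cmpA acounit_nat -cmpA -fmapM gE adj_curryK.
Qed.

End Exactness.

(** * Rigid monoidal categories acting on categories *)

Section Bifunctors.
Variables (k : fieldType) (A B E : lincat k) (T : bifunctor A B E).

Lemma bmap_fixl x y y' y'' (g' : mor y' y'') (g : mor y y') :
  bmap T (idm x) (g' ∘ g) = bmap T (idm x) g' ∘ bmap T (idm x) g.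
Proof. by rewrite -bmapM cmp1m. Qed.

Lemma bmap_fixr x x' x'' y (f' : mor x' x'') (f : mor x x') :
  bmap T (f' ∘ f) (idm y) = bmap T f' (idm y) ∘ bmap T f (idm y).
Proof. by rewrite -bmapM cmp1m. Qed.

Lemma bmap_lr x x' y y' (f : mor x x') (g : mor y y') :
  bmap T f g = bmap T f (idm y') ∘ bmap T (idm x) g.
Proof. by rewrite -bmapM cmpm1 cmp1m. Qed.

Lemma bmap_rl x x' y y' (f : mor x x') (g : mor y y') :
  bmap T f g = bmap T (idm x') g ∘ bmap T f (idm y).
Proof. by rewrite -bmapM cmpm1 cmp1m. Qed.

Lemma bmap_isoinv x x' y y' (f : mor x x') (g : mor y y') :
  is_iso f -> is_iso g -> bmap T (isoinv f) (isoinv g) = isoinv (bmap T f g).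
Proof.
move=> fi gi; apply/esym/is_inverse_isoinv.
by split; rewrite -bmapM ?isoinvK ?isoinvKV ?bmap1.
Qed.

Lemma bmap_isoinvl x y y' (g : mor y y') :
  is_iso g -> bmap T (idm x) (isoinv g) = isoinv (bmap T (idm x) g).
Proof. by move=> gi; rewrite -bmap_isoinv ?isoinv1 //; apply: is_iso_idm. Qed.

Lemma bmap_isoinvr x x' y (f : mor x x') :
  is_iso f -> bmap T (isoinv f) (idm y) = isoinv (bmap T f (idm y)).
Proof. by move=> fi; rewrite -bmap_isoinv ?isoinv1 //; apply: is_iso_idm. Qed.

Lemma bmap_isol x y y' (g : mor y y') : is_iso g -> is_iso (bmap T (idm x) g).
Proof. by move=> gi; apply: bmap_iso => //; apply: is_iso_idm. Qed.

Lemma bmap_isor x x' y (f : mor x x') : is_iso f -> is_iso (bmap T f (idm y)).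
Proof. by move=> fi; apply: bmap_iso => //; apply: is_iso_idm. Qed.

Program Definition bswap : bifunctor B A E :=
  Bifunctor (bobj := fun y x => T x y) (bmap := fun y y' x x' g f => bmap T f g)
    _ _ _ _.
Next Obligation. by move=> *; rewrite /= bmap_linr. Qed.
Next Obligation. by move=> *; rewrite /= bmap_linl. Qed.
Next Obligation. by move=> *; rewrite /= bmap1. Qed.
Next Obligation. by move=> *; rewrite /= bmapM. Qed.

End Bifunctors.

(* Module categories without finiteness and exactness: what is needed to speak
   of the regular module category before knowing that duality makes the tensor
   product exact. *)
Record premod (k : fieldType) (D : monoidal k) : Type := Premod {
  pm_cat :> lincat k;
  pm_act : bifunctor D pm_cat pm_cat;
  pm_assoc : forall d d' m, mor (pm_act (d ⊗ d') m) (pm_act d (pm_act d' m));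
  pm_assoc_iso : forall d d' m, is_iso (pm_assoc d d' m);
  pm_assoc_nat : forall d d' e e' m m'
    (f : mor d d') (g : mor e e') (h : mor m m'),
    pm_assoc d' e' m' ∘ bmap pm_act (f ⊗₁ g) h =
    bmap pm_act f (bmap pm_act g h) ∘ pm_assoc d e m;
  pm_lun : forall m, mor (pm_act 𝟙 m) m;
  pm_lun_iso : forall m, is_iso (pm_lun m);
  pm_lun_nat : forall m m' (f : mor m m'),
    pm_lun m' ∘ bmap pm_act (idm 𝟙) f = f ∘ pm_lun m;
  pm_pentagon : forall d d' d'' m,
    pm_assoc d d' (pm_act d'' m) ∘ pm_assoc (d ⊗ d') d'' m =
    bmap pm_act (idm d) (pm_assoc d' d'' m) ∘ pm_assoc d (d' ⊗ d'') m
      ∘ bmap pm_act (massoc d d' d'') (idm m);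
  pm_triangle : forall d m,
    bmap pm_act (idm d) (pm_lun m) ∘ pm_assoc d 𝟙 m =
    bmap pm_act (mrun d) (idm m)
}.

Arguments pm_act {k D} N : rename.
Arguments pm_assoc {k D N} d d' m : rename.
Arguments pm_lun {k D N} m : rename.

Definition premod_of (k : fieldType) (D : ftcat k) (M : modcat D) : premod D :=
  Premod (@aassoc_iso k D M) (@aassoc_nat k D M) (@alun_iso k D M)
    (@alun_nat k D M) (@apentagon k D M) (@atriangle k D M).

Definition premod_reg (k : fieldType) (D : monoidal k) : premod D :=
  Premod (@massoc_iso k D) (@massoc_nat k D) (@mlun_iso k D)
    (@mlun_nat k D) (@mpentagon k D) (@mtriangle k D).

Section Premod.
Variables (k : fieldType) (D : monoidal k) (N : premod D).
Implicit Types (x y : D) (m n : N).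

Local Notation "x ⋆ m" := (bobj (pm_act N) x m)
  (at level 38, right associativity).
Local Notation "f ⋆₁ g" := (bmap (pm_act N) f g)
  (at level 38, right associativity).
Local Notation α := pm_assoc.

Lemma pm_assoc_natl x x' y y' m (f : mor x x') (g : mor y y') :
  α x' y' m ∘ (f ⊗₁ g) ⋆₁ idm m = f ⋆₁ (g ⋆₁ idm m) ∘ α x y m.
Proof. exact: pm_assoc_nat. Qed.

Lemma pm_assoc_nat1 x x' y m (f : mor x x') :
  α x' y m ∘ (f ⊗₁ idm y) ⋆₁ idm m = f ⋆₁ idm (y ⋆ m) ∘ α x y m.
Proof. by rewrite pm_assoc_nat bmap1. Qed.

Lemma pm_assoc_nat3 x y m m' (h : mor m m') :
  α x y m' ∘ idm (x ⊗ y) ⋆₁ h = idm x ⋆₁ (idm y ⋆₁ h) ∘ α x y m.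
Proof. by rewrite -pm_assoc_nat bmap1. Qed.

(** Kelly's argument: acting by 𝟙 is faithful by naturality of [pm_lun], and after acting by 𝟙 the
    identity follows from pentagon and triangle. *)
Lemma pm_lun_assoc x m : pm_lun (x ⋆ m) ∘ α 𝟙 x m = mlun x ⋆₁ idm m.
Proof.
suff /(congr1 (fun f => pm_lun _ ∘ f)) : idm 𝟙 ⋆₁ (pm_lun (x ⋆ m) ∘ α 𝟙 x m) =
    idm 𝟙 ⋆₁ (mlun x ⋆₁ idm m).
  rewrite !pm_lun_nat; exact: iso_epic (pm_lun_iso _) _ _ _.
have mi : is_iso (α 𝟙 (𝟙 ⊗ x) m ∘ massoc 𝟙 𝟙 x ⋆₁ idm m).
  apply: is_iso_cmp; first exact: pm_assoc_iso.
  by apply: bmap_isor; apply: massoc_iso.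
apply: (iso_epic mi); rewrite bmap_fixl -!cmpA.
rewrite (cmpA (idm 𝟙 ⋆₁ α 𝟙 x m)) -pm_pentagon cmpA pm_triangle.
rewrite -(bmap1 (pm_act N) x m) -pm_assoc_natl cmpA -pm_assoc_natl -cmpA.
by rewrite -bmap_fixr mtriangle.
Qed.

Variables (x y : D) (e : mor (y ⊗ x) 𝟙) (c : mor 𝟙 (x ⊗ y)).
Hypothesis ec : is_rdual e c.

(** [pm_ev] and [pm_coev] are counit and unit of an adjunction with y ⋆ - left adjoint to x ⋆ -;
    [pm_zig] and [pm_zag] are its triangle identities. *)
Definition pm_ev m : mor (y ⋆ x ⋆ m) m :=
  pm_lun m ∘ (e ⋆₁ idm m ∘ isoinv (α y x m)).

Definition pm_coev m : mor m (x ⋆ y ⋆ m) :=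
  α x y m ∘ (c ⋆₁ idm m ∘ isoinv (pm_lun m)).

Lemma pm_ev_nat m n (f : mor m n) :
  pm_ev n ∘ idm y ⋆₁ (idm x ⋆₁ f) = f ∘ pm_ev m.
Proof.
rewrite /pm_ev -!cmpA (isoinv_square (pm_assoc_iso _ _ _) (pm_assoc_iso _ _ _)
  (pm_assoc_nat3 _ _ _)) (cmpA (e ⋆₁ _)) -bmap_lr bmap_rl -!cmpA.
by rewrite !cmpA pm_lun_nat.
Qed.

Lemma pm_coev_nat m n (f : mor m n) :
  pm_coev n ∘ f = idm x ⋆₁ (idm y ⋆₁ f) ∘ pm_coev m.
Proof.
rewrite /pm_coev !cmpA -pm_assoc_nat3 -!cmpA.
rewrite (isoinv_square (pm_lun_iso _) (pm_lun_iso _) (pm_lun_nat f)).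
by rewrite (cmpA (c ⋆₁ _)) -bmap_lr bmap_rl -!cmpA.
Qed.

Lemma pm_zig m : idm x ⋆₁ pm_ev m ∘ pm_coev (x ⋆ m) = idm (x ⋆ m).
Proof.
rewrite /pm_ev /pm_coev.
have li := mlun_iso x; have Li := bmap_isor (pm_act N) m li.
(* With the inverse unitor expressed through D, the composite becomes the action on m of the zigzag
   in D. *)
have -> : isoinv (pm_lun (x ⋆ m)) = α 𝟙 x m ∘ isoinv (mlun x) ⋆₁ idm m.
  rewrite bmap_isoinvr // -pm_lun_assoc isoinv_cmp; last exact: pm_assoc_iso.
    by rewrite isoinvKVl //; apply: pm_assoc_iso.
  exact: pm_lun_iso.
rewrite !bmap_fixl -!cmpA (cmpA (c ⋆₁ _)) -pm_assoc_nat1 -!cmpA.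
rewrite (cmpA (α x y _)) pm_pentagon -!cmpA (bmap_isoinvl _ _ (pm_assoc_iso _ _ _)).
rewrite isoinvKl; last by apply: bmap_isol; apply: pm_assoc_iso.
rewrite -!bmap_fixr (cmpA (idm x ⋆₁ (e ⋆₁ _))) -pm_assoc_natl !cmpA pm_triangle.
rewrite -!bmap_fixr; move: ec => [+ _]; rewrite !cmpA => ->.
by rewrite isoinvKV // bmap1.
Qed.

Lemma pm_zag m : pm_ev (y ⋆ m) ∘ idm y ⋆₁ pm_coev m = idm (y ⋆ m).
Proof.
have ri := mrun_iso y; have Ri := bmap_isor (pm_act N) m ri.
rewrite /pm_ev /pm_coev !bmap_fixl (bmap_isoinvl _ _ (pm_lun_iso _)).
have -> : isoinv (idm y ⋆₁ pm_lun m) = α y 𝟙 m ∘ isoinv (mrun y) ⋆₁ idm m.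
  rewrite bmap_isoinvr // -pm_triangle isoinv_cmp; last exact: pm_assoc_iso.
    by rewrite isoinvKVl //; apply: pm_assoc_iso.
  by apply: bmap_isol; apply: pm_lun_iso.
rewrite -!cmpA (cmpA (idm y ⋆₁ (c ⋆₁ _))) -pm_assoc_natl.
have pent : isoinv (α y x (y ⋆ m)) ∘ (idm y ⋆₁ α x y m ∘ α y (x ⊗ y) m) =
    α (y ⊗ x) y m ∘ isoinv (massoc y x y) ⋆₁ idm m.
  have mi := bmap_isor (pm_act N) m (massoc_iso y x y).
  rewrite bmap_isoinvr; last exact: massoc_iso.
  apply: move_isor => //; rewrite -!cmpA (cmpA (idm y ⋆₁ α x y m)) -pm_pentagon.
  by rewrite isoinvKl //; apply: pm_assoc_iso.
rewrite -!cmpA (cmpA (idm y ⋆₁ α x y m)) (cmpA (isoinv (α y x _))) pent -!cmpA.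
rewrite (cmpA (e ⋆₁ _)) -pm_assoc_nat1 -!cmpA !cmpA pm_lun_assoc.
rewrite -!cmpA -!bmap_fixr; move: ec => [_]; rewrite -!cmpA => E.
by rewrite (cmpA (isoinv (massoc _ _ _))) (cmpA (e ⊗₁ _))
  (cmpA (mlun y)) E isoinvKV // bmap1.
Qed.

Lemma pm_ev_inj m n (f g : mor n (x ⋆ m)) :
  pm_ev m ∘ idm y ⋆₁ f = pm_ev m ∘ idm y ⋆₁ g -> f = g.
Proof.
have K h : idm x ⋆₁ (pm_ev m ∘ idm y ⋆₁ h) ∘ pm_coev n = h.
  by rewrite bmap_fixl -cmpA -pm_coev_nat cmpA pm_zig cmp1m.
by move=> E; rewrite -(K f) E K.
Qed.

Lemma pm_evK m n (f : mor (y ⋆ n) m) :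
  pm_ev m ∘ idm y ⋆₁ (idm x ⋆₁ f ∘ pm_coev n) = f.
Proof. by rewrite bmap_fixl cmpA pm_ev_nat -cmpA pm_zag cmpm1. Qed.

End Premod.

Arguments pm_ev {k D N x y} e m.
Arguments pm_coev {k D N x y} c m.

Ltac iso := repeat first
  [ exact: massoc_iso | exact: mlun_iso | exact: mrun_iso | exact: is_iso_idm
  | exact: aassoc_iso | exact: alun_iso | exact: tf_mu_iso | exact: tf_eps_iso
  | exact: pm_assoc_iso | exact: pm_lun_iso | exact: piv_iso | assumption
  | apply: is_iso_inv | apply: bmap_iso | apply: fmap_iso | apply: is_iso_cmp ].

(** Reversal swaps the two unitors and exchanges the roles of an object and its dual, so each
    left-handed lemma also yields its mirror image. *)
Program Definition rev_mon (k : fieldType) (D : monoidal k) : monoidal k :=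
  @Monoidal k D (bswap tens) 𝟙 (fun x y z => isoinv (massoc z y x)) _ _
    (fun x => mrun x) _ _ (fun x => mlun x) _ _ _ _.
Next Obligation. by move=> k D x y z; apply/is_iso_inv/massoc_iso. Qed.
Next Obligation.
move=> k D x x' y y' z z' f g h /=; apply: isoinv_square;
  [exact: massoc_iso | exact: massoc_iso | exact: massoc_nat].
Qed.
Next Obligation. by move=> k D x; apply: mrun_iso. Qed.
Next Obligation. by move=> k D x x' f; apply: mrun_nat. Qed.
Next Obligation. by move=> k D x; apply: mlun_iso. Qed.
Next Obligation. by move=> k D x x' f; apply: mlun_nat. Qed.
Next Obligation.
move=> k D w x y z /=; have := congr1 (@isoinv _ _ _ _) (mpentagon z y x w).
rewrite !isoinv_cmp; try by iso.
rewrite -bmap_isoinvl; last by iso.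
by rewrite -bmap_isoinvr; [rewrite cmpA | iso].
Qed.
Next Obligation.
move=> k D x y /=; apply: (iso_epic (massoc_iso y 𝟙 x)).
by rewrite -cmpA isoinvK ?cmpm1 ?mtriangle //; apply: massoc_iso.
Qed.

Section Monoidal.
Variables (k : fieldType) (D : monoidal k).
Implicit Types x y z : D.

Lemma rev_rdual x y (e : mor (y ⊗ x) 𝟙) (c : mor 𝟙 (x ⊗ y)) :
  is_rdual e c -> @is_rdual k (rev_mon D) y x e c.
Proof.
move=> [e1 e2]; split; first by [].
by rewrite /= isoinvV //; apply: massoc_iso.
Qed.

Lemma mlun_assoc x y : mlun (x ⊗ y) ∘ massoc 𝟙 x y = mlun x ⊗₁ idm y.
Proof. exact: (@pm_lun_assoc _ _ (premod_reg D)). Qed.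

Lemma mrun_assoc x y : (idm x ⊗₁ mrun y) ∘ massoc x y 𝟙 = mrun (x ⊗ y).
Proof.
have := @pm_lun_assoc _ _ (premod_reg (rev_mon D)) y x; rewrite /= => <-.
by rewrite -cmpA isoinvK ?cmpm1 //; apply: massoc_iso.
Qed.

Lemma mlun_unit : mlun 𝟙 = mrun 𝟙 :> mor (𝟙 ⊗ 𝟙 : D) 𝟙.
Proof.
have e1 := mtriangle (𝟙 : D) 𝟙; have e2 := mlun_assoc (𝟙 : D) 𝟙.
have e3 := mlun_nat (mlun (𝟙 : D)).
have e4 : mlun (𝟙 ⊗ 𝟙) = idm (𝟙 : D) ⊗₁ mlun 𝟙.
  by apply: (iso_monic (mlun_iso (𝟙 : D))); rewrite e3.
have e5 : (mlun 𝟙 ⊗₁ idm (𝟙 : D)) = mrun 𝟙 ⊗₁ idm 𝟙 by rewrite -e2 e4 e1.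
apply: (iso_epic (mrun_iso (𝟙 ⊗ 𝟙 : D))).
by rewrite -!mrun_nat e5.
Qed.

End Monoidal.

(* Reversing tensor products turns ra_left, rra_left and la_left into ra_right,
   rra_right and la_right. *)
Section RevFtcat.
Variables (k : fieldType) (D : ftcat k).

(** [ldual_ex] asserts mere existence; classical choice selects the left duals, which serve as the
    right duals of [rev_ft]. *)
Definition ldual (x : D) : D := projT1 (cid (ldual_ex x)).
Definition ldev (x : D) : mor (x ⊗ ldual x) 𝟙 :=
  projT1 (cid (projT2 (cid (ldual_ex x)))).
Definition ldcoev (x : D) : mor 𝟙 (ldual x ⊗ x) :=
  projT1 (cid (projT2 (cid (projT2 (cid (ldual_ex x)))))).
Lemma ldualP (x : D) : is_rdual (ldev x) (ldcoev x).
Proof. exact: (projT2 (cid (projT2 (cid (projT2 (cid (ldual_ex x))))))). Qed.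

Program Definition rev_ft : ftcat k :=
  @FTCat k (rev_mon D) (ft_finite D) (@ft_end1 k D) ldual ldev ldcoev _ _.
Next Obligation. by move=> x; apply/rev_rdual/ldualP. Qed.
Next Obligation.
by move=> x; exists (x^∨), (rdev x), (rdcoev x); apply/rev_rdual/rdualP.
Qed.

End RevFtcat.

Section Regular.
Variables (k : fieldType) (D : ftcat k).

(** By rigidity x ⊗ - has adjoints on both sides: x^∨ ⊗ - on the left and [ldual x] ⊗ - on the
    right. *)
Lemma tens_exactl (x : D) : exact_functor (bfixl tens x).
Proof.
pose P := premod_reg D.
have ec := rdualP x; have ec' := ldualP x.
apply: (@two_adjoints_exact _ _ _ _ (bfixl tens (x^∨)) (bfixl tens (ldual x))).
- exists (pm_coev (N := P) (rdcoev x)) (pm_ev (N := P) (rdev x)).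
  + exact: (@pm_coev_nat _ _ P).
  + by move=> y y' g; rewrite (@pm_ev_nat _ _ P).
  + exact: (@pm_zag _ _ P _ _ _ _ ec).
  + exact: (@pm_zig _ _ P _ _ _ _ ec).
- exists (pm_coev (N := P) (ldcoev x)) (pm_ev (N := P) (ldev x)).
  + exact: (@pm_coev_nat _ _ P).
  + by move=> y y' g; rewrite (@pm_ev_nat _ _ P).
  + exact: (@pm_zag _ _ P _ _ _ _ ec').
  + exact: (@pm_zig _ _ P _ _ _ _ ec').
Qed.

End Regular.

Definition reg (k : fieldType) (D : ftcat k) : modcat D :=
  @ModCat k D D (ft_finite D) tens (@tens_exactl k D) (@tens_exactl k (rev_ft D))
    (fun x y z => massoc x y z) (@massoc_iso k D) (@massoc_nat k D)
    (fun x => mlun x) (@mlun_iso k D) (@mlun_nat k D) (@mpentagon k D)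
    (@mtriangle k D).

Section ModuleDuality.
Variables (k : fieldType) (D : ftcat k) (M : modcat D).
Implicit Types (x y : D) (m n : M).

Lemma aassoc_natl x x' y y' m (f : mor x x') (g : mor y y') :
  aassoc x' y' m ∘ (f ⊗₁ g) ▷₁ idm m = f ▷₁ (g ▷₁ idm m) ∘ aassoc x y m.
Proof. exact: aassoc_nat. Qed.

Lemma aassoc_nat1 x x' y m (f : mor x x') :
  aassoc x' y m ∘ (f ⊗₁ idm y) ▷₁ idm m = f ▷₁ idm (y ▷ m) ∘ aassoc x y m.
Proof. by rewrite aassoc_nat bmap1. Qed.

Lemma aassoc_nat3 x y m m' (h : mor m m') :
  aassoc x y m' ∘ idm (x ⊗ y) ▷₁ h = idm x ▷₁ (idm y ▷₁ h) ∘ aassoc x y m.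
Proof. by rewrite -aassoc_nat bmap1. Qed.

Lemma alun_assoc x m : alun (x ▷ m) ∘ aassoc 𝟙 x m = mlun x ▷₁ idm m.
Proof. exact: (@pm_lun_assoc _ _ (premod_of M)). Qed.

(* Locked, here and below: rewriting with cmpA matches up to conversion and would
   otherwise unfold these composites. *)
Definition aev x m : mor (x^∨ ▷ x ▷ m) m :=
  locked (alun m ∘ (rdev x ▷₁ idm m ∘ isoinv (aassoc (x^∨) x m))).

Definition acoev x m : mor m (x ▷ x^∨ ▷ m) :=
  locked (aassoc x (x^∨) m ∘ (rdcoev x ▷₁ idm m ∘ isoinv (alun m))).

Lemma aevE x m :
  aev x m = alun m ∘ (rdev x ▷₁ idm m ∘ isoinv (aassoc (x^∨) x m)).
Proof. by rewrite [LHS]/aev -lock. Qed.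

Lemma acoevE x m :
  acoev x m = aassoc x (x^∨) m ∘ (rdcoev x ▷₁ idm m ∘ isoinv (alun m)).
Proof. by rewrite [LHS]/acoev -lock. Qed.

Lemma aev_nat x m n (f : mor m n) :
  aev x n ∘ idm (x^∨) ▷₁ (idm x ▷₁ f) = f ∘ aev x m.
Proof. rewrite ?aevE ?acoevE; exact: (@pm_ev_nat _ _ (premod_of M)). Qed.

Lemma acoev_nat x m n (f : mor m n) :
  acoev x n ∘ f = idm x ▷₁ (idm (x^∨) ▷₁ f) ∘ acoev x m.
Proof. rewrite ?aevE ?acoevE; exact: (@pm_coev_nat _ _ (premod_of M)). Qed.

Lemma aev_zig x m : idm x ▷₁ aev x m ∘ acoev x (x ▷ m) = idm (x ▷ m).
Proof. rewrite ?aevE ?acoevE; exact: (@pm_zig _ _ (premod_of M) _ _ _ _ (rdualP x)). Qed.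

Lemma aev_inj x m n (f g : mor n (x ▷ m)) :
  aev x m ∘ idm (x^∨) ▷₁ f = aev x m ∘ idm (x^∨) ▷₁ g -> f = g.
Proof. by rewrite !aevE; apply: (@pm_ev_inj _ _ (premod_of M) _ _ _ _ (rdualP x)). Qed.

Lemma aevK x m n (f : mor (x^∨ ▷ n) m) :
  aev x m ∘ idm (x^∨) ▷₁ (idm x ▷₁ f ∘ acoev x n) = f.
Proof. rewrite aevE acoevE; exact: (@pm_evK _ _ (premod_of M) _ _ _ _ (rdualP x)). Qed.

End ModuleDuality.

(** * Module functors and their mates *)

Section ModuleFunctors.
Variables (k : fieldType) (C : ftcat k) (N N' : modcat C) (G : functor N N').

(** A left adjoint carries its module structure in this direction and its right adjoint inherits a
    [lax] one as a mate. Rigidity makes the latter invertible, so the construction can be repeated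
    along a chain of adjoints. *)
Record oplax (l : forall c n, mor (G (c ▷ n)) (c ▷ G n)) : Prop := Oplax {
  oplax_nat : forall c c' n n' (f : mor c c') (g : mor n n'),
    l c' n' ∘ fmap G (f ▷₁ g) = f ▷₁ fmap G g ∘ l c n;
  oplax_assoc : forall c c' n, aassoc c c' (G n) ∘ l (c ⊗ c') n =
    idm c ▷₁ l c' n ∘ l c (c' ▷ n) ∘ fmap G (aassoc c c' n);
  oplax_unit : forall n, alun (G n) ∘ l 𝟙 n = fmap G (alun n)
}.

Record lax (r : forall c n, mor (c ▷ G n) (G (c ▷ n))) : Prop := Lax {
  lax_nat : forall c c' n n' (f : mor c c') (g : mor n n'),
    r c' n' ∘ f ▷₁ fmap G g = fmap G (f ▷₁ g) ∘ r c n;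
  lax_assoc : forall c c' n, r c (c' ▷ n) ∘ (idm c ▷₁ r c' n ∘ aassoc c c' (G n))
    = fmap G (aassoc c c' n) ∘ r (c ⊗ c') n;
  lax_unit : forall n, fmap G (alun n) ∘ r 𝟙 n = alun (G n)
}.

Lemma oplax_inv r : lax r -> (forall c n, is_iso (r c n)) ->
  oplax (fun c n => isoinv (r c n)).
Proof.
move=> [rn ra ru] ri; split.
- move=> c c' n n' f g; apply: isoinv_square; [exact: ri | exact: ri | exact: rn].
- move=> c c' n; apply: (iso_epic (ri _ _)); rewrite -!cmpA isoinvK // cmpm1.
  rewrite -ra isoinvKl // cmpA -bmap_fixl isoinvK // bmap1 cmp1m //.
- by move=> n; apply: (iso_epic (ri _ _)); rewrite -!cmpA isoinvK // cmpm1 ru.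
Qed.

(* Rigidity of [C] provides the inverse
   G (c ▷ n) -> c ▷ c^∨ ▷ G (c ▷ n) -> c ▷ G (c^∨ ▷ c ▷ n) -> c ▷ G n. *)
Lemma lax_iso r : lax r -> forall c n, is_iso (r c n).
Proof.
move=> [rn ra ru] c n.
have rn1 a m m' (g : mor m m') : r a m' ∘ idm a ▷₁ fmap G g = fmap G (idm a ▷₁ g) ∘ r a m.
  exact: rn.
have rn2 a b (f : mor a b) m : r b m ∘ f ▷₁ idm (G m) = fmap G (f ▷₁ idm m) ∘ r a m.
  by rewrite -rn fmap1.
have ai a b m : is_iso (aassoc (M := N) a b m) by apply: aassoc_iso.
have ai' a b m : is_iso (aassoc (M := N') a b m) by apply: aassoc_iso.
have li m : is_iso (alun (M := N) m) by apply: alun_iso.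
have li' m : is_iso (alun (M := N') m) by apply: alun_iso.
(* Evaluation and coevaluation pass through G up to r; by [evE] and [coevE] both composites with the
   candidate inverse reduce to [aev_zig]. *)
have evE : fmap G (aev c n) ∘ (r (c^∨) (c ▷ n) ∘ idm (c^∨) ▷₁ r c n) = aev c (G n).
  apply: (iso_epic (ai' _ _ _)); rewrite -!cmpA ra !aevE -!cmpA isoinvK // cmpm1.
  rewrite !fmapM -!cmpA (cmpA (fmap G (isoinv _))) -fmapM isoinvK // fmap1 cmp1m.
  by rewrite -rn2 cmpA ru.
have coevE : r c (c^∨ ▷ (c ▷ n)) ∘ (idm c ▷₁ r (c^∨) (c ▷ n) ∘ acoev c (G (c ▷ n))) =
    fmap G (acoev c (c ▷ n)).
  rewrite !acoevE (cmpA (idm c ▷₁ _) (aassoc _ _ _)) (cmpA (r c _)) ra -!cmpA.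
  rewrite (cmpA (r (c ⊗ c^∨) _)) rn2 -!cmpA !fmapM; congr (_ ∘ (_ ∘ _)).
  apply: (iso_epic (li' _)); rewrite -!cmpA isoinvK // cmpm1 -ru cmpA -fmapM.
  by rewrite isoinvK // fmap1 cmp1m.
apply: (@iso_of_inverse _ _ _ _ _
  (idm c ▷₁ (fmap G (aev c n) ∘ r (c^∨) (c ▷ n)) ∘ acoev c (G (c ▷ n)))).
  rewrite -!cmpA acoev_nat cmpA -bmap_fixl.
  by rewrite -cmpA evE aev_zig.
by rewrite bmap_fixl -cmpA (cmpA (r c n)) rn1 -cmpA coevE -fmapM aev_zig fmap1.
Qed.

Section Strong.
Variable l : forall c n, mor (G (c ▷ n)) (c ▷ G n).
Hypothesis lP : oplax l.

Lemma oplax_natl c n n' (g : mor n n') :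
  l c n' ∘ fmap G (idm c ▷₁ g) = idm c ▷₁ fmap G g ∘ l c n.
Proof. exact: oplax_nat. Qed.

Lemma oplax_natr c c' (f : mor c c') n :
  l c' n ∘ fmap G (f ▷₁ idm n) = f ▷₁ idm (G n) ∘ l c n.
Proof. by rewrite oplax_nat // fmap1. Qed.

Lemma oplax_ev c n :
  aev c (G n) ∘ (idm (c^∨) ▷₁ l c n ∘ l (c^∨) (c ▷ n)) = fmap G (aev c n).
Proof.
rewrite !aevE -!cmpA.
have -> : isoinv (aassoc (c^∨) c (G n)) ∘ (idm (c^∨) ▷₁ l c n ∘ l (c^∨) (c ▷ n)) =
    l (c^∨ ⊗ c) n ∘ isoinv (fmap G (aassoc (c^∨) c n)).
  apply: move_isor; first by iso.
  by rewrite -cmpA -(oplax_assoc lP) isoinvKl //; iso.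
rewrite (cmpA (_ ▷₁ _)) -oplax_natr -!cmpA (cmpA (alun _)) (oplax_unit lP).
by rewrite !fmapM fmap_isoinv //; iso.
Qed.

End Strong.
End ModuleFunctors.

Section Mates.
Variables (k : fieldType) (C : ftcat k) (N N' : modcat C).
Variables (L : functor N N') (R : functor N' N) (adj : adjunction L R).
Variable l : forall c n, mor (L (c ▷ n)) (c ▷ L n).
Hypothesis lP : oplax l.

(** [ra_left], [rra_left] and [ihom_actr] are all instances, so their coherence and invertibility
    are proved once. *)
Definition mate (c : C) (n : N') : mor (c ▷ R n) (R (c ▷ n)) :=
  locked (fmap R (idm c ▷₁ acounit adj n ∘ l c (R n)) ∘ aunit adj (c ▷ R n)).

Lemma mateE c n :
  mate c n = fmap R (idm c ▷₁ acounit adj n ∘ l c (R n)) ∘ aunit adj (c ▷ R n).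
Proof. by rewrite /mate -lock. Qed.

Lemma mate_counit c n : acounit adj (c ▷ n) ∘ fmap L (mate c n) =
  idm c ▷₁ acounit adj n ∘ l c (R n).
Proof. by rewrite mateE; apply: adj_curryK. Qed.

Lemma mate_unit c x :
  mate c (L x) ∘ idm c ▷₁ aunit adj x = fmap R (l c x) ∘ aunit adj (c ▷ x).
Proof.
apply: (adj_inj (adj := adj)); rewrite adj_curryK fmapM cmpA mate_counit -cmpA.
by rewrite (oplax_natl lP) cmpA -bmap_fixl adj_triL bmap1 cmp1m.
Qed.

(** Doctrinal adjunction: transposed along the adjunction, each axiom becomes by [mate_counit] the
    corresponding axiom of [l]. *)
Lemma mate_lax : lax mate.
Proof.
split.
- move=> c c' n n' f g; apply: (adj_inj (adj := adj)).
  rewrite !fmapM !cmpA mate_counit -acounit_nat -cmpA (oplax_nat lP) cmpA -bmapM.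
  rewrite -[in RHS]cmpA mate_counit [in RHS]cmpA -bmapM cmp1m cmpm1.
  by rewrite acounit_nat.
- move=> c c' n; apply: (adj_inj (adj := adj)).
  rewrite !fmapM !cmpA mate_counit -acounit_nat -[in RHS]cmpA mate_counit.
  rewrite -!cmpA (cmpA (l c _)) (oplax_natl lP) -!cmpA (cmpA (_ ▷₁ _)) -bmap_fixl.
  rewrite mate_counit bmap_fixl -!cmpA; rewrite [in RHS]cmpA aassoc_nat3 -[in RHS]cmpA.
  by congr (_ ∘ _); rewrite cmpA (oplax_assoc lP).
- move=> n; apply: (adj_inj (adj := adj)).
  rewrite fmapM cmpA -acounit_nat -cmpA mate_counit cmpA alun_nat -cmpA.
  by rewrite (oplax_unit lP).
Qed.

Lemma mate_iso c n : is_iso (mate c n).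
Proof. exact: lax_iso mate_lax c n. Qed.

Lemma mate_oplax : oplax (fun c n => isoinv (mate c n)).
Proof. by apply: oplax_inv; [exact: mate_lax | exact: mate_iso]. Qed.

End Mates.

(** * Duality in a rigid monoidal category *)

Section TensorDuality.
Variables (k : fieldType) (D : ftcat k).
Implicit Types x y z w b : D.

Lemma aev_unit x : aev (M := reg D) x 𝟙 = rdev x ∘ (idm (x^∨) ⊗₁ mrun x).
Proof.
rewrite aevE /= mlun_unit cmpA mrun_nat -cmpA -mrun_assoc.
by rewrite -cmpA isoinvKV ?cmpm1 //; iso.
Qed.

Lemma rdev_injl x y (f g : mor y x) :
  rdev x ∘ (idm (x^∨) ⊗₁ f) = rdev x ∘ (idm (x^∨) ⊗₁ g) -> f = g.
Proof.
move=> E; have ri := mrun_iso x.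
suff : isoinv (mrun x) ∘ f = isoinv (mrun x) ∘ g.
  exact/iso_monic/is_iso_inv.
apply: (aev_inj (M := reg D)); rewrite aev_unit -!cmpA -!bmap_fixl /=.
by rewrite !isoinvKVl.
Qed.

(* Hom(z ⊗ x, b) ≅ Hom(z, b ⊗ x^∨), of which transpose is the case b = 1. *)
Definition evr x b : mor (b ⊗ x^∨ ⊗ x) b :=
  locked (mrun b ∘ ((idm b ⊗₁ rdev x) ∘ massoc b (x^∨) x)).

Definition tpose z x b (f : mor (z ⊗ x) b) : mor z (b ⊗ x^∨) :=
  locked ((f ⊗₁ idm (x^∨)) ∘ (isoinv (massoc z x (x^∨))
    ∘ ((idm z ⊗₁ rdcoev x) ∘ isoinv (mrun z)))).

Lemma evrE x b : evr x b = mrun b ∘ ((idm b ⊗₁ rdev x) ∘ massoc b (x^∨) x).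
Proof. by rewrite /evr -lock. Qed.

Lemma tposeE z x b (f : mor (z ⊗ x) b) : tpose f = (f ⊗₁ idm (x^∨))
    ∘ (isoinv (massoc z x (x^∨)) ∘ ((idm z ⊗₁ rdcoev x) ∘ isoinv (mrun z))).
Proof. by rewrite /tpose -lock. Qed.

Lemma tposeK z x b (f : mor (z ⊗ x) b) : evr x b ∘ (tpose f ⊗₁ idm x) = f.
Proof.
have := @pm_evK _ _ (premod_reg (rev_mon D)) _ _ _ _ (rev_rdual (rdualP x)) b z f.
rewrite /pm_ev /pm_coev /= isoinvV; last by iso.
by rewrite evrE tposeE => {2}<-.
Qed.

Lemma evr_inj x b z (f g : mor z (b ⊗ x^∨)) :
  evr x b ∘ (f ⊗₁ idm x) = evr x b ∘ (g ⊗₁ idm x) -> f = g.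
Proof.
move=> E.
apply: (@pm_ev_inj _ _ (premod_reg (rev_mon D)) _ _ _ _ (rev_rdual (rdualP x))).
by rewrite /pm_ev /= isoinvV -?evrE //; iso.
Qed.

Lemma evr_nat x b b' (f : mor b b') :
  evr x b' ∘ ((f ⊗₁ idm (x^∨)) ⊗₁ idm x) = f ∘ evr x b.
Proof.
rewrite !evrE -!cmpA massoc_nat bmap1 (cmpA (_ ⊗₁ _)) -bmap_rl bmap_lr -!cmpA.
by rewrite cmpA mrun_nat -!cmpA.
Qed.

Lemma tpose_uniq x b z (f : mor (z ⊗ x) b) (g : mor z (b ⊗ x^∨)) :
  evr x b ∘ (g ⊗₁ idm x) = f -> tpose f = g.
Proof. by move=> E; apply: evr_inj; rewrite tposeK. Qed.

Lemma tpose_natl z z' x b (f : mor (z ⊗ x) b) (g : mor z' z) :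
  tpose (f ∘ (g ⊗₁ idm x)) = tpose f ∘ g.
Proof. by apply: tpose_uniq; rewrite bmap_fixr cmpA tposeK. Qed.

Lemma transposeE z x (f : mor (z ⊗ x) 𝟙) : transpose f = mlun (x^∨) ∘ tpose f.
Proof. by rewrite /transpose tposeE -!cmpA. Qed.

Lemma evr_unit x : evr x 𝟙 = rdev x ∘ (mlun (x^∨) ⊗₁ idm x).
Proof.
by rewrite evrE -mlun_unit cmpA mlun_nat -cmpA mlun_assoc.
Qed.

Lemma transposeK z x (f : mor (z ⊗ x) 𝟙) : rdev x ∘ (transpose f ⊗₁ idm x) = f.
Proof. by rewrite transposeE bmap_fixr cmpA -evr_unit tposeK. Qed.

Lemma rdev_injr x z (f g : mor z (x^∨)) :
  rdev x ∘ (f ⊗₁ idm x) = rdev x ∘ (g ⊗₁ idm x) -> f = g.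
Proof.
move=> E; have li := mlun_iso (x^∨).
suff : isoinv (mlun (x^∨)) ∘ f = isoinv (mlun (x^∨)) ∘ g.
  exact/iso_monic/is_iso_inv.
apply: evr_inj; rewrite evr_unit -!cmpA -!bmap_fixr.
by rewrite !isoinvKVl.
Qed.

Lemma transpose_uniq z x (f : mor (z ⊗ x) 𝟙) (g : mor z (x^∨)) :
  rdev x ∘ (g ⊗₁ idm x) = f -> transpose f = g.
Proof. by move=> E; apply: rdev_injr; rewrite transposeK. Qed.

Lemma rdev_dualm x y (f : mor x y) :
  rdev x ∘ (dualm f ⊗₁ idm x) = rdev y ∘ (idm (y^∨) ⊗₁ f).
Proof. exact: transposeK. Qed.

Lemma dualm_cmp x y z (g : mor y z) (f : mor x y) :
  dualm (g ∘ f) = dualm f ∘ dualm g.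
Proof.
apply: transpose_uniq; rewrite bmap_fixr cmpA rdev_dualm -cmpA -bmap_rl bmap_lr.
by rewrite cmpA rdev_dualm -cmpA -bmap_fixl.
Qed.

Lemma dualm1 x : dualm (idm x) = idm (x^∨).
Proof. exact: transpose_uniq. Qed.

Lemma dualm_iso x y (f : mor x y) : is_iso f -> is_iso (dualm f).
Proof.
case=> g [gf fg]; exists (dualm g).
by split; rewrite -dualm_cmp ?fg ?gf dualm1.
Qed.

(** Evaluation on x ⊗ y is evaluation on x followed by evaluation on y. Since evaluation is
    nondegenerate, this characterizes [dual_tens]. *)
Lemma rdev_dual_tens x y w (h : mor w (y^∨ ⊗ x^∨)) :
  rdev (x ⊗ y) ∘ ((dual_tens x y ∘ h) ⊗₁ idm (x ⊗ y)) ∘ massoc w x y =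
  rdev y ∘ ((evr x (y^∨) ∘ (h ⊗₁ idm x)) ⊗₁ idm y).
Proof.
rewrite bmap_fixr cmpA transposeK -!cmpA -(bmap1 tens x y) -massoc_nat.
rewrite evrE !bmap_fixr -!cmpA (cmpA (massoc _ _ (_ ⊗ _))) mpentagon -!cmpA.
congr (_ ∘ _); rewrite !bmap_fixl -!cmpA (cmpA (idm _ ⊗₁ isoinv _)) -bmap_fixl.
rewrite isoinvK ?bmap1 ?cmp1m; last by iso.
rewrite (cmpA (idm _ ⊗₁ (_ ⊗₁ _))) -massoc_nat -!cmpA (cmpA (idm _ ⊗₁ mlun _)).
by rewrite mtriangle.
Qed.

Lemma dual_tens_iso x y : is_iso (dual_tens x y).
Proof.
apply: iso_of_bij => w g.
have ai : is_iso (massoc w x y) by iso.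
(* Transposing along y and then along x inverts the formula of [rdev_dual_tens]. *)
exists (tpose (transpose (rdev (x ⊗ y) ∘ (g ⊗₁ idm _) ∘ massoc w x y))); split.
  apply: rdev_injr; apply: (iso_epic ai).
  by rewrite rdev_dual_tens tposeK transposeK.
by move=> h <-; rewrite rdev_dual_tens; apply: tpose_uniq; rewrite transposeE;
  apply/esym; rewrite -transposeE; apply: transpose_uniq.
Qed.

End TensorDuality.

(* T is a strong module functor out of the regular module category, R its right
   adjoint and [om] : R s -> 1; then [ptr a f] is a partial trace of [f]. *)
(** * Partial traces along a strong module functor *)

Section PartialTrace.
Variables (k : fieldType) (C : ftcat k) (N : modcat C).
Variables (T : functor C N) (R : functor N C) (adj : adjunction T R).
Variable l : forall c x, mor (T (c ⊗ x)) (c ▷ T x).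
Hypothesis lP : oplax (N := reg C) l.
Variables (s : N) (om : mor (R s) (𝟙 : C)).
Implicit Types (x y a b : C) (n : N).

Local Notation ε := (acounit adj).
Local Notation η := (aunit adj).

Let r c n : mor (c ⊗ R n) (R (c ▷ n)) := mate (N := reg C) adj l c n.
Let ri c n : is_iso (r c n).
Proof. exact: (mate_iso (N := reg C) adj lP). Qed.

Definition trc x (f : mor (T x) s) : mor x 𝟙 :=
  locked (om ∘ (fmap R f ∘ η x) : mor (x : C) 𝟙).

Definition ptr a x (f : mor (T x) (a ▷ s)) : mor x a :=
  locked (mrun a ∘ ((idm a ⊗₁ om) ∘ (isoinv (r a s) ∘ (fmap R f ∘ η x)))).

Lemma trcE x (f : mor (T x) s) : trc f = om ∘ (fmap R f ∘ η x).
Proof. by rewrite /trc -lock. Qed.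

Lemma ptrE a x (f : mor (T x) (a ▷ s)) :
  ptr f = mrun a ∘ ((idm a ⊗₁ om) ∘ (isoinv (r a s) ∘ (fmap R f ∘ η x))).
Proof. by rewrite /ptr -lock. Qed.

Lemma trc_nat x y (f : mor (T y) s) (u : mor x y) :
  trc (f ∘ fmap T u) = trc f ∘ u.
Proof.
by rewrite !trcE fmapM -!cmpA; congr (_ ∘ (_ ∘ _)); rewrite (aunit_nat adj).
Qed.

Lemma ptr_nat a x y (f : mor (T y) (a ▷ s)) (u : mor x y) :
  ptr (f ∘ fmap T u) = ptr f ∘ u.
Proof.
rewrite !ptrE fmapM -!cmpA; congr (_ ∘ (_ ∘ (_ ∘ (_ ∘ _)))).
by rewrite (aunit_nat adj).
Qed.

Lemma trc_counit n (g : mor n s) : trc (g ∘ ε n) = om ∘ fmap R g.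
Proof. by rewrite trcE fmapM -cmpA adj_triR cmpm1. Qed.

Lemma trc_factor n (g : mor n s) x (f : mor (T x) n) :
  trc (g ∘ f) = trc (g ∘ ε n) ∘ (fmap R f ∘ η x).
Proof. by rewrite trc_counit trcE fmapM -!cmpA. Qed.

(** As R is a strong module functor, every T x -> a ▷ n factors through a ⊗ R n; statements on
    partial traces thereby reduce to the case computed in [ptr_act]. *)
Lemma ptr_factor a x n (f : mor (T x) (a ▷ n)) :
  f = (idm a ▷₁ ε n) ∘ (l a (R n) ∘ fmap T (isoinv (r a n) ∘ (fmap R f ∘ η x))).
Proof.
rewrite (cmpA (idm a ▷₁ _)) -(mate_counit (N := reg C) adj l) -cmpA -fmapM.
by rewrite isoinvKVl ?adj_curryK.
Qed.

Lemma ptr_act a x (f : mor (T x) s) :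
  ptr ((idm a ▷₁ f) ∘ l a x) = mrun a ∘ (idm a ⊗₁ trc f).
Proof.
have rE := oplax_natl (mate_oplax (N := reg C) adj lP) a f; rewrite /= -/(r a s) in rE.
have uE := mate_unit (N := reg C) adj lP a x; rewrite /= -/(r a (T x)) in uE.
rewrite ptrE trcE fmapM -!cmpA -uE (cmpA (isoinv _)) rE -!cmpA isoinvKl //.
by rewrite -!bmap_fixl.
Qed.

Lemma ptr_natr a b x (f : mor (T x) (a ▷ s)) (v : mor a b) :
  ptr ((v ▷₁ idm s) ∘ f) = v ∘ ptr f.
Proof.
have E := oplax_natr (mate_oplax (N := reg C) adj lP) v s; rewrite /= -/(r a s) -/(r b s) in E.
rewrite !ptrE fmapM -!cmpA (cmpA (isoinv _)) E -!cmpA.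
by rewrite (cmpA (idm b ⊗₁ _)) -bmap_rl bmap_lr -!cmpA cmpA mrun_nat -cmpA.
Qed.

Lemma ptr_actM a b x (f : mor (T x) (a ▷ s)) :
  ptr (isoinv (aassoc b a s) ∘ ((idm b ▷₁ f) ∘ l b x)) = idm b ⊗₁ ptr f.
Proof.
pose u := isoinv (r a s) ∘ (fmap R f ∘ η x).
have fE : f = (idm a ▷₁ ε s) ∘ (l a (R s) ∘ fmap T u) by apply: ptr_factor.
have pE : ptr f = mrun a ∘ ((idm a ⊗₁ om) ∘ u) by rewrite ptrE.
clearbody u.
have -> : isoinv (aassoc b a s) ∘ (idm b ▷₁ f ∘ l b x) =
    (idm (b ⊗ a) ▷₁ ε s) ∘ l (b ⊗ a) (R s)
      ∘ fmap T (isoinv (massoc b a (R s)) ∘ (idm b ⊗₁ u)).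
  have ai : is_iso (aassoc b a s) by iso.
  apply: (iso_monic ai); rewrite isoinvKVl // {1}fE !bmap_fixl -!cmpA.
  rewrite (cmpA (aassoc _ _ _)) aassoc_nat3 -!cmpA; congr (_ ∘ _).
  have := oplax_assoc lP b a (R s) => /= lA.
  rewrite (cmpA (aassoc _ _ _)) lA -!cmpA; congr (_ ∘ _).
  rewrite -fmapM isoinvKVl; last by iso.
  by have /= -> := oplax_natl lP b u.
rewrite ptr_nat ptr_act -[ε s]cmp1m trc_counit fmap1 cmpm1 pE.
have ai : is_iso (massoc b a 𝟙) by iso.
have E := isoinv_square (massoc_iso b a (R s)) ai (massoc_nat (idm b) (idm a) om).
rewrite bmap1 in E.
rewrite -!cmpA (cmpA (idm (b ⊗ a) ⊗₁ om)) -E !bmap_fixl -mrun_assoc -!cmpA.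
by rewrite isoinvKVl.
Qed.

(** Pairing with a^∨ turns partial traces into traces. Since evaluation is nondegenerate, the
    universal property of s for traces extends to partial traces in [ptr_ex] and [ptr_inj]. *)
Lemma ptr_trc_ev a y (f : mor (T y) (a ▷ s)) :
  trc (aev a s ∘ ((idm (a^∨) ▷₁ f) ∘ l (a^∨) y)) = rdev a ∘ (idm (a^∨) ⊗₁ ptr f).
Proof.
pose u := isoinv (r a s) ∘ (fmap R f ∘ η y).
have fE : f = (idm a ▷₁ ε s) ∘ (l a (R s) ∘ fmap T u) by apply: ptr_factor.
have pE : ptr f = mrun a ∘ ((idm a ⊗₁ om) ∘ u) by rewrite ptrE.
clearbody u; rewrite pE {1}fE !bmap_fixl.
rewrite -!cmpA (cmpA (aev a s)) aev_nat -!cmpA.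
have lN := oplax_natl lP (a^∨) u; rewrite /= in lN; rewrite -lN.
have lE := oplax_ev lP a (R s); rewrite /= in lE.
rewrite (cmpA (_ ▷₁ _)) (cmpA (aev a _)) lE -fmapM trc_nat.
rewrite -[ε s]cmp1m trc_counit fmap1 cmpm1.
have eN := aev_nat (M := reg C) a om; rewrite /= in eN.
by rewrite cmpA -eN aev_unit -!cmpA.
Qed.

(* [s] represents [n |-> Hom (R n, 1)], with universal element [om]. *)
Definition utrace := forall n (b : mor (R n) (𝟙 : C)),
  exists! g : mor n s, om ∘ fmap R g = b.

Hypothesis omU : utrace.

Lemma trc_ex n (b : mor (R n) (𝟙 : C)) :
  exists g : mor n s, forall x (f : mor (T x) n), trc (g ∘ f) = b ∘ (fmap R f ∘ η x).
Proof.
have [g [gE _]] := omU b; exists g => x f.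
by rewrite trc_factor trc_counit gE.
Qed.

Lemma trc_inj n (g h : mor n s) :
  (forall x (f : mor (T x) n), trc (g ∘ f) = trc (h ∘ f)) -> g = h.
Proof.
move=> E; have [c [_ cu]] := omU (om ∘ fmap R h).
by rewrite -(cu g) ?(cu h) // -!trc_counit E.
Qed.

Lemma ptr_ex a n (b : mor (R n) (a : C)) :
  exists g : mor n (a ▷ s),
    forall x (f : mor (T x) n), ptr (g ∘ f) = b ∘ (fmap R f ∘ η x).
Proof.
(* Pairing b with a^∨ gives a functional on R (a^∨ ▷ n) ≅ a^∨ ⊗ R n; the map representing it is then
   transposed to n -> a ▷ s. *)
have [g' gE] := trc_ex (rdev a ∘ ((idm (a^∨) ⊗₁ b) ∘ isoinv (r (a^∨) n))).
exists ((idm a ▷₁ g') ∘ acoev a n) => x f.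
apply: rdev_injl; rewrite -ptr_trc_ev bmap_fixl (cmpA (aev a s)) (cmpA (aev a s)).
rewrite aevK -!cmpA gE -!cmpA; congr (_ ∘ _).
have rE := oplax_natl (mate_oplax (N := reg C) adj lP) (a^∨) f; rewrite /= in rE.
have uE := mate_unit (N := reg C) adj lP (a^∨) x; rewrite /= in uE.
rewrite fmapM -!cmpA -uE (cmpA (isoinv _)) rE -!cmpA (isoinvKl _ (ri _ _)).
by rewrite -!bmap_fixl.
Qed.

Lemma ptr_inj a n (g h : mor n (a ▷ s)) :
  (forall x (f : mor (T x) n), ptr (g ∘ f) = ptr (h ∘ f)) -> g = h.
Proof.
move=> E; apply: aev_inj; apply: trc_inj => x f.
pose u := isoinv (r (a^∨) n) ∘ (fmap R f ∘ η x).
have -> : f = (idm (a^∨) ▷₁ ε n) ∘ (l (a^∨) (R n) ∘ fmap T u) by apply: ptr_factor.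
rewrite -!cmpA (cmpA (_ ▷₁ g)) (cmpA (_ ▷₁ h)) -!bmap_fixl.
rewrite (cmpA (_ ▷₁ _) (l _ _)) (cmpA (aev a s)) [in RHS](cmpA (_ ▷₁ _) (l _ _)).
by rewrite [in RHS](cmpA (aev a s)) !trc_nat !ptr_trc_ev E.
Qed.

End PartialTrace.

(** * The relative modular object as a universal trace *)

Section RevFunctor.
Variables (k : fieldType) (C D : ftcat k) (F : tensor_functor C D).

Program Definition rev_fun : tensor_functor (rev_ft C) (rev_ft D) :=
  @TensorFunctor k (rev_ft C) (rev_ft D) F (fun x y => tf_mu F y x)
    _ _ (tf_eps F) (tf_eps_iso F) _ _ _ (@tf_exact _ _ _ F).
Next Obligation. by move=> x y; exact: (tf_mu_iso F y x). Qed.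
Next Obligation. by move=> x x' y y' f g; exact: (tf_mu_nat F g f). Qed.
Next Obligation.
move=> x y z /=.
have ai : is_iso (massoc (F z) (F y) (F x)) by iso.
apply: (iso_epic ai); rewrite -!cmpA isoinvK // cmpm1 (cmpA (tf_mu F z _)) -tf_assoc.
rewrite fmap_isoinv; last by iso.
by rewrite -!cmpA isoinvKl //; iso.
Qed.
Next Obligation. by move=> x; exact: (tf_run F x). Qed.
Next Obligation. by move=> x; exact: (tf_lun F x). Qed.

Definition rev_right_adjoints (R : right_adjoints F) : right_adjoints rev_fun :=
  @RightAdjoints k (rev_ft C) (rev_ft D) rev_fun
    (ra R) (ra_adj R) (rra R) (rra_adj R).

Definition rev_left_adjoint (L : left_adjoint F) : left_adjoint rev_fun :=
  @LeftAdjoint k (rev_ft C) (rev_ft D) rev_fun (la L) (la_adj L).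

End RevFunctor.

Section TensorFunctor.
Variables (k : fieldType) (C D : ftcat k) (F : tensor_functor C D).
Variable R : right_adjoints F.

Definition tf_l (c x : C) : mor (F (c ⊗ x)) (F c ⊗ F x) := isoinv (tf_mu F c x).

Lemma tf_oplax : oplax (N := reg C) (N' := twist F (reg D)) (G := F) tf_l.
Proof.
split.
- by move=> c c' n n' f g; apply: isoinv_square;
    [exact: tf_mu_iso | exact: tf_mu_iso | exact: tf_mu_nat].
- move=> c c' n; rewrite /= /twist_assoc /= fmap1 -[in RHS]cmpA -tf_assoc_inv.
  by rewrite -cmpA.
- move=> x; rewrite /= /twist_lun /= -tf_lun -!cmpA (cmpA (tf_eps F ⊗₁ _)).
  rewrite -bmap_fixr isoinvKV ?bmap1 ?cmp1m; last by iso.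
  by rewrite isoinvKV ?cmpm1 //; iso.
Qed.

Lemma ra_leftE c d :
  ra_left R c d = mate (N := reg C) (N' := twist F (reg D)) (ra_adj R) tf_l c d.
Proof. by rewrite mateE /= fmap1. Qed.

Lemma ra_left_iso c d : is_iso (ra_left R c d).
Proof. rewrite ra_leftE; exact: (mate_iso _ tf_oplax). Qed.

Lemma ra_left_oplax : oplax (N := twist F (reg D)) (N' := reg C) (G := ra R)
  (fun c d => isoinv (ra_left R c d)).
Proof.
have [a b c] := mate_oplax (N := reg C) (N' := twist F (reg D)) (ra_adj R) tf_oplax.
by split=> *; rewrite ?ra_leftE; [exact: a | exact: b | exact: c].
Qed.

Lemma rra_leftE c x : rra_left R c x =
  mate (N := twist F (reg D)) (N' := reg C) (rra_adj R)
    (fun c d => isoinv (ra_left R c d)) c x.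
Proof. by rewrite mateE. Qed.

Lemma rra_left_iso c x : is_iso (rra_left R c x).
Proof. rewrite rra_leftE; exact: (mate_iso _ ra_left_oplax). Qed.

Lemma rra_left_counit c x : acounit (rra_adj R) (c ⊗ x) ∘ fmap (ra R) (rra_left R c x) =
  (idm c ⊗₁ acounit (rra_adj R) x) ∘ isoinv (ra_left R c (rra R x)).
Proof.
rewrite rra_leftE.
exact: (mate_counit (N := twist F (reg D)) (N' := reg C) (rra_adj R)).
Qed.

Lemma rra_left_nat c c' x x' (f : mor c c') (g : mor x x') :
  rra_left R c' x' ∘ (fmap F f ⊗₁ fmap (rra R) g) =
  fmap (rra R) (f ⊗₁ g) ∘ rra_left R c x.
Proof.
rewrite !rra_leftE.
exact: (lax_nat (mate_lax (N := twist F (reg D)) (N' := reg C) (rra_adj R)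
  ra_left_oplax)).
Qed.

Definition om : mor (ra R (chi R)) (𝟙 : C) := acounit (rra_adj R) 𝟙.

Lemma om_utrace : utrace (N := twist F (reg D)) om.
Proof.
move=> n b; exists (fmap (rra R) b ∘ aunit (rra_adj R) n); split.
  exact: adj_curryK.
move=> g <-; exact: adj_uncurryK.
Qed.

Definition ctrc x (f : mor (F x) (chi R)) : mor x 𝟙 :=
  trc (C := C) (N := twist F (reg D)) (ra_adj R) om f.

(* Partial traces along F, whose value of the universal object is χ; phir has χ
   on the other side, and the half-braiding of χ exchanges the two. *)
Definition phil a x (f : mor (F x) (F a ⊗ chi R)) : mor x a :=
  ptr (C := C) (N := twist F (reg D)) (ra_adj R) tf_l om f.

Lemma phil_act a x (f : mor (F x) (chi R)) :
  phil ((idm (F a) ⊗₁ f) ∘ isoinv (tf_mu F a x)) = mrun a ∘ (idm a ⊗₁ ctrc f).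
Proof.
rewrite -(fmap1 F).
exact: (ptr_act (N := twist F (reg D)) (ra_adj R) tf_oplax).
Qed.

Lemma phil_nat a x y (f : mor (F y) (F a ⊗ chi R)) (u : mor x y) :
  phil (f ∘ fmap F u) = phil f ∘ u.
Proof. exact: (ptr_nat (N := twist F (reg D)) (ra_adj R)). Qed.

Lemma ctrc_nat x y (f : mor (F y) (chi R)) (u : mor x y) :
  ctrc (f ∘ fmap F u) = ctrc f ∘ u.
Proof. exact: (trc_nat (N := twist F (reg D)) (ra_adj R)). Qed.

Lemma ctrc_inj (n : D) (g h : mor n (chi R)) :
  (forall x (f : mor (F x) n), ctrc (g ∘ f) = ctrc (h ∘ f)) -> g = h.
Proof. exact: (@trc_inj _ C (twist F (reg D)) F (ra R) (ra_adj R) _ om om_utrace). Qed.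

Lemma ctrc_ex (n : D) (b : mor (ra R n) (𝟙 : C)) :
  exists g : mor n (chi R), forall x (f : mor (F x) n),
    ctrc (g ∘ f) = b ∘ (fmap (ra R) f ∘ aunit (ra_adj R) x).
Proof. exact: (@trc_ex _ C (twist F (reg D)) F (ra R) (ra_adj R) _ om om_utrace). Qed.

Lemma philE a x (f : mor (F x) (F a ⊗ chi R)) :
  phil f = mrun a ∘ ((idm a ⊗₁ om) ∘ (isoinv (ra_left R a (chi R))
    ∘ (fmap (ra R) f ∘ aunit (ra_adj R) x))).
Proof. by rewrite /phil ptrE -ra_leftE. Qed.

(** Through [rra_left], which identifies F a ⊗ χ with F^rra (a ⊗ 𝟙), the partial trace is just
    transposition along the two adjunctions. In this form it meets the definition of [chi_braid]. *)
Lemma philE' a x (f : mor (F x) (F a ⊗ chi R)) :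
  phil f = mrun a ∘ (acounit (rra_adj R) (a ⊗ 𝟙)
    ∘ (fmap (ra R) (rra_left R a 𝟙 ∘ f) ∘ aunit (ra_adj R) x)).
Proof.
by rewrite philE fmapM -!cmpA [in RHS](cmpA (acounit _ _)) rra_left_counit -!cmpA.
Qed.

End TensorFunctor.

Section Braiding.
Variables (k : fieldType) (C D : ftcat k) (F : tensor_functor C D).
Variable R : right_adjoints F.

Definition phir a x (f : mor (F x) (chi R ⊗ F a)) : mor x a :=
  @phil k (rev_ft C) (rev_ft D) (rev_fun F) (rev_right_adjoints R) a x f.

Lemma phir_act a x (f : mor (F x) (chi R)) :
  phir ((f ⊗₁ idm (F a)) ∘ isoinv (tf_mu F x a)) = mlun a ∘ (ctrc f ⊗₁ idm a).
Proof.
exact: (@phil_act k (rev_ft C) (rev_ft D) (rev_fun F) (rev_right_adjoints R)).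
Qed.

Lemma phir_nat a x y (f : mor (F y) (chi R ⊗ F a)) (u : mor x y) :
  phir (f ∘ fmap F u) = phir f ∘ u.
Proof.
exact: (@phil_nat k (rev_ft C) (rev_ft D) (rev_fun F) (rev_right_adjoints R)).
Qed.

Lemma phirE a x (f : mor (F x) (chi R ⊗ F a)) :
  phir f = mlun a ∘ (acounit (rra_adj R) (𝟙 ⊗ a)
    ∘ (fmap (ra R) (rra_right R 𝟙 a ∘ f) ∘ aunit (ra_adj R) x)).
Proof.
exact: (@philE' k (rev_ft C) (rev_ft D) (rev_fun F) (rev_right_adjoints R)).
Qed.

Lemma rra_right_nat c c' x x' (f : mor c c') (g : mor x x') :
  rra_right R x' c' ∘ (fmap (rra R) g ⊗₁ fmap F f) =
  fmap (rra R) (g ⊗₁ f) ∘ rra_right R x c.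
Proof.
exact: (@rra_left_nat k (rev_ft C) (rev_ft D) (rev_fun F) (rev_right_adjoints R)).
Qed.

Lemma rra_left_chi_braid c : rra_left R c 𝟙 ∘ chi_braid R c =
  fmap (rra R) (isoinv (mrun c) ∘ mlun c) ∘ rra_right R 𝟙 c.
Proof. by rewrite /chi_braid -(cmpA (isoinv _)) isoinvKVl //; apply: rra_left_iso. Qed.

Lemma chi_braid_nat c c' (f : mor c c') :
  chi_braid R c' ∘ (idm (chi R) ⊗₁ fmap F f) =
  (fmap F f ⊗₁ idm (chi R)) ∘ chi_braid R c.
Proof.
apply: (iso_monic (rra_left_iso R c' 𝟙)).
have El := rra_left_nat R f (idm 𝟙); have Er := rra_right_nat f (idm 𝟙).
rewrite fmap1 in El; rewrite fmap1 in Er.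
rewrite [LHS]cmpA rra_left_chi_braid -(cmpA (fmap _ _)) Er.
rewrite [RHS]cmpA El -(cmpA (fmap _ _)) rra_left_chi_braid.
apply: cmp_eq2; rewrite -2!fmapM; congr (fmap _ _).
rewrite -cmpA mlun_nat !cmpA; congr (_ ∘ _).
apply: isoinv_square; try by iso.
exact: mrun_nat.
Qed.

(** Both partial traces are the same double transposition, read through F^rra (a ⊗ 𝟙) and F^rra (𝟙 ⊗
    a); [chi_braid] is the passage between these two readings, and its unitors cancel against those
    of the traces. *)
Lemma phil_braid a x (f : mor (F x) (chi R ⊗ F a)) :
  phil (chi_braid R a ∘ f) = phir f.
Proof.
rewrite philE' phirE (cmpA (rra_left R a 𝟙)) rra_left_chi_braid.
rewrite -(cmpA (fmap (rra R) _)) (fmapM (ra R) (fmap (rra R) _)) -(cmpA (fmap _ _)).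
rewrite (cmpA (acounit _ _)) -acounit_nat -!(cmpA (isoinv (mrun a) ∘ _)).
by rewrite -(cmpA (isoinv (mrun a))) isoinvKVl //; iso.
Qed.

End Braiding.

(** * Relative Serre functors as universal traces *)

Section InternalHomAdjunction.
Variables (k : fieldType) (D : ftcat k) (M : modcat D) (H : internal_homs M).
Implicit Types (x y d : D) (m n : M).

Lemma ihcur_inj d m n (f g : mor d (ihom H m n)) :
  ihev H m n ∘ (f ▷₁ idm m) = ihev H m n ∘ (g ▷₁ idm m) -> f = g.
Proof. by move=> E; rewrite -(ihcur_uniq f) E ihcur_uniq. Qed.

Lemma ihcur_natl x y m n (f : mor (y ▷ m) n) (u : mor x y) :
  ihcur H (f ∘ (u ▷₁ idm m)) = ihcur H f ∘ u.
Proof. by apply: ihcur_inj; rewrite ihcurK bmap_fixr cmpA ihcurK. Qed.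

Lemma ihcur_ev m n : ihcur H (ihev H m n) = idm (ihom H m n).
Proof. by apply: ihcur_inj; rewrite ihcurK bmap1 cmpm1. Qed.

Lemma ihomr_ihcur x m n n' (g : mor n n') (f : mor (x ▷ m) n) :
  ihomr H m g ∘ ihcur H f = ihcur H (g ∘ f).
Proof. by rewrite -ihcur_natl -cmpA ihcurK. Qed.

Lemma ihoml_ihcur x m m' n (h : mor m m') (f : mor (x ▷ m') n) :
  ihoml H n h ∘ ihcur H f = ihcur H (f ∘ (idm x ▷₁ h)).
Proof. by rewrite -ihcur_natl -cmpA -bmap_rl bmap_lr cmpA ihcurK. Qed.

Program Definition ihomF m : functor M D :=
  Functor (fobj := ihom H m) (fmap := fun n n' f => ihomr H m f) _ _ _.
Next Obligation.
move=> m n n' a f g; apply: ihcur_inj; rewrite ihcurK bmap_linl cmp_linr !ihcurK.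
by rewrite cmp_linl.
Qed.
Next Obligation. by move=> m n; rewrite /ihomr cmp1m ihcur_ev. Qed.
Next Obligation.
by move=> m x y z g f; rewrite [in RHS]/ihomr -/(ihomr _ _ _) ihomr_ihcur cmpA.
Qed.

Program Definition ihadj m : adjunction (bfixr act m) (ihomF m) :=
  @Adjunction _ _ _ (bfixr act m) (ihomF m)
    (fun x => ihcur H (idm (x ▷ m))) (fun n => ihev H m n) _ _ _ _.
Next Obligation.
by move=> m x x' f /=; rewrite ihomr_ihcur -ihcur_natl cmp1m cmpm1.
Qed.
Next Obligation. by move=> m n n' g /=; rewrite ihcurK. Qed.
Next Obligation. by move=> m x /=; rewrite ihcurK. Qed.
Next Obligation. by move=> m n /=; rewrite ihomr_ihcur cmpm1 ihcur_ev. Qed.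

Lemma ihadj_curry m x n (f : mor (x ▷ m) n) :
  fmap (ihomF m) f ∘ aunit (ihadj m) x = ihcur H f.
Proof. by rewrite /= ihomr_ihcur cmpm1. Qed.

Lemma aassoc_oplax m :
  oplax (N := reg D) (G := bfixr act m) (fun d x => aassoc d x m).
Proof.
split.
- by move=> c c' n n' f g /=; rewrite aassoc_nat.
- by move=> c c' n /=; rewrite apentagon.
- by move=> n /=; rewrite alun_assoc.
Qed.

Lemma ihom_actrE d m n : ihom_actr H d m n =
  mate (N := reg D) (ihadj m) (fun d x => aassoc d x m) d n.
Proof. by rewrite mateE ihadj_curry. Qed.

Lemma ihom_actr_iso d m n : is_iso (ihom_actr H d m n).
Proof.
rewrite ihom_actrE.
exact: (@mate_iso _ _ (reg D) M (bfixr act m) _ (ihadj m) _ (aassoc_oplax m)).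
Qed.

Definition ihom_uncur d m n : mor (ihom H (d ▷ m) n ⊗ d) (ihom H m n) :=
  ihcur H (ihev H (d ▷ m) n ∘ aassoc (ihom H (d ▷ m) n) d m).

Lemma ihom_actlE d m n : ihom_actl H d m n = tpose (ihom_uncur d m n).
Proof. by rewrite tposeE /ihom_actl -!cmpA. Qed.

Lemma ihom_uncur_ihcur d m n x (f : mor (x ▷ d ▷ m) n) :
  ihom_uncur d m n ∘ (ihcur H f ⊗₁ idm d) = ihcur H (f ∘ aassoc x d m).
Proof. by rewrite -ihcur_natl -cmpA aassoc_nat1 cmpA ihcurK. Qed.

Lemma ihom_actl_ihcur d m n x (f : mor (x ▷ d ▷ m) n) :
  ihom_actl H d m n ∘ ihcur H f = tpose (ihcur H (f ∘ aassoc x d m)).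
Proof. by rewrite ihom_actlE -tpose_natl ihom_uncur_ihcur. Qed.

Lemma ihom_actl_iso d m n : is_iso (ihom_actl H d m n).
Proof.
apply: iso_of_bij => w g.
have ai : is_iso (aassoc w d m) by iso.
have gE : tpose (evr d (ihom H m n) ∘ (g ⊗₁ idm d)) = g by apply: tpose_uniq.
exists (ihcur H (ihev H m n ∘ ((evr d (ihom H m n) ∘ (g ⊗₁ idm d)) ▷₁ idm m)
  ∘ isoinv (aassoc w d m))); split.
  by rewrite ihom_actl_ihcur -cmpA isoinvK // cmpm1 ihcur_uniq.
move=> h hE; rewrite -[h]ihcur_uniq; congr (ihcur H _).
apply: (iso_epic ai); rewrite -[LHS]cmpA isoinvK // cmpm1 -hE ihom_actlE.
by rewrite -tpose_natl tposeK bmap_fixr cmpA ihcurK -!cmpA aassoc_nat1.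
Qed.

End InternalHomAdjunction.

Section ModuleTrace.
Variables (k : fieldType) (D : ftcat k) (M : modcat D) (H : internal_homs M).
Variables (m s : M) (tau : mor (ihom H m s) (𝟙 : D)).
Implicit Types (x y a b d : D) (n : M).

Definition mtr x (f : mor (x ▷ m) s) : mor x 𝟙 :=
  trc (T := bfixr act m) (ihadj H m) tau f.

Definition mptr a x (f : mor (x ▷ m) (a ▷ s)) : mor x a :=
  ptr (T := bfixr act m) (ihadj H m) (fun d x => aassoc d x m) tau f.

Lemma mtrE x (f : mor (x ▷ m) s) : mtr f = tau ∘ ihcur H f.
Proof. by rewrite /mtr trcE ihadj_curry. Qed.

Lemma mtr_nat x y (f : mor (y ▷ m) s) (u : mor x y) :
  mtr (f ∘ (u ▷₁ idm m)) = mtr f ∘ u.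
Proof. exact: (trc_nat (T := bfixr act m)). Qed.

Lemma mptr_nat a x y (f : mor (y ▷ m) (a ▷ s)) (u : mor x y) :
  mptr (f ∘ (u ▷₁ idm m)) = mptr f ∘ u.
Proof. exact: (ptr_nat (T := bfixr act m)). Qed.

Lemma mptr_act a x (f : mor (x ▷ m) s) :
  mptr ((idm a ▷₁ f) ∘ aassoc a x m) = mrun a ∘ (idm a ⊗₁ mtr f).
Proof. exact: (ptr_act (T := bfixr act m) _ (aassoc_oplax m)). Qed.

Lemma mptr_natr a b x (f : mor (x ▷ m) (a ▷ s)) (v : mor a b) :
  mptr ((v ▷₁ idm s) ∘ f) = v ∘ mptr f.
Proof. exact: (ptr_natr (T := bfixr act m) _ (aassoc_oplax m)). Qed.

Lemma mptr_actM a b x (f : mor (x ▷ m) (a ▷ s)) :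
  mptr (isoinv (aassoc b a s) ∘ ((idm b ▷₁ f) ∘ aassoc b x m)) = idm b ⊗₁ mptr f.
Proof. exact: (ptr_actM (T := bfixr act m) _ (aassoc_oplax m)). Qed.

Lemma mptr_factor a x n (f : mor (x ▷ m) (a ▷ n)) :
  exists y (u : mor x (a ⊗ y)) (g : mor (y ▷ m) n),
    f = (idm a ▷₁ g) ∘ (aassoc a y m ∘ (u ▷₁ idm m)).
Proof.
do 3 eexists; exact: (ptr_factor (T := bfixr act m) (ihadj H m) (aassoc_oplax m)).
Qed.

Lemma mptr_act_comp a x y n (h : mor n s) (g : mor (y ▷ m) n) (u : mor x (a ⊗ y)) :
  mptr ((idm a ▷₁ h) ∘ ((idm a ▷₁ g) ∘ (aassoc a y m ∘ (u ▷₁ idm m)))) =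
  mrun a ∘ ((idm a ⊗₁ mtr (h ∘ g)) ∘ u).
Proof.
by rewrite (cmpA (_ ▷₁ h)) -bmap_fixl (cmpA _ (aassoc _ _ _)) mptr_nat mptr_act -cmpA.
Qed.

Lemma mptr_actM_comp a b x y (g : mor (y ▷ m) (a ▷ s)) (u : mor x (b ⊗ y)) :
  mptr (isoinv (aassoc b a s) ∘ ((idm b ▷₁ g) ∘ (aassoc b y m ∘ (u ▷₁ idm m)))) =
  (idm b ⊗₁ mptr g) ∘ u.
Proof. by rewrite (cmpA (idm b ▷₁ g)) (cmpA _ (_ ∘ _)) mptr_nat mptr_actM. Qed.

(** Composition of internal Homs followed by the functional [tau]. For universal [tau] it is a
    perfect pairing, the one encoded by [serre_phi]. *)
Definition mpair n : mor (ihom H n s ⊗ ihom H m n) 𝟙 :=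
  mtr (ihev H n s ∘ ((idm (ihom H n s) ▷₁ ihev H m n) ∘ aassoc _ _ m)).

Lemma mpair_ihcur n x y (a : mor (x ▷ n) s) (b : mor (y ▷ m) n) :
  mpair n ∘ (ihcur H a ⊗₁ ihcur H b) = mtr (a ∘ ((idm x ▷₁ b) ∘ aassoc x y m)).
Proof.
rewrite -mtr_nat -!cmpA aassoc_natl; congr mtr.
rewrite (cmpA (_ ▷₁ _)) -bmapM cmp1m ihcurK (bmap_lr act (ihcur H a) b).
by rewrite -!cmpA cmpA ihcurK.
Qed.

Lemma mpair_ihcurl n x (a : mor (x ▷ n) s) :
  mpair n ∘ (ihcur H a ⊗₁ idm (ihom H m n)) =
  tau ∘ (ihomr H m a ∘ ihom_actr H x m n).
Proof. by rewrite -{1}ihcur_ev mpair_ihcur mtrE ihomr_ihcur. Qed.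

Lemma mpair_ihcurr n y (b : mor (y ▷ m) n) :
  mpair n ∘ (idm (ihom H n s) ⊗₁ ihcur H b) =
  mtr (ihev H n s ∘ ((idm (ihom H n s) ▷₁ b) ∘ aassoc _ y m)).
Proof. by rewrite -{1}ihcur_ev mpair_ihcur. Qed.

End ModuleTrace.

Arguments mpair {k D M H m s} tau n.

Section SerreOfTrace.
Variables (k : fieldType) (D : ftcat k) (M : modcat D) (H : internal_homs M).
Variables (S : functor M M) (tau : forall m, mor (ihom H m (S m)) (𝟙 : D)).
Hypothesis tauU : forall m n (b : mor (ihom H m n) (𝟙 : D)),
  exists! g : mor n (S m), tau m ∘ ihomr H m g = b.
Hypothesis tau_nat : forall m m' (h : mor m m'),
  tau m' ∘ ihomr H m' (fmap S h) = tau m ∘ ihoml H (S m) h.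

Let psi m n : mor (ihom H n (S m)) ((ihom H m n)^∨) := transpose (mpair (tau m) n).

(** A map w -> (ihom m n)^∨ is a functional on w ⊗ ihom m n ≅ ihom m (w ▷ n), hence by universality
    a map w ▷ n -> S m, hence a map w -> ihom n (S m). *)
Let psi_iso m n : is_iso (psi m n).
Proof.
apply: iso_of_bij => w q.
have ri := ihom_actr_iso H w m n.
have [g [gE gu]] := tauU
  (rdev (ihom H m n) ∘ (q ⊗₁ idm _) ∘ isoinv (ihom_actr H w m n)).
exists (ihcur H g); split.
  apply: rdev_injr; rewrite bmap_fixr cmpA transposeK mpair_ihcurl cmpA gE.
  by rewrite -cmpA isoinvK ?cmpm1.
move=> h hE; rewrite -[h](ihcur_uniq); congr (ihcur H _); apply: gu.
apply: (iso_epic ri); rewrite -!cmpA isoinvK // cmpm1 -mpair_ihcurl ihcur_uniq.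
by rewrite -hE bmap_fixr cmpA transposeK.
Qed.

Let psi_natl m m' n (f : mor m m') :
  dualm (ihoml H n f) ∘ psi m n = psi m' n ∘ ihomr H n (fmap S f).
Proof.
apply: rdev_injr; rewrite (bmap_fixr _ _ (dualm _)) [LHS]cmpA rdev_dualm.
rewrite -[LHS]cmpA -bmap_rl (bmap_lr _ (psi _ _)) [LHS]cmpA transposeK.
rewrite (bmap_fixr _ _ (psi _ _)) [RHS]cmpA transposeK mpair_ihcurr /ihomr.
rewrite -(ihcur_ev H m' n) mpair_ihcur.
rewrite !mtrE -!cmpA -[in RHS]ihomr_ihcur [in RHS]cmpA tau_nat -[in RHS]cmpA.
by rewrite ihoml_ihcur -!cmpA aassoc_nat3 bmap_fixl -!cmpA ihcur_ev.
Qed.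

Let psi_natr m n n' (g : mor n n') :
  dualm (ihomr H m g) ∘ psi m n' = psi m n ∘ ihoml H (S m) g.
Proof.
apply: rdev_injr; rewrite (bmap_fixr _ _ (dualm _)) [LHS]cmpA rdev_dualm.
rewrite -[LHS]cmpA -bmap_rl (bmap_lr _ (psi _ _)) [LHS]cmpA transposeK.
rewrite (bmap_fixr _ _ (psi _ _)) [RHS]cmpA transposeK mpair_ihcurr /ihoml.
rewrite -(ihcur_ev H m n) mpair_ihcur.
by rewrite bmap_fixl -!cmpA.
Qed.

Let psi_act d m n :
  dual_tens d (ihom H m n) ∘ ((psi m n ⊗₁ idm (d^∨)) ∘ ihom_actl H d n (S m)) =
  dualm (ihom_actr H d m n) ∘ psi m (d ▷ n).
Proof.
set W := ihom H (d ▷ n) (S m).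
have ai : is_iso (massoc W d (ihom H m n)) by iso.
apply: rdev_injr; apply: (iso_epic ai).
rewrite rdev_dual_tens (bmap_fixr _ _ (_ ⊗₁ _)) (cmpA (evr _ _)) evr_nat -cmpA.
rewrite ihom_actlE tposeK (bmap_fixr _ _ (psi _ _)) [LHS]cmpA transposeK.
rewrite (bmap_fixr _ _ (dualm _)) (cmpA (rdev _) (dualm _ ⊗₁ _)) rdev_dualm.
rewrite -(cmpA (rdev _)) -bmap_rl (bmap_lr _ (psi _ _)) (cmpA (rdev _)) transposeK.
rewrite mpair_ihcurr -[X in _ ⊗₁ X]ihcur_ev mpair_ihcur -mtr_nat; congr mtr.
rewrite -!cmpA; congr (_ ∘ _); rewrite bmap_fixl -!cmpA.
have := apentagon W d (ihom H m n) m; rewrite -!cmpA => <-.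
by rewrite !cmpA aassoc_nat3.
Qed.

(** The converse of [stau_utrace]: it turns the composite trace on χ ▷ S m into a relative Serre
    functor of _F M, which [pivotal_module] asks for. *)
Definition serre_of_trace : relative_serre H.
Proof.
have isoE m n : is_iso (isoinv (psi m n)) by exact/is_iso_inv/psi_iso.
apply: (@RelativeSerre k D M H S (fun m n => isoinv (psi m n)) isoE).
- by move=> m m' n f; apply: isoinv_square; rewrite ?psi_natl.
- by move=> m n n' g; apply: isoinv_square; rewrite ?psi_natr.
move=> d m n; apply: (iso_epic (psi_iso m (d ▷ n))).
rewrite -[LHS]cmpA isoinvK // cmpm1 -[RHS]cmpA -psi_act -[RHS]cmpA.
rewrite isoinvKl; last exact: dual_tens_iso.
by rewrite [RHS]cmpA -bmap_fixr isoinvK // bmap1 cmp1m.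
Defined.

End SerreOfTrace.

Lemma evr_act (k : fieldType) (D : ftcat k) (M : modcat D) (d y : D) (m : M) :
  evr d y ▷₁ idm m = (idm y ▷₁ aev d m)
    ∘ (aassoc y (d^∨) (d ▷ m) ∘ aassoc (y ⊗ d^∨) d m).
Proof.
rewrite evrE !bmap_fixr aevE !bmap_fixl -!cmpA apentagon -!cmpA.
rewrite (cmpA (_ ▷₁ isoinv _)) -bmap_fixl isoinvK ?bmap1 ?cmp1m; last by iso.
by rewrite (cmpA (_ ▷₁ (rdev _ ▷₁ _))) -aassoc_natl !cmpA atriangle.
Qed.

Lemma tpose_act (k : fieldType) (D : ftcat k) (b x z : D) (t : mor (z ⊗ x) 𝟙) :
  tpose (mrun b ∘ ((idm b ⊗₁ t) ∘ massoc b z x)) = idm b ⊗₁ transpose t.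
Proof.
apply: tpose_uniq; rewrite evrE -!cmpA massoc_nat (cmpA (idm b ⊗₁ _)) -bmap_fixl.
by rewrite transposeK.
Qed.

Section SerreTrace.
Variables (k : fieldType) (D : ftcat k) (M : modcat D) (H : internal_homs M).
Variable S : relative_serre H.
Implicit Types (d x y : D) (m n : M).

Local Notation φ := (serre_phi S).

Let P m n : mor (ihom H n (S m) ⊗ ihom H m n) 𝟙 :=
  locked (rdev (ihom H m n) ∘ (isoinv (φ m n) ⊗₁ idm (ihom H m n))).

Let PE m n : P m n = rdev (ihom H m n) ∘ (isoinv (φ m n) ⊗₁ idm (ihom H m n)).
Proof. by rewrite /P -lock. Qed.

Let unitc n n' (g : mor n n') : mor 𝟙 (ihom H n n') := ihcur H (g ∘ alun n).

(* The functional on ihom m (S m) given by the identity of S m through serre_phi. *)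
Definition stau m : mor (ihom H m (S m)) 𝟙 :=
  locked (P m (S m) ∘ ((ihcur H (alun (S m)) ⊗₁ idm _) ∘ isoinv (mlun _))).

Let stauE m : stau m =
  P m (S m) ∘ ((ihcur H (alun (S m)) ⊗₁ idm _) ∘ isoinv (mlun _)).
Proof. by rewrite /stau -lock. Qed.

Let P_iso m n : is_iso (isoinv (φ m n)).
Proof. exact/is_iso_inv/serre_phi_iso. Qed.

Let P_natr m n n' (g : mor n n') :
  P m n ∘ (ihoml H (S m) g ⊗₁ idm _) = P m n' ∘ (idm _ ⊗₁ ihomr H m g).
Proof.
have E := isoinv_square (serre_phi_iso S m n') (serre_phi_iso S m n)
  (serre_phi_natr S m g).
rewrite !PE -[LHS]cmpA -bmap_fixr E (bmap_fixr _ _ (dualm _)) [LHS]cmpA.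
by rewrite rdev_dualm -!cmpA -bmap_rl -bmap_lr.
Qed.

Let P_natl m m' n (f : mor m m') :
  P m' n ∘ (ihomr H n (fmap S f) ⊗₁ idm _) = P m n ∘ (idm _ ⊗₁ ihoml H n f).
Proof.
have E := isoinv_square (serre_phi_iso S m n) (serre_phi_iso S m' n)
  (serre_phi_natl S n f).
rewrite !PE -[LHS]cmpA -bmap_fixr E (bmap_fixr _ _ (dualm _)) [LHS]cmpA.
by rewrite rdev_dualm -!cmpA -bmap_rl -bmap_lr.
Qed.

Let stau_ihomr m n (g : mor n (S m)) :
  stau m ∘ ihomr H m g = P m n ∘ ((unitc g ⊗₁ idm _) ∘ isoinv (mlun _)).
Proof.
have E := isoinv_square (mlun_iso _) (mlun_iso _) (mlun_nat (ihomr H m g)).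
rewrite stauE -!cmpA E (cmpA (_ ⊗₁ _)) -bmap_lr bmap_rl -!cmpA cmpA -P_natr.
rewrite -!cmpA (cmpA (ihoml _ _ _ ⊗₁ _)) -bmap_fixr ihoml_ihcur.
by rewrite alun_nat.
Qed.

(** A functional on ihom m n is an element of (ihom m n)^∨, which [serre_phi] sends to an element of
    ihom n (S m), that is, to a map n -> S m. *)
Lemma stau_utrace m n (b : mor (ihom H m n) (𝟙 : D)) :
  exists! g : mor n (S m), stau m ∘ ihomr H m g = b.
Proof.
have li := mlun_iso (ihom H m n); have Li := alun_iso n.
pose e := φ m n ∘ transpose (b ∘ mlun (ihom H m n)).
exists (ihev H n (S m) ∘ (e ▷₁ idm n) ∘ isoinv (alun n)); split.
  rewrite stau_ihomr /unitc -cmpA isoinvK // cmpm1 ihcur_uniq PE -cmpA.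
  rewrite (cmpA (_ ⊗₁ _)) -bmap_fixr /e isoinvKl; last exact: serre_phi_iso.
  by rewrite cmpA transposeK -cmpA isoinvKV ?cmpm1.
move=> g gE; rewrite /e -gE; apply: (iso_epic Li); rewrite -[LHS]cmpA isoinvK // cmpm1.
rewrite -[RHS](ihcurK H); congr (_ ∘ (_ ▷₁ _)); rewrite -/(unitc g).
apply: (iso_monic (P_iso m n)); rewrite isoinvKl; last exact: serre_phi_iso.
apply: transpose_uniq; rewrite stau_ihomr PE bmap_fixr -!cmpA isoinvK //.
by rewrite cmpm1.
Qed.

Lemma stau_nat m m' (h : mor m m') :
  stau m' ∘ ihomr H m' (fmap S h) = stau m ∘ ihoml H (S m) h.
Proof.
have E := isoinv_square (mlun_iso _) (mlun_iso _) (mlun_nat (ihoml H (S m) h)).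
rewrite stau_ihomr /unitc -ihomr_ihcur bmap_fixr -!cmpA cmpA P_natl stauE.
by rewrite -!cmpA E (cmpA (_ ⊗₁ _)) (cmpA (_ ⊗₁ idm _)) -bmap_lr -bmap_rl.
Qed.

(** Naturality handles only elements 𝟙 -> ihom n (S m). A generalized element at x is an element of
    ihom (x ▷ n) (S m) moved across [ihom_actl], and [serre_phi_act] is what controls this move. *)
Let P_mpair m n : P m n = mpair (stau m) n.
Proof.
suff Px x (g : mor (x ▷ n) (S m)) :
    P m n ∘ (ihcur H g ⊗₁ idm _) = stau m ∘ (ihomr H m g ∘ ihom_actr H x m n).
  by rewrite -[LHS]cmpm1 -bmap1 -ihcur_ev Px -mpair_ihcurl ihcur_ev bmap1 cmpm1.
have Li := bmap_isor tens (ihom H m n) (mlun_iso x).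
apply: (iso_epic Li); rewrite -[LHS]cmpA -bmap_fixr.
pose j := unitc g; pose e := isoinv (φ m (x ▷ n)) ∘ j.
have jE : j = φ m (x ▷ n) ∘ e by rewrite /e isoinvKVl //; apply: serre_phi_iso.
have AjE : evr x _ ∘ ((ihom_actl H x n (S m) ∘ j) ⊗₁ idm x) = ihcur H g ∘ mlun x.
  by rewrite ihom_actl_ihcur tposeK -cmpA alun_assoc ihcur_natl.
have dE : dual_tens x (ihom H m n) ∘
    ((isoinv (φ m n) ⊗₁ idm (x^∨)) ∘ (ihom_actl H x n (S m) ∘ j)) =
    dualm (ihom_actr H x m n) ∘ e.
  rewrite jE (cmpA (ihom_actl _ _ _ _)) serre_phi_act.
  rewrite -(cmpA (_ ∘ isoinv _)) -(cmpA (φ m n ⊗₁ _)) (cmpA (isoinv _ ⊗₁ _)).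
  rewrite -bmap_fixr isoinvK ?bmap1 ?cmp1m; last exact: serre_phi_iso.
  by rewrite isoinvKVl //; apply: dual_tens_iso.
have := rdev_dual_tens
  ((isoinv (φ m n) ⊗₁ idm (x^∨)) ∘ (ihom_actl H x n (S m) ∘ j)).
rewrite dE (bmap_fixr _ _ (isoinv (φ m n) ⊗₁ _)) [in RHS]cmpA evr_nat -[in RHS]cmpA AjE.
rewrite (bmap_fixr _ _ (isoinv (φ m n))) [in RHS]cmpA  -PE => <-.
rewrite (bmap_fixr _ _ (dualm _)) (cmpA (rdev _)) rdev_dualm -(cmpA (rdev _)).
rewrite -bmap_rl (bmap_lr _ e) (cmpA (rdev _)) /e (bmap_fixr _ _ (isoinv _)).
rewrite (cmpA (rdev _)) -PE.
have PJ : P m (x ▷ n) ∘ (j ⊗₁ idm _) = stau m ∘ ihomr H m g ∘ mlun _.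
  by rewrite stau_ihomr -!cmpA isoinvK ?cmpm1 //; apply: mlun_iso.
rewrite PJ -(cmpA _ (mlun _)) mlun_nat -mlun_assoc.
by rewrite (cmpA (stau m)) (cmpA (stau m ∘ _)) (cmpA _ (mlun _)).
Qed.

(* Partial traces separate morphisms into d^∨∨ ▷ S m, so this formula determines
   the twisted module structure of S by the traces alone. *)
Lemma serre_constr_mptr d m y (f : mor (y ▷ m) (S (d ▷ m))) :
  mptr (stau m) (serre_constr S d m ∘ f) =
  transpose (mtr (stau (d ▷ m)) (f ∘ ((idm y ▷₁ aev d m) ∘ aassoc y (d^∨) (d ▷ m)))).
Proof.
set dd := d^∨^∨; set N := S (d ▷ m); set I := ihom H N (S m).
set X := ihom H m N.
pose j := ihcur H (alun N).
(* [e3] is the element of d^∨∨ ⊗ ihom N (S m) behind the Yoneda definition of [serre_constr]; [eE]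
   states its property with the inverses of [dual_tens] and [ihom_actl] moved to the other side. *)
have [e3 [sE eE]] : exists e3 : mor 𝟙 (dd ⊗ I),
    serre_constr S d m = (idm dd ▷₁ ihev H N (S m)) ∘
      (aassoc dd I N ∘ ((e3 ▷₁ idm N) ∘ isoinv (alun N))) /\
    dualm (ihom_actl H d m N) ∘ (dual_tens X (d^∨)
      ∘ ((idm dd ⊗₁ isoinv (φ m N)) ∘ e3)) = isoinv (φ (d ▷ m) N) ∘ j.
  pose e := isoinv (φ (d ▷ m) N) ∘ j.
  pose e' := isoinv (dualm (ihom_actl H d m N)) ∘ e.
  pose e2 := isoinv (dual_tens X (d^∨)) ∘ e'.
  exists ((idm dd ⊗₁ φ m N) ∘ e2); split.
    rewrite /serre_constr /serre_ihom -/dd -/N -/j -!(cmpA (_ ∘ isoinv _)).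
    rewrite -!(cmpA (_ ∘ _)) -/e -/X -/e' -/e2 -(cmpA (ihom_actr _ _ _ _)).
    by rewrite (bmap_fixr _ _ (ihom_actr _ _ _ _)) (cmpA (ihev _ _ _)) ihcurK -!cmpA.
  rewrite (cmpA (idm dd ⊗₁ _)) -bmap_fixl isoinvK ?bmap1 ?cmp1m; last first.
    exact: serre_phi_iso.
  rewrite /e2 isoinvKVl; last exact: dual_tens_iso.
  by rewrite /e' isoinvKVl //; apply/dualm_iso/ihom_actl_iso.
have ly := mlun_iso y.
(* This brings the composite to the shape required by [mptr_act]. *)
have -> : serre_constr S d m ∘ f =
    (idm dd ▷₁ (ihev H N (S m) ∘ ((idm I ▷₁ f) ∘ aassoc I y m)))
    ∘ aassoc dd (I ⊗ y) m
    ∘ ((massoc dd I y ∘ ((e3 ⊗₁ idm y) ∘ isoinv (mlun y))) ▷₁ idm m).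
  rewrite sE -!cmpA (isoinv_square (alun_iso _) (alun_iso _) (alun_nat f)).
  have -> : isoinv (alun (y ▷ m)) = aassoc 𝟙 y m ∘ (isoinv (mlun y) ▷₁ idm m).
    have Ly := bmap_isor act m ly.
    rewrite bmap_isoinvr // -alun_assoc isoinv_cmp; try by iso.
    by rewrite isoinvKVl //; iso.
  rewrite (cmpA (e3 ▷₁ _)) -bmap_lr (bmap_rl act e3) -!cmpA (cmpA (e3 ▷₁ _)) -aassoc_nat1.
  rewrite (cmpA (aassoc dd I N)) aassoc_nat3 -!cmpA -!bmap_fixr.
  rewrite (cmpA (aassoc dd I _)) apentagon !bmap_fixl -!cmpA.
  by rewrite -!bmap_fixr.
rewrite mptr_nat mptr_act -mpair_ihcurr -P_mpair.
apply: rdev_injr; rewrite transposeK.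
have ji : mtr (stau (d ▷ m)) (f ∘ ((idm y ▷₁ aev d m) ∘ aassoc y (d^∨) (d ▷ m))) =
    rdev (ihom H (d ▷ m) N) ∘ (((isoinv (φ (d ▷ m) N) ∘ j) ⊗₁
    ihcur H (f ∘ ((idm y ▷₁ aev d m) ∘ aassoc y (d^∨) (d ▷ m)))) ∘ isoinv (mlun _)).
  rewrite mtrE stauE -!cmpA.
  rewrite (isoinv_square (mlun_iso _) (mlun_iso _) (mlun_nat (ihcur H _))).
  rewrite PE -!cmpA; congr (_ ∘ _); rewrite !cmpA; congr (_ ∘ _).
  by rewrite -!bmapM !cmpm1 !cmp1m.
(* The evaluation of d undoes the transposition contained in [ihom_actl]. *)
have jq : ihom_actl H d m N ∘
    ihcur H (f ∘ ((idm y ▷₁ aev d m) ∘ aassoc y (d^∨) (d ▷ m))) =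
    ihcur H f ⊗₁ idm (d^∨).
  rewrite ihom_actl_ihcur; apply: tpose_uniq.
  by rewrite evr_nat -ihcur_natl evr_act -!cmpA.
rewrite ji -eE -[ihcur H (f ∘ ((idm y ▷₁ aev d m) ∘ _))]cmp1m bmapM.
rewrite -[in RHS](cmpA (dualm _ ⊗₁ _)) [in RHS](cmpA (rdev _)) rdev_dualm.
rewrite -[in RHS](cmpA (rdev _)) (cmpA (idm _ ⊗₁ ihom_actl _ _ _ _)) -bmapM cmp1m jq.
rewrite (bmap_lr _ (dual_tens X (d^∨) ∘ _)) -[in RHS](cmpA (_ ⊗₁ idm _)).
have -> : (idm 𝟙 ⊗₁ (ihcur H f ⊗₁ idm (d^∨))) ∘ isoinv (mlun (y ⊗ d^∨)) =
    massoc 𝟙 X (d^∨) ∘ (((idm 𝟙 ⊗₁ ihcur H f) ∘ isoinv (mlun y)) ⊗₁ idm (d^∨)).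
  rewrite bmap_fixr (cmpA (massoc _ _ _)) massoc_nat -!cmpA; congr (_ ∘ _).
  rewrite (bmap_isoinvr _ _ ly) -mlun_assoc isoinv_cmp; try by iso.
  by rewrite isoinvKVl //; iso.
rewrite (cmpA (_ ⊗₁ idm (X ⊗ d^∨))) (cmpA (rdev (X ⊗ d^∨))).
rewrite (cmpA (rdev (X ⊗ d^∨)) _ (massoc _ _ _)) rdev_dual_tens -[in RHS]cmpA.
rewrite -bmap_fixr; congr (_ ∘ (_ ⊗₁ _)).
rewrite evrE (bmap_fixr _ _ (idm dd ⊗₁ _)) -!cmpA; congr (_ ∘ _).
rewrite (cmpA (massoc dd (X^∨) X)) massoc_nat -!cmpA.
rewrite (cmpA (idm dd ⊗₁ rdev X)) -bmap_fixl -PE bmap_fixl -!cmpA; congr (_ ∘ _).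
rewrite (cmpA (e3 ⊗₁ _)) -bmap_lr (bmap_rl _ e3 (ihcur H f)) -!cmpA (cmpA (massoc dd I X)).
by rewrite -(bmap1 tens dd I) massoc_nat -!cmpA.
Qed.

(** The version with a spectator b, to be used with b = χ; factoring f reduces it to the previous
    formula. *)
Lemma serre_constr_mptrM b d m y (f : mor (y ▷ m) (b ▷ S (d ▷ m))) :
  mptr (stau m) (isoinv (aassoc b (d^∨^∨) (S m))
    ∘ ((idm b ▷₁ serre_constr S d m) ∘ f)) =
  tpose (mptr (stau (d ▷ m)) (f ∘ ((idm y ▷₁ aev d m) ∘ aassoc y (d^∨) (d ▷ m)))).
Proof.
have [z [u [g ->]]] := mptr_factor H f.
have -> : (idm b ▷₁ g ∘ (aassoc b z m ∘ u ▷₁ idm m))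
    ∘ ((idm y ▷₁ aev d m) ∘ aassoc y (d^∨) (d ▷ m)) =
  (idm b ▷₁ (g ∘ ((idm z ▷₁ aev d m) ∘ aassoc z (d^∨) (d ▷ m))))
    ∘ aassoc b (z ⊗ d^∨) (d ▷ m)
    ∘ ((massoc b z (d^∨) ∘ (u ⊗₁ idm (d^∨))) ▷₁ idm (d ▷ m)).
  rewrite !bmap_fixl !bmap_fixr -!cmpA; congr (_ ∘ _).
  have := apentagon b z (d^∨) (d ▷ m); rewrite -!cmpA => pent.
  rewrite [in RHS](cmpA (aassoc b (z ⊗ d^∨) _)) (cmpA (_ ▷₁ aassoc _ _ _)) -pent.
  rewrite -!cmpA aassoc_nat1 (cmpA (_ ▷₁ (_ ▷₁ _))) -aassoc_nat3 -!cmpA.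
  by congr (_ ∘ _); rewrite !cmpA -bmap_lr -bmap_rl.
rewrite mptr_nat mptr_act (cmpA _ (massoc _ _ _)) tpose_natl -(cmpA (mrun b)).
rewrite tpose_act -serre_constr_mptr -mptr_actM -mptr_nat; congr mptr.
by rewrite bmap_fixl -!cmpA.
Qed.

End SerreTrace.

(** * Tensor functors and duals *)

Section TensorFunctorDuals.
Variables (k : fieldType).

Section Images.
Variables (C D : ftcat k) (F : tensor_functor C D) (x y : C).

Definition tf_im_ev (e : mor (y ⊗ x) 𝟙) : mor (F y ⊗ F x) 𝟙 :=
  locked (isoinv (tf_eps F) ∘ fmap F e ∘ tf_mu F y x).

Definition tf_im_coev (c : mor 𝟙 (x ⊗ y)) : mor 𝟙 (F x ⊗ F y) :=
  locked (isoinv (tf_mu F x y) ∘ (fmap F c ∘ tf_eps F)).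

Lemma tf_zig (e : mor (y ⊗ x) 𝟙) (c : mor 𝟙 (x ⊗ y)) :
  mrun x ∘ (idm x ⊗₁ e) ∘ massoc x y x ∘ (c ⊗₁ idm x) = mlun x ->
  mrun (F x) ∘ (idm (F x) ⊗₁ tf_im_ev e) ∘ massoc (F x) (F y) (F x)
    ∘ (tf_im_coev c ⊗₁ idm (F x)) = mlun (F x).
Proof.
move=> E; rewrite /tf_im_ev /tf_im_coev -!lock !bmap_fixl !bmap_fixr -!cmpA.
have -> : mrun (F x) ∘ (idm (F x) ⊗₁ isoinv (tf_eps F) ∘ (idm (F x) ⊗₁ fmap F e
    ∘ (idm (F x) ⊗₁ tf_mu F y x ∘ (massoc (F x) (F y) (F x)
    ∘ (isoinv (tf_mu F x y) ⊗₁ idm (F x) ∘ (fmap F c ⊗₁ idm (F x)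
    ∘ tf_eps F ⊗₁ idm (F x))))))) =
  fmap F (mrun x) ∘ (fmap F (idm x ⊗₁ e) ∘ (fmap F (massoc x y x)
    ∘ (fmap F (c ⊗₁ idm x) ∘ (tf_mu F 𝟙 x ∘ (tf_eps F ⊗₁ idm (F x)))))).
  have mi a b : is_iso (tf_mu F a b) by exact: tf_mu_iso.
  have R1 : mrun (F x) ∘ (idm (F x) ⊗₁ isoinv (tf_eps F)) =
      fmap F (mrun x) ∘ tf_mu F x 𝟙.
    rewrite -tf_run -!cmpA -bmap_fixl isoinvKV ?bmap1 ?cmpm1 //; iso.
  have R2 : tf_mu F x 𝟙 ∘ (idm (F x) ⊗₁ fmap F e) =
      fmap F (idm x ⊗₁ e) ∘ tf_mu F x (y ⊗ x).
    by rewrite -tf_mu_nat fmap1.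
  have R3 := tf_assoc F x y x.
  have R4 : fmap F (c ⊗₁ idm x) ∘ tf_mu F 𝟙 x =
      tf_mu F (x ⊗ y) x ∘ (fmap F c ⊗₁ idm (F x)).
    by rewrite -tf_mu_nat fmap1.
  rewrite cmpA R1 -!cmpA (cmpA (tf_mu F x 𝟙)) R2 -!cmpA.
  rewrite (cmpA (fmap F (c ⊗₁ _))) R4 -!cmpA; congr (_ ∘ (_ ∘ _)).
  rewrite 2!cmpA -cmpA; move: R3; rewrite -!cmpA => R3.
  rewrite (cmpA (tf_mu F x (y ⊗ x))) (cmpA (tf_mu F x (y ⊗ x) ∘ _)) -(cmpA (tf_mu F x _)).
  by rewrite -R3 -!cmpA (cmpA (tf_mu F x y ⊗₁ _)) -bmap_fixr isoinvKV // bmap1 cmp1m.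
rewrite (cmpA (fmap F (mrun x))) -fmapM (cmpA (fmap F _)) -fmapM.
by rewrite (cmpA (fmap F _)) -fmapM E cmpA tf_lun.
Qed.

End Images.

Variables (C D : ftcat k) (F : tensor_functor C D).

Lemma tf_rdual (x y : C) (e : mor (y ⊗ x) 𝟙) (c : mor 𝟙 (x ⊗ y)) :
  is_rdual e c -> is_rdual (tf_im_ev F e) (tf_im_coev F c).
Proof.
move=> ec; have [z1 z2] := rev_rdual ec; split.
  by apply: tf_zig; case: ec.
exact: (@tf_zig (rev_ft C) (rev_ft D) (rev_fun F) y x e c z1).
Qed.

Lemma rdev_tf_dual (x : C) :
  rdev (F x) ∘ (tf_dual F x ⊗₁ idm (F x)) = tf_im_ev F (rdev x).
Proof. by rewrite /tf_im_ev -lock; apply: transposeK. Qed.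

(** Uniqueness of duals: F carries the duality of x to one of F x by [tf_rdual], and [tf_dual]
    intertwines its evaluation with that of (F x)^∨. *)
Lemma tf_dual_iso (x : C) : is_iso (tf_dual F x).
Proof.
have ec := rev_rdual (tf_rdual (rdualP x)).
have ri := mrun_iso (F x).
have evI w (h : mor w (F (x^∨))) :
    @pm_ev _ _ (premod_reg (rev_mon D)) _ _ (tf_im_ev F (rdev x)) 𝟙
      ∘ ((isoinv (mlun (F (x^∨))) ∘ h) ⊗₁ idm (F x)) =
    tf_im_ev F (rdev x) ∘ (h ⊗₁ idm (F x)).
  rewrite /pm_ev /= isoinvV; last by iso.
  rewrite -mlun_unit cmpA mlun_nat bmap_fixr -!cmpA; congr (_ ∘ _).
  have li := mlun_iso (F (x^∨)).
  by rewrite cmpA mlun_assoc -!bmap_fixr isoinvKVl.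
apply: iso_of_bij => w g.
pose f := rdev (F x) ∘ (g ⊗₁ idm (F x)).
have li := mlun_iso (F (x^∨)).
pose h' := @pm_evK _ _ (premod_reg (rev_mon D)) _ _ _ _ ec 𝟙 w f.
pose h := mlun (F (x^∨)) ∘ ((f ⊗₁ idm (F (x^∨)))
  ∘ @pm_coev _ _ (premod_reg (rev_mon D)) _ _ (tf_im_coev F (rdcoev x)) w).
have hE : tf_im_ev F (rdev x) ∘ (h ⊗₁ idm (F x)) = f.
  by rewrite -evI /h isoinvKl // -{}h'.
exists h; split.
  by apply: rdev_injr; rewrite bmap_fixr cmpA rdev_tf_dual hE.
move=> j jE; have li' := is_iso_inv li; apply: (iso_monic li').
apply: (@pm_ev_inj _ _ (premod_reg (rev_mon D)) _ _ _ _ ec).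
rewrite [LHS]evI [RHS]evI hE /f -jE.
by rewrite (bmap_fixr _ _ (tf_dual F x)) [LHS]cmpA rdev_tf_dual.
Qed.

Lemma evr_coev (X : D) : evr X X ∘ (rdcoev X ⊗₁ idm X) = mlun X.
Proof. by rewrite evrE !cmpA; case: (rdualP X). Qed.

Lemma tf_im_rdcoev (x : C) :
  (idm (F x) ⊗₁ tf_dual F x) ∘ tf_im_coev F (rdcoev x) = rdcoev (F x).
Proof.
apply: evr_inj; rewrite evr_coev evrE bmap_fixr -!cmpA.
rewrite (cmpA (massoc _ _ _)) massoc_nat -!cmpA (cmpA (idm _ ⊗₁ rdev _)) -bmap_fixl.
by rewrite rdev_tf_dual !cmpA; case: (tf_rdual (rdualP x)).
Qed.

Lemma rdcoev_dinat (a b : D) (g : mor a b) :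
  (g ⊗₁ idm (a^∨)) ∘ rdcoev a = (idm b ⊗₁ dualm g) ∘ rdcoev b.
Proof.
apply: evr_inj; rewrite (bmap_fixr _ _ (g ⊗₁ _)) [LHS]cmpA evr_nat -[LHS]cmpA.
rewrite evr_coev -mlun_nat evrE (bmap_fixr _ _ (_ ⊗₁ dualm g)) -[RHS](cmpA (mrun b)).
rewrite -[in RHS](cmpA _ (massoc _ _ _)) (cmpA (massoc b (a^∨) a)) massoc_nat.
rewrite -[in RHS](cmpA _ (massoc _ _ _)) (cmpA (idm b ⊗₁ rdev a)) -bmap_fixl.
rewrite rdev_dualm bmap_fixl -[in RHS](cmpA _ (idm b ⊗₁ (_ ⊗₁ _))).
rewrite (cmpA (idm b ⊗₁ (idm (b^∨) ⊗₁ g))) -massoc_nat -!cmpA bmap1 -bmap_rl.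
by rewrite (bmap_lr _ (rdcoev b)) -evr_coev evrE -!cmpA.
Qed.

Definition tf_ddual (c : C) : mor ((F c)^∨^∨) (F (c^∨^∨)) :=
  locked (isoinv (tf_dual F (c^∨)) ∘ dualm (tf_dual F c)).

Lemma tf_ddualE (c : C) :
  tf_ddual c = isoinv (tf_dual F (c^∨)) ∘ dualm (tf_dual F c).
Proof. by rewrite /tf_ddual -lock. Qed.

Lemma tf_ddual_coev (c : C) :
  (idm _ ⊗₁ tf_ddual c) ∘ rdcoev ((F c)^∨) =
  (tf_dual F c ⊗₁ idm _) ∘ tf_im_coev F (rdcoev (c^∨)).
Proof.
rewrite tf_ddualE bmap_fixl -[LHS]cmpA -rdcoev_dinat -tf_im_rdcoev.
have ti := tf_dual_iso (c^∨).
by rewrite !cmpA -!bmapM !cmpm1 !cmp1m isoinvK.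
Qed.

End TensorFunctorDuals.

Section PhirTranspose.
Variables (k : fieldType) (C D : ftcat k) (F : tensor_functor C D).
Variable R : right_adjoints F.

Lemma tf_mu_coev (y c : C) (X : C) (q : mor 𝟙 (c ⊗ X)) :
  massoc (F y) (F c) (F X) ∘ ((isoinv (tf_mu F y c) ⊗₁ idm (F X))
    ∘ (isoinv (tf_mu F (y ⊗ c) X)
    ∘ fmap F (isoinv (massoc y c X) ∘ ((idm y ⊗₁ q) ∘ isoinv (mrun y))))) =
  (idm (F y) ⊗₁ tf_im_coev F q) ∘ isoinv (mrun (F y)).
Proof.
have ai : is_iso (massoc y c X) by iso.
have mi a b : is_iso (tf_mu F a b) by exact: tf_mu_iso.
rewrite (cmpA (isoinv (tf_mu F y c) ⊗₁ _)) (cmpA (massoc _ _ _)) tf_assoc_inv.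
rewrite -!cmpA -fmapM isoinvKVl // fmapM (cmpA (isoinv (tf_mu F y (c ⊗ X)))).
have E := isoinv_square (mi y 𝟙) (mi y (c ⊗ X)) (tf_mu_nat F (idm y) q).
rewrite fmap1 in E; rewrite E.
have E1 : isoinv (tf_mu F y 𝟙) ∘ fmap F (isoinv (mrun y)) =
    (idm (F y) ⊗₁ tf_eps F) ∘ isoinv (mrun (F y)).
  have ri := mrun_iso y; have rFi := mrun_iso (F y).
  apply: move_isor => //; rewrite -tf_run -!cmpA.
  rewrite (cmpA (fmap F (isoinv _))) -fmapM isoinvK // fmap1 cmp1m isoinvKl //.
rewrite -[in LHS](cmpA _ (isoinv (tf_mu F y 𝟙))) E1 /tf_im_coev -lock !bmap_fixl.
by rewrite -!cmpA.
Qed.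

(** Traces along F convert transposition in D into transposition in C, up to the canonical (F c)^∨∨
    ≅ F (c^∨∨). This links the Serre structures of M and of _F M, both of which are transpositions
    on traces. *)
Lemma phir_tpose (y c : C) (w : mor (F y ⊗ (F c)^∨) (chi R)) :
  phir ((idm (chi R) ⊗₁ tf_ddual F c) ∘ tpose w) =
  transpose (ctrc (w ∘ ((idm (F y) ⊗₁ tf_dual F c) ∘ isoinv (tf_mu F y (c^∨))))).
Proof.
rewrite transposeE (tposeE (ctrc _)) cmpA -phir_act -phir_nat; congr phir.
rewrite tposeE (cmpA (idm (chi R) ⊗₁ _)) -bmap_rl (bmap_lr _ w) !bmap_fixr -!cmpA.
congr (_ ∘ _).
have ai : is_iso (massoc (F y) ((F c)^∨) (F (c^∨^∨))) by iso.
apply: (iso_monic ai).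
rewrite [in RHS](cmpA (massoc _ _ _) (_ ⊗₁ _)) massoc_nat -!cmpA tf_mu_coev.
rewrite (cmpA (massoc _ _ _)) -(bmap1 tens (F y)) massoc_nat -!cmpA.
rewrite isoinvKVl; last by iso.
by rewrite !cmpA -!bmap_fixl tf_ddual_coev.
Qed.

End PhirTranspose.

(** * The relative Serre functor of a twisted module category *)

Section UniversalModuleTrace.
Variables (k : fieldType) (D : ftcat k) (M : modcat D) (H : internal_homs M).
Variables (m s : M) (tau : mor (ihom H m s) (𝟙 : D)).
Hypothesis tauU : forall n (b : mor (ihom H m n) (𝟙 : D)),
  exists! g : mor n s, tau ∘ ihomr H m g = b.

Lemma mtr_inj n (g h : mor n s) :
  (forall x (f : mor (x ▷ m) n), mtr tau (g ∘ f) = mtr tau (h ∘ f)) -> g = h.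
Proof. exact: (@trc_inj _ _ _ (bfixr act m) (ihomF H m) (ihadj H m) _ _ tauU). Qed.

Lemma mtr_ex n (b : mor (ihom H m n) (𝟙 : D)) :
  exists g : mor n s, forall x (f : mor (x ▷ m) n), mtr tau (g ∘ f) = b ∘ ihcur H f.
Proof.
have [g gE] := @trc_ex _ _ _ (bfixr act m) (ihomF H m) (ihadj H m) _ _ tauU n b.
by exists g => x f; rewrite -ihadj_curry -gE.
Qed.

Lemma mptr_inj a n (g h : mor n (a ▷ s)) :
  (forall x (f : mor (x ▷ m) n), mptr tau (g ∘ f) = mptr tau (h ∘ f)) -> g = h.
Proof.
exact: (@ptr_inj _ _ _ (bfixr act m) (ihomF H m) (ihadj H m) _
  (aassoc_oplax m) _ _ tauU).
Qed.

Lemma mptr_ex a n (b : mor (ihom H m n) (a : D)) :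
  exists g : mor n (a ▷ s),
    forall x (f : mor (x ▷ m) n), mptr tau (g ∘ f) = b ∘ ihcur H f.
Proof.
have [g gE] := @ptr_ex _ _ _ (bfixr act m) (ihomF H m) (ihadj H m) _
  (aassoc_oplax m) _ _ tauU a n b.
by exists g => x f; rewrite -ihadj_curry -gE.
Qed.

(** Cyclicity of the trace: h' on the values may be traded for h on the argument. [stau_nat]
    provides the hypothesis with h' = S h. *)
Lemma mptr_swap a m' s' (tau' : mor (ihom H m' s') (𝟙 : D)) (h : mor m m')
    (h' : mor s s') :
  tau' ∘ ihomr H m' h' = tau ∘ ihoml H s h ->
  forall x (f : mor (x ▷ m') (a ▷ s)),
  mptr tau' ((idm a ▷₁ h') ∘ f) = mptr tau (f ∘ (idm x ▷₁ h)).
Proof.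
move=> E x f; have [y [u [g ->]]] := mptr_factor H f.
rewrite (cmpA (_ ▷₁ h')) -bmap_fixl (cmpA _ (aassoc _ _ _)) mptr_nat mptr_act.
rewrite mtrE -ihomr_ihcur (cmpA tau') E -(cmpA tau) ihoml_ihcur -mtrE.
rewrite -!cmpA -bmap_lr (bmap_rl _ u) (cmpA (aassoc _ _ _)) aassoc_nat3 -!cmpA.
by rewrite (cmpA (idm a ▷₁ g)) -bmap_fixl (cmpA _ (aassoc _ _ _)) mptr_nat mptr_act
  -!cmpA.
Qed.

End UniversalModuleTrace.

Section Comparison.
Variables (k : fieldType) (C D : ftcat k) (F : tensor_functor C D).
Variables (R : right_adjoints F) (M : modcat D).
Variables (H : internal_homs M) (S : relative_serre H).
Variable H' : internal_homs (twist F M).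

Local Notation M' := (twist F M).
Local Notation χ := (chi R).

(* The trace of the composite C -> D -> M: first the partial trace of M with
   values in χ, then the trace of F. *)
Definition cmtr m x (f : mor (F x ▷ m) (χ ▷ S m)) : mor x 𝟙 :=
  ctrc (mptr (stau S m) f).

Lemma cmtr_nat m x y (f : mor (F y ▷ m) (χ ▷ S m)) (u : mor x y) :
  cmtr (f ∘ (fmap F u ▷₁ idm m)) = cmtr f ∘ u.
Proof. by rewrite /cmtr mptr_nat ctrc_nat. Qed.

Definition ctau m : mor (ihom H' m (χ ▷ S m : M')) (𝟙 : C) :=
  cmtr (ihev H' m (χ ▷ S m : M')).

Lemma ctau_ihcur m x (f : mor (F x ▷ m) (χ ▷ S m)) :
  ctau m ∘ ihcur H' (f : mor ((x : C) ▷ (m : M')) (χ ▷ S m : M')) = cmtr f.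
Proof.
rewrite -cmtr_nat; congr (cmtr _); exact: (ihcurK H' f).
Qed.

Lemma cmtr_inj m n (g h : mor n (χ ▷ S m)) :
  (forall x (f : mor (F x ▷ m) n), cmtr (g ∘ f) = cmtr (h ∘ f)) -> g = h.
Proof.
move=> E; apply: (mptr_inj (@stau_utrace _ _ _ _ S m)) => x f.
apply: ctrc_inj => y u; rewrite -!mptr_nat -!cmpA; exact: E.
Qed.

Lemma cmtr_ex m n (b : mor (ihom H' m (n : M')) (𝟙 : C)) :
  exists g : mor n (χ ▷ S m), forall x (f : mor (F x ▷ m) n),
    cmtr (g ∘ f) = b ∘ ihcur H' (f : mor ((x : C) ▷ (m : M')) (n : M')).
Proof.
(* A functional for _F M is pulled back along the canonical [κ] from F^ra (ihom m n); then χ and S m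
   represent it in turn. *)
pose X := ihom H m n.
pose κ : mor (ra R X) (ihom H' m (n : M')) :=
  ihcur H' (ihev H m n ∘ (acounit (ra_adj R) X ▷₁ idm m) :
    mor ((ra R X : C) ▷ (m : M')) (n : M')).
have [v vE] := ctrc_ex (b ∘ κ).
have [g gE] := mptr_ex (@stau_utrace _ _ _ _ S m) v.
exists g => x f; rewrite /cmtr gE.
rewrite [LHS]vE -[LHS]cmpA; congr (_ ∘ _).
rewrite /κ -ihcur_natl; congr (ihcur H' _); rewrite /= -cmpA -bmap_fixr.
by rewrite adj_curryK ihcurK.
Qed.

Lemma ctau_utrace m (n : M') (b : mor (ihom H' m n) (𝟙 : C)) :
  exists! g : mor n (χ ▷ S m : M'), ctau m ∘ ihomr H' m g = b.
Proof.
have [g gE] := cmtr_ex b; exists g; split.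
  by rewrite /ihomr ctau_ihcur gE ihcur_ev cmpm1.
move=> h hE; apply: cmtr_inj => x f; rewrite gE -hE -[RHS]ctau_ihcur -cmpA.
by congr (_ ∘ _); apply: ihomr_ihcur.
Qed.

Lemma cmtr_swap m m' (h : mor m m') x (f : mor (F x ▷ m') (χ ▷ S m)) :
  cmtr ((idm χ ▷₁ fmap S h) ∘ f) = cmtr (f ∘ (idm (F x) ▷₁ h)).
Proof. by rewrite /cmtr (mptr_swap (stau_nat S h)). Qed.

Lemma ctau_nat m m' (h : mor m m') :
  ctau m' ∘ ihomr H' m' (fmap (compF (chi_act R M) S) h : mor (χ ▷ S m : M') _) =
  ctau m ∘ ihoml H' (χ ▷ S m : M') h.
Proof.
rewrite /ihomr ctau_ihcur /= cmtr_swap.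
by rewrite -(fmap1 F) /ihoml ctau_ihcur.
Qed.

Lemma twist_aev (c : C) (m : M) :
  aev (M := M') c m = aev (F c) m ∘ (tf_dual F c ▷₁ idm (F c ▷ m)).
Proof.
rewrite !aevE /= /twist_lun /twist_assoc.
have mi := bmap_isor act m (tf_mu_iso F (c^∨) c).
rewrite (bmap_isoinvr act m (tf_mu_iso F (c^∨) c)) isoinv_cmp; try by iso.
rewrite isoinvV // -!cmpA (isoinv_square (aassoc_iso _ _ _) (aassoc_iso _ _ _)
  (aassoc_nat1 (F c) m (tf_dual F c))).
by rewrite (cmpA (rdev (F c) ▷₁ _)) -bmap_fixr rdev_tf_dual /tf_im_ev -lock !bmap_fixr
  -!cmpA.
Qed.

Variable S' : relative_serre H'.

Definition theta_spec (theta : forall m : M, mor (χ ▷ S m) (S' m)) :=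
  forall m x (f : mor (F x ▷ m) (χ ▷ S m)),
  mtr (M := M') (stau S' m) (theta m ∘ f) = cmtr f.

Lemma theta_ex : exists theta, theta_spec theta.
Proof.
have ex m : exists th : mor (χ ▷ S m) (S' m),
    forall x (f : mor (F x ▷ m) (χ ▷ S m)),
    mtr (M := M') (stau S' m) (th ∘ f) = cmtr f.
  have [g gE] := mtr_ex (M := M') (@stau_utrace _ _ _ _ S' m) (ctau m).
  by exists g => x f; rewrite [LHS]gE ctau_ihcur.
by exists (fun m => projT1 (cid (ex m))) => m; case: (cid (ex m)).
Qed.

Variable theta : forall m : M, mor (χ ▷ S m) (S' m).
Hypothesis thetaE : theta_spec theta.

Lemma theta_natural_iso : natural_iso (compF (chi_act R M) S) S' theta.
Proof.
split=> [m m' h|m].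
  apply: (mtr_inj (M := M') (@stau_utrace _ _ _ _ S' m')) => x f.
  rewrite -!cmpA [LHS]thetaE [LHS]cmtr_swap.
  have -> : mtr (M := M') (stau S' m') (fmap S' h ∘ (theta m ∘ f)) =
      mtr (M := M') (stau S' m) (theta m ∘ f ∘ (idm (F x) ▷₁ h)).
    rewrite -(fmap1 F).
    by rewrite !mtrE -ihomr_ihcur -ihoml_ihcur !cmpA stau_nat.
  by rewrite -cmpA [RHS]thetaE.
have [g gE] := cmtr_ex (stau S' m : mor (ihom H' m (S' m : M')) (𝟙 : C)).
exists g; split.
  by apply: cmtr_inj => x f; rewrite -cmpA gE cmp1m -thetaE mtrE.
apply: (mtr_inj (M := M') (@stau_utrace _ _ _ _ S' m)) => x f.
by rewrite -cmpA [LHS]thetaE [LHS]gE cmp1m mtrE.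
Qed.

(** Partial traces of _F M are those of M followed by those of F; this extends [theta_spec] from the
    unit to values in an arbitrary a. *)
Lemma theta_mptr a m x (g : mor (F x ▷ m) (F a ▷ χ ▷ S m)) :
  mptr (M := M') (stau S' m) (((idm a : mor (a : C) a) ▷₁ (theta m : mor (_ : M') _)) ∘ g) =
  phil (mptr (stau S m) (isoinv (aassoc (F a) χ (S m)) ∘ g)).
Proof.
have [y [u [g' ->]]] := mptr_factor H' (g : mor ((x : C) ▷ (m : M')) (a ▷ (χ ▷ S m : M'))).
etransitivity; first exact: (mptr_act_comp (M := M') (H := H')).
rewrite thetaE /= /twist_assoc fmap1 -!cmpA.
rewrite -(bmap_fixr act m (isoinv (tf_mu F a y))).
have -> := mptr_actM_comp (stau S m) g' (isoinv (tf_mu F a y) ∘ fmap F u).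
by rewrite [in RHS]cmpA phil_nat phil_act -cmpA.
Qed.

Lemma theta_module c m :
  serre_constr S' c m ∘ theta (F c ▷ m) =
  (idm (F (c^∨^∨)) ▷₁ theta m) ∘ chi_serre_constr R S c m.
Proof.
apply: (mptr_inj (M := M') (a := c^∨^∨) (@stau_utrace _ _ _ _ S' m)) => y f.
(* The trace formula for S' makes the left side a transposed trace in C. *)
have -> : mptr (M := M') (stau S' m) (serre_constr S' c m ∘ theta (F c ▷ m) ∘ f) =
    transpose (cmtr (f ∘ ((idm (F y) ▷₁ aev (M := M') c m)
      ∘ twist_assoc F (y : C) (c^∨) (F c ▷ m)))).
  rewrite -cmpA; etransitivity.
    exact: (@serre_constr_mptr k C M' H' S' c m y (theta (F c ▷ m) ∘ f)).
  by rewrite -cmpA [in LHS]thetaE /= fmap1.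
set w := mptr (stau S (F c ▷ m))
  (f ∘ ((idm (F y) ▷₁ aev (F c) m) ∘ aassoc (F y) ((F c)^∨) (F c ▷ m))).
have -> : cmtr (f ∘ ((idm (F y) ▷₁ aev (M := M') c m)
      ∘ twist_assoc F (y : C) (c^∨) (F c ▷ m))) =
    ctrc (w ∘ ((idm (F y) ⊗₁ tf_dual F c) ∘ isoinv (tf_mu F y (c^∨)))).
  rewrite /w -mptr_nat; congr (ctrc (mptr _ _)).
  rewrite twist_aev /twist_assoc bmap_fixl bmap_fixr -!cmpA; congr (_ ∘ (_ ∘ _)).
  by rewrite !cmpA aassoc_natl.
(* The transposition is moved into D with χ on the left; the half-braiding then carries χ to the
   right, as in [chi_constr]. *)
rewrite -phir_tpose -phil_braid.
rewrite -[in RHS]cmpA; etransitivity; last first.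
  apply/esym; have := theta_mptr (a := c^∨^∨) (chi_serre_constr R S c m ∘ f).
  by rewrite /= fmap1; apply.
congr phil.
rewrite -serre_constr_mptrM -!mptr_natr; congr (mptr _ _).
rewrite /chi_serre_constr /chi_constr /pullback_serre_constr -tf_ddualE.
have ai : is_iso (aassoc (F (c^∨^∨)) χ (S m)) by iso.
move: (serre_constr S (F c) m) => s.
rewrite -!cmpA isoinvKl //; congr (_ ∘ _).
have bi : is_iso (aassoc χ (F (c^∨^∨)) (S m)) by iso.
have ci : is_iso (aassoc χ ((F c)^∨^∨) (S m)) by iso.
have E := isoinv_square ci bi (aassoc_natl (S m) (idm χ) (tf_ddual F c)).
by rewrite bmap_fixl -!cmpA [RHS]cmpA E -!cmpA.
Qed.

End Comparison.

Lemma serre_comparison_ex (k : fieldType) (C D : ftcat k)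
    (F : tensor_functor C D) (R : right_adjoints F) (M : modcat D)
    (H : internal_homs M) (S : relative_serre H)
    (H' : internal_homs (twist F M)) (S' : relative_serre H') :
  exists theta : forall m : M, mor (chi R ▷ S m) (S' m),
    is_serre_comparison R S S' theta.
Proof.
have [theta thetaE] := theta_ex R S S'; exists theta; split.
  exact: theta_natural_iso thetaE.
by move=> c m; rewrite /= fmap1; apply: theta_module.
Qed.

Section Twisted.
Variables (k : fieldType) (C D : ftcat k) (F : tensor_functor C D).
Variables (R : right_adjoints F) (M : modcat D).

Lemma exact_twist : perfect R -> exact_module M -> exact_module (twist F M).
Proof.
move=> Rex Mex p m pP; apply: Mex.
exact: (ladj_projective (fin_abelian (ft_finite D)) (ra_adj R) Rex).
Qed.

Variable H : internal_homs M.

Definition ihom_twist : internal_homs (twist F M).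
Proof.
apply: (@InternalHoms k C (twist F M) (fun m n => ra R (ihom H m n))
  (fun m n => ihev H m n ∘ (acounit (ra_adj R) (ihom H m n) ▷₁ idm m))
  (fun c m n f => fmap (ra R) (ihcur H f) ∘ aunit (ra_adj R) c)).
  by move=> c m n f; rewrite /= -cmpA -bmap_fixr adj_curryK ihcurK.
move=> c m n g; rewrite /= -cmpA -bmap_fixr ihcur_uniq; exact: adj_uncurryK.
Defined.

Definition serre_twist (S : relative_serre H) : relative_serre ihom_twist :=
  serre_of_trace (M := twist F M) (S := compF (chi_act R M) S)
    (@ctau_utrace _ _ _ F R M H S ihom_twist) (@ctau_nat _ _ _ F R M H S ihom_twist).

Lemma chi_constr_nat c c' (u : mor c c') (m m' : M) (h : mor m m') :
  chi_constr R c' m' ∘ (idm (chi R) ▷₁ (fmap F u ▷₁ h)) =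
  (fmap F u ▷₁ (idm (chi R) ▷₁ h)) ∘ chi_constr R c m.
Proof.
rewrite /chi_constr -!cmpA (isoinv_square (aassoc_iso _ _ _) (aassoc_iso _ _ _)
  (aassoc_nat (idm (chi R)) (fmap F u) h)).
rewrite (cmpA (chi_braid R c' ▷₁ _)) -bmapM cmp1m chi_braid_nat.
rewrite -[X in _ ▷₁ X]cmpm1 bmapM -(cmpA (_ ▷₁ h)).
by rewrite [LHS]cmpA (aassoc_nat (fmap F u) (idm (chi R)) h) -!cmpA.
Qed.

End Twisted.

(** * Pivotal structures and the Frobenius condition *)

Section PivotalTwist.
Variables (k : fieldType) (C D : pivotal_ftcat k) (F : tensor_functor C D).
Hypothesis Fpivotal : pivotal_functor F.
Variables (R : right_adjoints F) (M : modcat D).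
Variables (H : internal_homs M) (S : relative_serre H).
Variables (p : forall m : M, mor m (S m)).
Hypothesis pP : is_pivotal_structure S p.

(** Moving [piv] to the other side replaces the module structure on S by the double-dual one, on
    which the Serre comparison operates. *)
Lemma pivotal_structureE (D' : pivotal_ftcat k) (N : modcat D')
    (HN : internal_homs N) (SN : relative_serre HN)
    (q : forall n : N, mor n (SN n)) (d : D') (n : N) :
  serre_piv SN d n ∘ q (d ▷ n) = (idm d ▷₁ q n) ∘ id_constr N d n <->
  serre_constr SN d n ∘ q (d ▷ n) = piv d ▷₁ q n.
Proof.
have di := piv_iso d; rewrite /serre_piv /id_constr cmpm1 -cmpA.
have Di : is_iso (piv d ▷₁ idm (SN n)) by apply: bmap_isor.
rewrite bmap_isoinvr //; split=> [E|->].
  by rewrite (bmap_lr _ _ (q n)) -E isoinvKVl.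
by rewrite (bmap_lr _ (piv d) (q n)) isoinvKl.
Qed.

Lemma tf_ddual_piv (c : C) : tf_ddual F c ∘ piv (F c) = fmap F (piv c).
Proof.
rewrite tf_ddualE -cmpA Fpivotal isoinvKl //; exact: tf_dual_iso.
Qed.

Lemma chi_serre_constr_piv (c : C) (m : M) :
  chi_serre_constr R S c m ∘ (idm (chi R) ▷₁ p (F c ▷ m)) =
  (fmap F (piv c) ▷₁ (idm (chi R) ▷₁ p m)) ∘ chi_constr R c m.
Proof.
have [_ /(_ (F c) m)/pivotal_structureE pE] := pP.
rewrite -chi_constr_nat /chi_serre_constr /pullback_serre_constr -tf_ddualE.
rewrite -[LHS]cmpA -bmap_fixl -(cmpA (tf_ddual F c ▷₁ _)) pE -bmapM cmp1m.
by rewrite tf_ddual_piv.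
Qed.

Section Comparison.
Variables (H' : internal_homs (twist F M)) (S' : relative_serre H').
Variables (theta : forall m : M, mor (chi R ▷ S m) (S' m)).
Hypothesis thetaP : is_serre_comparison R S S' theta.

(** Thus theta and p identify χ ▷ - with S' as module functors once c^∨∨ is identified with c;
    trivializations of χ ▷ - and pivotal structures of _F M then differ by composition with this
    isomorphism. *)
Lemma serre_comparison_piv (c : C) (m : M) :
  serre_constr S' c m ∘ (theta (F c ▷ m) ∘ (idm (chi R) ▷₁ p (F c ▷ m))) =
  (fmap F (piv c) ▷₁ (theta m ∘ (idm (chi R) ▷₁ p m))) ∘ chi_constr R c m.
Proof.
have [_ /(_ c m) thE] := thetaP; rewrite [in RHS]/= fmap1 in thE.
rewrite cmpA thE -cmpA chi_serre_constr_piv cmpA -bmapM cmp1m //.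
Qed.

Lemma pivotal_structure_of_trivialization (t : forall m : M, mor (chi R ▷ m) m) :
  is_trivialization R M t ->
  is_pivotal_structure (M := twist F M) S'
    (fun m : M => theta m ∘ isoinv (t (S m)) ∘ p m).
Proof.
move=> [[tn ti] tm].
have [[pn pi] _] := pP; have [[thn thi] _] := thetaP.
have tpE m : isoinv (t (S m)) ∘ p m = (idm (chi R) ▷₁ p m) ∘ isoinv (t m).
  exact: (isoinv_square (ti m) (ti (S m)) (tn _ _ (p m))).
split.
  split=> [m m' f|m]; last first.
    exact: (is_iso_cmp (is_iso_cmp (thi m) (is_iso_inv (ti (S m)))) (pi m)).
  have /= := thn _ _ f; have /= := pn _ _ f => pf thf.
  have /= tf := isoinv_square (ti _) (ti _) (tn _ _ (fmap S f)).
  by rewrite /= -cmpA pf cmpA -(cmpA (theta m')) tf (cmpA (theta m')) thf -!cmpA.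
move=> c m; pose q (n : M) := theta n ∘ isoinv (t (S n)) ∘ p n.
apply: (proj2 (@pivotal_structureE C (twist F M) H' S' q c m)); rewrite /q /=.
have tE : chi_constr R c m ∘ isoinv (t (F c ▷ m)) = idm (F c) ▷₁ isoinv (t m).
  have := tm c m; rewrite /id_constr cmp1m /= fmap1 => E.
  apply/esym; apply: (move_isor (ti _)).
  by rewrite E cmpA -bmap_fixl (isoinvK (ti m)) bmap1 cmp1m.
rewrite -(cmpA (theta (F c ▷ m))) tpE (cmpA (theta (F c ▷ m))).
rewrite (cmpA (serre_constr S' c m)) serre_comparison_piv -(cmpA (_ ▷₁ _)).
rewrite tE -bmapM cmpm1.
by rewrite -!cmpA tpE.
Qed.

Lemma trivialization_of_pivotal_structure (q : forall m : M, mor m (S' m)) :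
  is_pivotal_structure (M := twist F M) S' q ->
  is_trivialization R M
    (fun m => isoinv (q m) ∘ (theta m ∘ (idm (chi R) ▷₁ p m))).
Proof.
move=> [[qn qi] qm].
have [[pn pi] _] := pP; have [[thn thi] _] := thetaP.
split.
  split=> [m m' f|m]; last first.
    exact: (is_iso_cmp (is_iso_inv (qi m))
      (is_iso_cmp (thi m) (bmap_isol act (chi R) (pi m)))).
  have /= pf := pn _ _ f; have /= thf := thn _ _ f; have /= qf := qn _ _ f.
  rewrite /= -!cmpA -bmap_fixl pf bmap_fixl (cmpA (theta m')) thf -!cmpA.
  by apply: cmp_eq2; exact: (isoinv_square (qi m) (qi m') qf).
move=> c m; rewrite /id_constr cmp1m.
have /= sq := proj1 (@pivotal_structureE C (twist F M) H' S' q c m) (qm c m).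
(* By [sq] this composite is the action of isomorphisms, so the inverse of q can be cancelled before
   comparing. *)
have mono : is_mono (serre_constr S' c m ∘ q (F c ▷ m)).
  apply: iso_monic; rewrite sq.
  exact: (bmap_iso act (fmap_iso F (piv_iso c)) (qi m)).
apply: mono; rewrite -[LHS]cmpA (isoinvKVl _ (qi (F c ▷ m))) serre_comparison_piv sq /= fmap1.
by rewrite [RHS]cmpA -bmapM cmpm1 (isoinvKVl _ (qi m)).
Qed.

End Comparison.

Lemma pivotal_twist_of_frobenius (Rperfect : perfect R) (Mexact : exact_module M) :
  frobenius_wrt R M -> pivotal_module (twist F M).
Proof.
move=> [t tP]; split; first exact: exact_twist Rperfect Mexact.
have [theta thetaP] := serre_comparison_ex R S (serre_twist R S).
exists (ihom_twist R H), (serre_twist R S).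
by eexists; exact: (pivotal_structure_of_trivialization thetaP tP).
Qed.

Lemma frobenius_of_pivotal_twist : pivotal_module (twist F M) -> frobenius_wrt R M.
Proof.
move=> [_ [H' [S' [q qP]]]].
have [theta thetaP] := serre_comparison_ex R S S'.
by eexists; exact: (trivialization_of_pivotal_structure thetaP qP).
Qed.

End PivotalTwist.

(** * Triviality of the relative modular object of a ⊗-Frobenius functor *)

Section Frobenius.
Variables (k : fieldType) (C D : ftcat k) (F : tensor_functor C D).
Variables (R : right_adjoints F) (L : left_adjoint F).
Variable t : forall d, mor (L d) (ra R d).
Hypothesis t_nat : natural_iso L (ra R) t.

(* F ≅ F^rra by uniqueness of right adjoints, from F^la ≅ F^ra. *)
Definition rra_iso (x : C) : mor (F x) (rra R x) :=
  locked (fmap (rra R) (acounit (la_adj L) x ∘ isoinv (t (F x)))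
    ∘ aunit (rra_adj R) (F x)).

Let ti d : is_iso (t d).
Proof. by case: t_nat. Qed.

Let tn d d' (f : mor d d') : isoinv (t d') ∘ fmap (ra R) f = fmap L f ∘ isoinv (t d).
Proof. by apply: isoinv_square => //; case: t_nat. Qed.

Lemma rra_iso_counit x w (h : mor w (F x)) :
  acounit (rra_adj R) x ∘ fmap (ra R) (rra_iso x ∘ h) =
  acounit (la_adj L) x ∘ (fmap L h ∘ isoinv (t w)).
Proof.
rewrite fmapM cmpA /rra_iso -lock adj_curryK -cmpA tn //.
Qed.

Lemma rra_iso_counit1 x : acounit (rra_adj R) x ∘ fmap (ra R) (rra_iso x) =
  acounit (la_adj L) x ∘ isoinv (t (F x)).
Proof. by have := rra_iso_counit (idm (F x)); rewrite cmpm1 fmap1 cmp1m. Qed.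

Lemma rra_iso_iso x : is_iso (rra_iso x).
Proof.
apply: iso_of_bij => w g.
(* Transpose g along F^ra ⊣ F^rra, pass from F^ra to F^la by t, and transpose back along F^la ⊣
   F. *)
exists (fmap F (acounit (rra_adj R) x ∘ fmap (ra R) g ∘ t w) ∘ aunit (la_adj L) w).
split.
  apply: (adj_inj (adj := rra_adj R)); rewrite rra_iso_counit cmpA adj_curryK.
  by rewrite -cmpA isoinvKV ?cmpm1.
move=> h <-; rewrite rra_iso_counit -!cmpA isoinvK // cmpm1.
exact: adj_uncurryK.
Qed.

Lemma rra_iso_nat x y (f : mor x y) :
  rra_iso y ∘ fmap F f = fmap (rra R) f ∘ rra_iso x.
Proof.
apply: (adj_inj (adj := rra_adj R)); rewrite rra_iso_counit fmapM cmpA.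
rewrite -(acounit_nat (la_adj L)) [RHS]cmpA -(acounit_nat (rra_adj R)) -!cmpA.
by rewrite rra_iso_counit1.
Qed.

Hypothesis t_left : forall c d,
  t (F c ⊗ d) = ra_left R c d ∘ (idm c ⊗₁ t d) ∘ la_left L c d.

Lemma rra_iso_left c x :
  rra_left R c x ∘ (idm (F c) ⊗₁ rra_iso x) = rra_iso (c ⊗ x) ∘ tf_mu F c x.
Proof.
apply: (adj_inj (adj := rra_adj R)).
rewrite rra_iso_counit (fmapM (ra R) (rra_left R c x)) [LHS]cmpA rra_left_counit.
have rn := oplax_natl (ra_left_oplax R) c (rra_iso x); rewrite /= fmap1 in rn.
rewrite -[LHS]cmpA rn [LHS]cmpA -bmap_fixl.
rewrite rra_iso_counit1.
(* Precomposing with t removes its inverse on the right and lets [t_left] rewrite it on the left. *)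
apply: (iso_epic (ti (F c ⊗ F x))).
rewrite -[RHS]cmpA -[in RHS](cmpA (fmap L _)) isoinvK // cmpm1 t_left.
rewrite -[LHS]cmpA -(cmpA (ra_left R c (F x))) (isoinvKl _ (ra_left_iso R c (F x))).
rewrite [LHS]cmpA -bmap_fixl -cmpA isoinvK // cmpm1 /la_left cmpA acounit_nat.
rewrite -cmpA -fmapM; congr (_ ∘ fmap L _).
by rewrite cmpA -tf_mu_nat fmap1 -cmpA -bmap_fixl adj_triR bmap1 cmpm1.
Qed.

End Frobenius.

Section ChiTrivial.
Variables (k : fieldType) (C D : ftcat k) (F : tensor_functor C D).
Variables (R : right_adjoints F) (L : left_adjoint F).

Lemma chi_trivial : tensor_frobenius R L ->
  exists v : mor 𝟙 (chi R), is_iso v /\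
    forall c : C, chi_braid R c ∘ (v ⊗₁ idm (F c)) =
      (idm (F c) ⊗₁ v) ∘ (isoinv (mrun (F c)) ∘ mlun (F c)).
Proof.
move=> [t [t_nat t_left t_right]].
have ui := rra_iso_iso t_nat; have un := rra_iso_nat t_nat.
have ul := rra_iso_left t_nat t_left.
(* The right-handed compatibility is [rra_iso_left] for the reversed categories, where the right
   condition on t becomes the left one. *)
have ur (x c : C) : rra_right R x c ∘ (rra_iso t x ⊗₁ idm (F c)) =
    rra_iso t (x ⊗ c) ∘ tf_mu F x c.
  exact: (@rra_iso_left k (rev_ft C) (rev_ft D) (rev_fun F) (rev_right_adjoints R)
    (rev_left_adjoint L) t t_nat (fun c d => t_right d c) c x).
exists (rra_iso t 𝟙 ∘ tf_eps F); split.
  by apply: is_iso_cmp => //; apply: tf_eps_iso.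
move=> c; apply: (iso_monic (rra_left_iso R c 𝟙)).
rewrite [LHS]cmpA rra_left_chi_braid -(cmpA (fmap (rra R) _)) bmap_fixr.
rewrite (cmpA (rra_right R 𝟙 c)) ur -!(cmpA (rra_iso t _)) cmpA -un -cmpA.
rewrite bmap_fixl -(cmpA (idm (F c) ⊗₁ _)) [RHS]cmpA ul -[RHS]cmpA; congr (_ ∘ _).
rewrite fmapM -!cmpA -tf_lun; have ri := mrun_iso c.
rewrite (cmpA (idm (F c) ⊗₁ _)) (cmpA (tf_mu F c 𝟙)).
have -> : tf_mu F c 𝟙 ∘ (idm (F c) ⊗₁ tf_eps F ∘ isoinv (mrun (F c))) =
    fmap F (isoinv (mrun c)).
  rewrite fmap_isoinv //; have rF := mrun_iso (F c).
  rewrite cmpA; apply/esym/move_isor => //.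
  by rewrite -tf_run -!cmpA isoinvKl //; apply: fmap_iso.
by rewrite -!cmpA.
Qed.

Lemma frobenius_wrt_of_tensor_frobenius (M : modcat D) :
  tensor_frobenius R L -> frobenius_wrt R M.
Proof.
move=> /chi_trivial[v [vi vc]].
have viV := is_iso_inv vi.
exists (fun m => alun m ∘ (isoinv v ▷₁ idm m)); split.
  split=> [m n f|m]; last exact: (is_iso_cmp (@alun_iso k D M m) (bmap_isor (@act k D M) m viV)).
  by rewrite /= -cmpA -bmap_lr bmap_rl !cmpA alun_nat.
move=> c m; rewrite /id_constr cmp1m /= fmap1.
(* Precomposing with v turns the trivialization into v itself, so the braiding identity [vc]
   applies. *)
have Vi : is_iso (v ▷₁ idm (F c ▷ m)) by apply: bmap_isor.
apply: (iso_epic Vi); rewrite -[LHS]cmpA -bmap_fixr isoinvK // bmap1 cmpm1.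
rewrite /chi_constr -!cmpA.
rewrite (isoinv_square (aassoc_iso _ _ _) (aassoc_iso _ _ _) (aassoc_nat1 (F c) m v)).
rewrite (cmpA (chi_braid R c ▷₁ _)) -bmap_fixr vc bmap_fixr -!cmpA.
rewrite (cmpA (aassoc _ _ _)) aassoc_natl -!cmpA.
rewrite [RHS]cmpA -bmap_fixl -cmpA -bmap_fixr isoinvK // bmap1 cmpm1.
rewrite [RHS]cmpA atriangle [RHS]cmpA -bmap_fixr isoinvKVl; last by iso.
by rewrite -alun_assoc -cmpA isoinvKV ?cmpm1 //; iso.
Qed.

End ChiTrivial.

Theorem proposition4p24 (k : closedFieldType) (C D : pivotal_ftcat k)
  (F : tensor_functor C D) (R : right_adjoints F)
  (Fperfect : perfect R) (Fpivotal : pivotal_functor F)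
  (M : modcat D) (Mexact : exact_module M)
  (H : internal_homs M) (S : relative_serre H)
  (p : forall m : M, mor m (S m)) (pP : is_pivotal_structure S p) :
  [/\ pivotal_module (twist F M) <-> frobenius_wrt R M,
      forall (H' : internal_homs (twist F M)) (S' : relative_serre H'),
        (exists theta : forall m : M, mor (chi R ▷ S m) (S' m),
           is_serre_comparison R S S' theta) /\
        (forall (theta : forall m : M, mor (chi R ▷ S m) (S' m))
                (t : forall m : M, mor (chi R ▷ m) m),
           is_serre_comparison R S S' theta -> is_trivialization R M t ->
           is_pivotal_structure (M := twist F M) S'
             (fun m : M => theta m ∘ isoinv (t (S m)) ∘ p m))
    & forall L : left_adjoint F,
        tensor_frobenius R L -> pivotal_module (twist F M)].
Proof.
have pivotal_of_frob := pivotal_twist_of_frobenius Fpivotal pP Fperfect Mexact.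
split.
- by split=> [|//]; exact: (frobenius_of_pivotal_twist Fpivotal R pP).
- move=> H' S'; split; first exact: serre_comparison_ex.
  by move=> theta t thetaP; apply: pivotal_structure_of_trivialization.
- by move=> L Lfrob; apply/pivotal_of_frob/(frobenius_wrt_of_tensor_frobenius M Lfrob).
Qed.
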